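(* Let $X$ be a point process on $\mathbb{R}^d$ with intensity $\rho$, isotropic pair correlation function $g$ and normalized joint intensities $g^{(3)},g^{(4)}$, observed through the windows $W_n=\times_{i=1}^d[-na_i,na_i]$. Let $\hat g_{o,n}(r;b)=\sum_{k=1}^\infty b_k(\psi_n)\hat\theta_{k,n}\phi_k(r-r_{\min})$ be the orthogonal series estimator of $g(r)$, $r_{\min}<r<r_{\min}+R$, as defined in the context. Assume: (V1) there exist $0<\rho_{\min}<\rho_{\max}<\infty$ such that $\rho_{\min}\le\rho(u)\le\rho_{\max}$ for all $u\in\mathbb{R}^d$; (V2) there are constants $C_2,C_3<\infty$ such that for all $h,h_1,h_2\in B_{r_{\min}}^R$, $g(h)\,w(\|h\|-r_{\min})\le C_2\|h\|^{d-1}$ and $g^{(3)}(h_1,h_2)\le C_3$; (V3) there is a constant $C_4<\infty$ such that $\sup_{h_1,h_2\in B_{r_{\min}}^R}\int_{\mathbb{R}^d}\big|g^{(4)}(h_1,h_3,h_2+h_3)-g(h_1)g(h_2)\big|\,\mathrm{d}h_3\le C_4$; (S1) $B=\sup_{k,\psi}|b_k(\psi)|<\infty$ and $\sum_{k=1}^\infty|b_k(\psi)|<\infty$ for all $\psi$; (S2) $\psi_n\to\psi^*$ for some $\psi^*$, and $\lim_{\psi\to\psi^*}\max_{1\le k\le m}|b_k(\psi)-1|=0$ for all $m\ge1$; (S3) $|W_n|^{-1}\sum_{k=1}^\infty|b_k(\psi_n)|\to0$ as $n\to\infty$. Then the mean integrated squared error of $\hat g_{o,n}$ tends to zero: $$\mathrm{sa}_d\int_{r_{\min}}^{r_{\min}+R}E\big\{\hat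 g_{o,n}(r;b)-g(r)\big\}^2\,w(r-r_{\min})\,\mathrm{d}r\longrightarrow0\quad\text{as }n\to\infty.$$
   Context: Point process setting. $X$ is a locally finite random subset of $\mathbb{R}^d$, $d\ge1$. For $k\ge1$ its $k$'th order joint intensity $\rho^{(k)}$ is defined by $E\{\sum_{u_1,\ldots,u_k\in X}^{\neq}\mathbf{1}(u_1\in A_1,\ldots,u_k\in A_k)\}=\int_{A_1\times\cdots\times A_k}\rho^{(k)}(v_1,\ldots,v_k)\,\mathrm{d}v_1\cdots\mathrm{d}v_k$ for bounded $A_i\subset\mathbb{R}^d$, where $\sum^{\neq}$ denotes the sum over pairwise distinct points; $\rho=\rho^{(1)}$ is the intensity function. Set $g^{(k)}(v_1,\ldots,v_k)=\rho^{(k)}(v_1,\ldots,v_k)/\{\rho(v_1)\cdots\rho(v_k)\}$. The pair correlation function is $g=g^{(2)}$, assumed isotropic: with abuse of notation $g(u,v)=g(v-u)=g(\|v-u\|)$. For $k=3,4$, $g^{(k)}$ is assumed translation invariant, and with abuse of notation $g^{(k)}(v_1,\ldots,v_k)=g^{(k)}(v_2-v_1,\ldots,v_k-v_1)$. The intensity $\rho$ is treated as known in the estimators. Notation. $R>0$ and $r_{\min}\ge0$ are fixed; $a_1,\ldots,a_d>0$ are fixed; $W_n=\times_{i=1}^d[-na_i,na_i]$; $|A|$ is the Lebesgue measure of $A$; $\mathrm{sa}_d$ is the surface area of the unit sphere in $\mathbb{R}^d$; $A_h=\{u-h:u\in A\}$; $B_{r_{\min}}^R=\{h\in\mathbb{R}^d: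 r_{\min}<\|h\|<r_{\min}+R\}$; $e_n(h)=|W_n\cap(W_n)_h|/|W_n|$; $X_{W_n}=X\cap W_n$ ($n$ is large enough that $e_n>0$ on $B_{r_{\min}}^R$). Orthogonal series. $w\ge0$ is a weight function on $(0,R)$ and $\{\phi_k\}_{k\ge1}$ is an orthonormal basis of functions on $(0,R)$ with respect to $w$, i.e. $\int_0^R\phi_k(r)\phi_l(r)w(r)\,\mathrm{d}r=\mathbf{1}(k=l)$. It is assumed that $g(\cdot+r_{\min})$ is square integrable on $(0,R)$ with respect to $w(r)\,\mathrm{d}r$, so that $g(r)=\sum_{k=1}^\infty\theta_k\phi_k(r-r_{\min})$ on $(r_{\min},r_{\min}+R)$, with $\theta_k=\int_0^Rg(r+r_{\min})\phi_k(r)w(r)\,\mathrm{d}r$. The estimator of $\theta_k$ is $$\hat\theta_{k,n}=\frac{1}{\mathrm{sa}_d|W_n|}\sum_{\substack{u,v\in X_{W_n}\\ v-u\in B_{r_{\min}}^R}}^{\neq}\frac{\phi_k(\|v-u\|-r_{\min})\,w(\|v-u\|-r_{\min})}{\rho(u)\rho(v)\|v-u\|^{d-1}e_n(v-u)}.$$ Smoothing scheme. $b(\psi)=\{b_k(\psi)\}_{k\ge1}$ is a family of real sequences indexed by a smoothing parameter $\psi$ (e.g. $b_k(\psi)=\mathbf{1}(k\le K)$ with $\psi=K$, in which case $\psi^*=\infty$), and $\psi_n$, $n\ge1$, is a sequence of smoothing parameters; the limit $\psi^*$ may be an ideal point such as $\infty$. The series defining $\hat g_{o,n}$ is understood as converging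 in the space of functions square integrable with respect to $w$.
   Formalization: The weight function w is additionally assumed integrable on (0,R), since for non-integrable w the variance of the coefficient estimators can be infinite and the claim fails; the joint intensities are read as locally integrable. *)

(* Defs.v *)
From HB Require Import structures.
From mathcomp Require Import all_boot all_order all_algebra.
From mathcomp Require Import all_classical all_reals all_analysis measurable_realfun.

Set Implicit Arguments.
Unset Strict Implicit.
Unset Printing Implicit Defensive.

Import Order.TTheory GRing.Theory Num.Theory.
Import numFieldNormedType.Exports.

Local Open Scope classical_set_scope.
Local Open Scope ring_scope.

Definition box (T : Type) (k : nat) (A : 'I_k -> set T) : set (k.-tuple T) :=
  [set t : k.-tuple T | forall i, A i (tnth t i)].

Definition tuple_cons (T : Type) (k : nat) (p : T * k.-tuple T) : k.+1.-tuple T :=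
  [tuple of p.1 :: p.2].

(* k-fold product of mu with itself on k.-tuple T *)
Fixpoint measure_power d (T : measurableType d) (R : realType)
    (mu : set T -> \bar R) (k : nat) : set (k.-tuple T) -> \bar R :=
  if k is k'.+1 then
    pushforward (mu \x @measure_power d T R mu k')%E (@tuple_cons T k')
  else \d_[tuple].
Arguments measure_power {d T R} mu k A.

Lemma product_sigma_finite d1 d2 (T1 : measurableType d1)
    (T2 : measurableType d2) (R : realType)
    (m1 : {sigma_finite_measure set T1 -> \bar R})
    (m2 : {sigma_finite_measure set T2 -> \bar R}) :
  sigma_finite setT (m1 \x m2)%E.
Proof.
have /sigma_finiteP[F [TF ndF Foo]] := sigma_finiteT m1.
have /sigma_finiteP[G [TG ndG Goo]] := sigma_finiteT m2.
exists (fun n => F n `*` G n).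
  rewrite -setXTT TF TG predeqE => -[x y]; split.
    move=> [/= [n _ Fnx] [k _ Gky]]; exists (maxn n k) => //; split.
    - by move: x Fnx; exact/subsetPset/ndF/leq_maxl.
    - by move: y Gky; exact/subsetPset/ndG/leq_maxr.
  by move=> [n _ []/= ? ?]; split; exists n.
move=> k; have [? ?] := Foo k; have [? ?] := Goo k.
split; first exact: measurableX.
by rewrite product_measure1E// lte_mul_pinfty// ge0_fin_numE.
Qed.

Section measure_power.
Context d (T : measurableType d) (R : realType).
Context (mu : {sigma_finite_measure set T -> \bar R}).

Lemma measurable_tuple_cons k :
  measurable_fun [set: T * k.-tuple T] (@tuple_cons T k).
Proof. exact: measurable_cons measurable_fst measurable_snd. Qed.

Lemma measurable_tuple_uncons k :
  measurable_fun [set: k.+1.-tuple T]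
    (fun t : k.+1.-tuple T => (thead t, [tuple of behead t] : k.-tuple T)).
Proof.
apply/measurable_fun_pairP; split => /=.
  exact: measurable_tnth.
exact: measurable_behead.
Qed.

Lemma measure_power_ex k : exists m : {sigma_finite_measure set (k.-tuple T) -> \bar R},
  measure_power mu k = m :> (set (k.-tuple T) -> \bar R).
Proof.
elim: k => [|k [m IH]]; first by exists \d_[tuple].
pose f := @tuple_cons T k.
have mf : measurable_fun setT f := measurable_tuple_cons (k := k).
pose nu : {measure set (k.+1.-tuple T) -> \bar R} :=
  measure_function_pushforward__canonical__measure_function_Measure
    (mu \x m)%E mf.
have sf : sigma_finite setT nu.
  have [F FT mF] := product_sigma_finite mu m.
  pose f' (t : k.+1.-tuple T) := (thead t, [tuple of behead t] : k.-tuple T).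
  have f'K : cancel f f'.
    by move=> [x t]; rewrite /f' /f /tuple_cons /= theadE; congr pair; exact/val_inj.
  exists (fun n => f' @^-1` F n); first by rewrite -preimage_bigcup -FT preimage_setT.
  move=> n; have [mFn Fnoo] := mF n; split.
    by rewrite -[X in measurable X]setTI; exact: measurable_tuple_uncons.
  rewrite /nu /= /pushforward -comp_preimage.
  by rewrite (_ : f' \o f = id)//; apply/funext => x; exact: f'K.
pose X := Measure_isSigmaFinite.Build _ _ _ nu sf.
pose nu' : {sigma_finite_measure set (k.+1.-tuple T) -> \bar R} :=
  HB.pack (nu : set _ -> \bar R) (Measure.on nu) X.
by exists nu'; rewrite /= IH.
Qed.

Let mp0 k : measure_power mu k set0 = 0%E.
Proof. by have [m ->] := measure_power_ex k; exact: measure0. Qed.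

Let mp_ge0 k A : (0 <= measure_power mu k A)%E.
Proof. by have [m ->] := measure_power_ex k; exact: measure_ge0. Qed.

Let mp_sigma k : semi_sigma_additive (measure_power mu k).
Proof.
by have [m ->] := measure_power_ex k; exact: measure_semi_sigma_additive.
Qed.

HB.instance Definition _ k := isMeasure.Build _ _ _ (measure_power mu k)
  (mp0 k) (@mp_ge0 k) (@mp_sigma k).

Let mp_sigma_finite k : sigma_finite setT (measure_power mu k).
Proof. by have [m ->] := measure_power_ex k; exact: sigma_finiteT. Qed.

HB.instance Definition _ k := Measure_isSigmaFinite.Build _ _ _
  (measure_power mu k) (@mp_sigma_finite k).

Lemma measure_power_box k (A : 'I_k -> set T) : (forall i, measurable (A i)) ->
  measure_power mu k (box A) = (\prod_(i < k) mu (A i))%E.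
Proof.
have mbox j (B : 'I_j -> set T) : (forall i, measurable (B i)) ->
    measurable (box B).
  move=> mB; have -> : box B =
      \big[setI/setT]_(i < j) ((fun t => tnth t i) @^-1` B i).
    by rewrite -bigcap_seq; apply/seteqP; split => [t Bt i _|t Bt i];
      [exact: Bt|exact: (Bt i (mem_index_enum i))].
  apply: bigsetI_measurable => i _; rewrite -[X in measurable X]setTI.
  exact: measurable_tnth.
elim: k A => [|k IH] A mA.
  by rewrite big_ord0 /= diracE mem_set// => -[].
rewrite big_ord_recl /= -IH// /pushforward -product_measure1E//; last first.
  by apply: (mbox k (fun i => A (lift ord0 i))) => i; exact: mA.
congr (_ _); apply/seteqP; split => [[x t] /= At|[x t] [/= A0 At] i].
  split; first exact: (At ord0).
  by move=> i; have := At (lift ord0 i); rewrite tnthS.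
case: (unliftP ord0 i) => [j ->|->//]; by rewrite tnthS; exact: At.
Qed.

End measure_power.

Definition rV_display : measure_display -> measure_display.
Proof. exact. Qed.

Section measurable_rV.
Context (R : realType) (d : nat).

Let coor (i : 'I_d) (x : 'rV[R]_d) : R := x ord0 i.

Let rV_set0 : g_sigma_preimage coor set0.
Proof. exact: sigma_algebra0. Qed.

Let rV_setC A : g_sigma_preimage coor A -> g_sigma_preimage coor (~` A).
Proof. exact: sigma_algebraC. Qed.

Let rV_bigcup (F : _^nat) : (forall i, g_sigma_preimage coor (F i)) ->
  g_sigma_preimage coor (\bigcup_i (F i)).
Proof. exact: sigma_algebra_bigcup. Qed.

(* The Borel sigma-algebra of R^d, generated by the coordinates. *)
HB.instance Definition _ := @isMeasurable.Build (rV_display default_measure_display)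
  'rV[R]_d (g_sigma_preimage coor) rV_set0 rV_setC rV_bigcup.

End measurable_rV.

Section lebesgue_rV.
Context (R : realType) (d : nat).

Definition row_of_tuple (t : d.-tuple (measurableTypeR R)) : 'rV[R]_d := \row_i tnth t i.

(* Lebesgue measure on R^d: the d-fold product of the one on R *)
Definition lebesgue_rV : set 'rV[R]_d -> \bar R :=
  pushforward (measure_power (@lebesgue_measure R) d) row_of_tuple.

Lemma measurable_coord (i : 'I_d) : measurable_fun setT (fun x : 'rV[R]_d => x ord0 i).
Proof.
move=> _ A mA; rewrite setTI; apply: sub_sigma_algebra.
rewrite -bigcup_seq; exists i; first exact: mem_index_enum.
by exists A => //; rewrite setTI.
Qed.

Lemma measurable_fun_rV d0 (T : measurableType d0) (f : T -> 'rV[R]_d) :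
  (forall i, measurable_fun setT (fun t => f t ord0 i)) -> measurable_fun setT f.
Proof.
move=> mf; apply: (@measurability _ _ _ _ _ _ 
  (\big[setU/set0]_(i < d) preimage_set_system setT (fun x : 'rV[R]_d => x ord0 i) measurable)).
  by [].
move=> _ [B + <-]; rewrite -bigcup_seq => -[i _ [A mA <-]].
by rewrite setTI setTI; have := mf i measurableT A mA; rewrite setTI.
Qed.

Lemma measurable_row_of_tuple : measurable_fun setT row_of_tuple.
Proof.
apply: measurable_fun_rV => i; rewrite /row_of_tuple.
by under eq_fun do rewrite mxE; exact: measurable_tnth.
Qed.


Lemma lebesgue_rV_ex : exists m : {sigma_finite_measure set 'rV[R]_d -> \bar R},
  lebesgue_rV = m :> (set 'rV[R]_d -> \bar R).
Proof.
pose m0 : {sigma_finite_measure set (d.-tuple (measurableTypeR R)) -> \bar R} :=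
  measure_power (@lebesgue_measure R) d.
pose nu : {measure set 'rV[R]_d -> \bar R} :=
  measure_function_pushforward__canonical__measure_function_Measure
    m0 measurable_row_of_tuple.
have sf : sigma_finite setT nu.
  have [F FT mF] := sigma_finiteT m0.
  pose f' (x : 'rV[R]_d) : d.-tuple (measurableTypeR R) := [tuple x ord0 i | i < d].
  have f'K : cancel row_of_tuple f'.
    by move=> t; apply: eq_from_tnth => i; rewrite tnth_mktuple mxE.
  have mf' : measurable_fun setT f'.
    apply/measurable_fun_tnthP => i.
    rewrite (_ : _ \o f' = fun x => x ord0 i); first exact: measurable_coord.
    by apply/funext => x /=; rewrite tnth_mktuple.
  exists (fun n => f' @^-1` F n); first by rewrite -preimage_bigcup -FT preimage_setT.
  move=> n; have [mFn Fnoo] := mF n; split.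
    by rewrite -[X in measurable X]setTI; exact: mf'.
  rewrite /nu /= /pushforward -comp_preimage.
  by rewrite (_ : f' \o row_of_tuple = id)//; apply/funext => x; exact: f'K.
pose X := Measure_isSigmaFinite.Build _ _ _ nu sf.
pose nu' : {sigma_finite_measure set 'rV[R]_d -> \bar R} :=
  HB.pack (nu : set _ -> \bar R) (Measure.on nu) X.
by exists nu'.
Qed.

Let leb0 : lebesgue_rV set0 = 0%E.
Proof. by have [m ->] := lebesgue_rV_ex; exact: measure0. Qed.

Let leb_ge0 A : (0 <= lebesgue_rV A)%E.
Proof. by have [m ->] := lebesgue_rV_ex; exact: measure_ge0. Qed.

Let leb_sigma : semi_sigma_additive lebesgue_rV.
Proof. by have [m ->] := lebesgue_rV_ex; exact: measure_semi_sigma_additive. Qed.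

HB.instance Definition _ := isMeasure.Build _ _ _ lebesgue_rV
  leb0 leb_ge0 leb_sigma.

Let leb_sigma_finite : sigma_finite setT lebesgue_rV.
Proof. by have [m ->] := lebesgue_rV_ex; exact: sigma_finiteT. Qed.

HB.instance Definition _ := Measure_isSigmaFinite.Build _ _ _ lebesgue_rV
  leb_sigma_finite.

Lemma lebesgue_rV_box (A : 'I_d -> set R) : (forall i, measurable (A i)) ->
  lebesgue_rV [set x | forall i, A i (x ord0 i)] =
  (\prod_(i < d) lebesgue_measure (A i))%E.
Proof.
move=> mA; rewrite -(@measure_power_box _ (measurableTypeR R) R lebesgue_measure d A mA).
rewrite /lebesgue_rV /pushforward.
by congr (measure_power _ _ _); apply/seteqP; split => t /= At i;
  have := At i; rewrite mxE.
Qed.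

End lebesgue_rV.
Arguments lebesgue_rV {R d} A.

(* Euclidean norm: the library norm `|x| on 'rV[R]_d is the sup norm. *)
Definition enorm (R : realType) (d : nat) (x : 'rV[R]_d) : R :=
  Num.sqrt (\sum_(i < d) x ord0 i ^+ 2).

Definition volume (R : realType) (d : nat) (A : set 'rV[R]_d) : R :=
  fine (lebesgue_rV A).

(* Surface measure of a subset E of the unit sphere, as d times the volume of
   the truncated cone over E. *)
Definition surface_measure (R : realType) (d : nat) (E : set 'rV[R]_d) : R :=
  d%:R * volume [set s *: x | s in `]0, 1] & x in E].

Definition sphere_area (R : realType) (d : nat) : R :=
  surface_measure [set x : 'rV[R]_d | enorm x = 1].

(* Bounded sets are the same for the sup norm and the Euclidean norm. *)
Definition locally_finite (R : realType) (d : nat) (A : set 'rV[R]_d) : Prop :=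
  forall B : set 'rV[R]_d, bounded_set B -> finite_set (A `&` B).

Definition point_process (R : realType) (d : nat) (dO : measure_display)
    (Omega : measurableType dO) (X : Omega -> set 'rV[R]_d) : Prop :=
  (forall omega, locally_finite (X omega)) /\
  (forall B : set 'rV[R]_d, measurable B -> bounded_set B ->
    measurable_fun setT ((fun omega => counting (X omega `&` B)) : Omega -> \bar R)).

Definition distinct_tuples (T : eqType) (k : nat) (A : set T) : set (k.-tuple T) :=
  [set t : k.-tuple T | uniq t /\ forall i, A (tnth t i)].
Arguments distinct_tuples {T} k A.

(* rho is a k-th order joint intensity of X.  The defining identity is one
   between finite quantities: rho is integrable on bounded boxes. *)
Definition joint_intensity (R : realType) (d : nat) (dO : measure_display)
    (Omega : measurableType dO) (P : probability Omega R)
    (X : Omega -> set 'rV[R]_d) (k : nat) (rho : k.-tuple 'rV[R]_d -> R) : Prop :=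
  [/\ measurable_fun setT rho,
      forall t, 0 <= rho t
    & forall A : 'I_k -> set 'rV[R]_d,
        (forall i, measurable (A i) /\ bounded_set (A i)) ->
        (\int[P]_omega (\esum_(t in distinct_tuples k (X omega))
            (\prod_(i < k) \1_(A i) (tnth t i))%:E)
         = \int[measure_power lebesgue_rV k]_(t in box A) (rho t)%:E)%E
        /\ (\int[measure_power lebesgue_rV k]_(t in box A) (rho t)%:E < +oo)%E].

Definition intensity (R : realType) (d : nat)
    (rho : forall k, k.-tuple 'rV[R]_d -> R) (u : 'rV[R]_d) : R :=
  rho 1%N [tuple u].

Definition normalized_intensity (R : realType) (d : nat)
    (rho : forall k, k.-tuple 'rV[R]_d -> R) (k : nat) (t : k.-tuple 'rV[R]_d) : R :=
  rho k t / \prod_(i < k) intensity rho (tnth t i).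

Definition window (R : realType) (d : nat) (a : 'I_d -> R) (n : nat) :
    set 'rV[R]_d :=
  [set u | forall i, - (n%:R * a i) <= u ord0 i <= n%:R * a i].

Definition translate (R : realType) (d : nat) (A : set 'rV[R]_d) (h : 'rV[R]_d) :
    set 'rV[R]_d :=
  [set u - h | u in A].

Definition annulus (R : realType) (d : nat) (rmin rlen : R) : set 'rV[R]_d :=
  [set h | rmin < enorm h < rmin + rlen].

(* e_n(h), for W = W_n *)
Definition edge_correction (R : realType) (d : nat) (W : set 'rV[R]_d)
    (h : 'rV[R]_d) : R :=
  volume (W `&` translate W h) / volume W.

(* Weight functions are measurable, nonnegative and of finite total mass. *)
Definition weight_function (R : realType) (rlen : R) (w : R -> R) : Prop :=
  [/\ measurable_fun `]0, rlen[ w,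
      forall r, 0 < r < rlen -> 0 <= w r
    & (\int[lebesgue_measure]_(r in `]0%R, rlen[) (w r)%:E < +oo)%E].

Definition L2w (R : realType) (rlen : R) (w f : R -> R) : Prop :=
  measurable_fun `]0, rlen[ f /\
  (\int[lebesgue_measure]_(r in `]0%R, rlen[) (f r ^+ 2 * w r)%:E < +oo)%E.

Definition L2w_coef (R : realType) (rlen : R) (w f phi : R -> R) : R :=
  \int[lebesgue_measure]_(r in `]0, rlen[) (f r * phi r * w r).

(* Orthonormal (Hilbert) basis {phi_k}, k >= 1, of L^2(]0, rlen[, w(r) dr);
   the value of phi at index 0 plays no role. *)
Definition orthonormal_basis (R : realType) (rlen : R) (w : R -> R)
    (phi : nat -> R -> R) : Prop :=
  [/\ forall k, (1 <= k)%N -> measurable_fun `]0, rlen[ (phi k),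
      forall k l, (1 <= k)%N -> (1 <= l)%N ->
        (\int[lebesgue_measure]_(r in `]0%R, rlen[) (phi k r * phi l r * w r)%:E
         = ((k == l)%:R)%:E)%E
    & forall f, L2w rlen w f ->
        (\int[lebesgue_measure]_(r in `]0%R, rlen[)
           ((f r - \sum_(1 <= k < m.+1) L2w_coef rlen w f (phi k) * phi k r) ^+ 2
            * w r)%:E)%E @[m --> \oo] --> 0%E].

(* Estimator of the k-th coefficient from the points A of the process; phi
   stands for phi_k and W for W_n. *)
Definition theta_hat (R : realType) (d : nat) (rho : 'rV[R]_d -> R)
    (rmin rlen : R) (w phi : R -> R) (W A : set 'rV[R]_d) : R :=
  (sphere_area R d * volume W)^-1 *
  \sum_(p \in [set p : 'rV[R]_d * 'rV[R]_d |
      [/\ (A `&` W) p.1, (A `&` W) p.2, p.1 <> p.2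
        & annulus rmin rlen (p.2 - p.1)]])
    (phi (enorm (p.2 - p.1) - rmin) * w (enorm (p.2 - p.1) - rmin) /
     (rho p.1 * rho p.2 * enorm (p.2 - p.1) ^+ d.-1 *
      edge_correction W (p.2 - p.1))).

(* G omega is, almost surely, the sum of the series of general term
   c k omega * phi_k(r - rmin), k >= 1, in L^2(]rmin, rmin + rlen[, w(r - rmin) dr);
   joint measurability makes expectations at fixed r meaningful. *)
Definition L2w_series_sum (R : realType) (dO : measure_display)
    (Omega : measurableType dO) (P : probability Omega R)
    (rmin rlen : R) (w : R -> R) (phi : nat -> R -> R) (c : nat -> Omega -> R)
    (G : Omega -> R -> R) : Prop :=
  measurable_fun ([set: Omega] `*` `]rmin, rmin + rlen[)
    (fun p : Omega * R => G p.1 p.2) /\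
  {ae P, forall omega,
    (\int[lebesgue_measure]_(r in `]rmin, (rmin + rlen)%R[)
       ((G omega r - \sum_(1 <= k < m.+1) c k omega * phi k (r - rmin)) ^+ 2
        * w (r - rmin))%:E)%E @[m --> \oo] --> 0%E}.

(* The sum of such a series: a version of the limit, which is unique up to
   null sets, and 0 when the series diverges. *)
Definition L2w_series (R : realType) (dO : measure_display)
    (Omega : measurableType dO) (P : probability Omega R)
    (rmin rlen : R) (w : R -> R) (phi : nat -> R -> R) (c : nat -> Omega -> R) :
    Omega -> R -> R :=
  xget (fun _ _ => 0) [set G | L2w_series_sum P rmin rlen w phi c G].

(* Orthogonal series estimator built from W = W_n and b = b(psi_n) *)
Definition orthogonal_series_estimator (R : realType) (d : nat)
    (dO : measure_display) (Omega : measurableType dO) (P : probability Omega R)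
    (X : Omega -> set 'rV[R]_d) (rho : 'rV[R]_d -> R) (rmin rlen : R)
    (w : R -> R) (phi : nat -> R -> R) (b : nat -> R) (W : set 'rV[R]_d) :
    Omega -> R -> R :=
  L2w_series P rmin rlen w phi
    (fun k omega => b k * theta_hat rho rmin rlen w (phi k) W (X omega)).

Definition MISE (R : realType) (d : nat) (dO : measure_display)
    (Omega : measurableType dO) (P : probability Omega R)
    (rmin rlen : R) (w g : R -> R) (ghat : Omega -> R -> R) : \bar R :=
  ((sphere_area R d)%:E *
   \int[lebesgue_measure]_(r in `]rmin, (rmin + rlen)%R[)
     ('E_P[fun omega => ((ghat omega r - g r) ^+ 2)%R] * (w (r - rmin))%:E))%E.

(* Main.v *)
(* The mean square error of the estimator of theta_k is O(1/|W_n|), uniformly in k.  The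
   square of the double sum over pairs of points splits, according to coincidences between
   the points, into sums over distinct quadruples, triples and pairs, whose means are given
   by Campbell's formula; (V3) compares the quadruple sum with the squared mean, and (V2)
   bounds the other two, which have one factor |W_n| less.  By orthonormality the integrated
   squared error is controlled by the sum over k of E(b_k thetahat_k - theta_k)^2, which is
   at most C/|W_n| times the sum of |b_k|, plus twice the sum of (b_k - 1)^2 theta_k^2.  The
   first part vanishes by (S3), the second by dominated convergence, using Parseval, (S1)
   and (S2).  Since thetahat_k has bounded first moments and the sum of |b_k| is finite, the
   series defining the estimator converges almost surely. *)
Require Import Defs.
From HB Require Import structures.
From mathcomp Require Import all_boot all_order all_algebra finmap ring lra.
From mathcomp Require Import all_classical all_reals all_analysis measurable_realfun.

Set Implicit Arguments.
Unset Strict Implicit.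
Unset Printing Implicit Defensive.

Import Order.TTheory GRing.Theory Num.Theory.
Import numFieldNormedType.Exports.

Local Open Scope classical_set_scope.
Local Open Scope ring_scope.

(** * Mixtures and densities of measures *)

Lemma mixture_measure_ex d d' (X : measurableType d) (Y : measurableType d')
    (R : realType) (mu : {measure set X -> \bar R})
    (k : X -> {measure set Y -> \bar R}) :
    (forall U, measurable U -> measurable_fun [set: X] (k ^~ U)) ->
  exists nu : {measure set Y -> \bar R}, forall U, (nu U = \int[mu]_x k x U)%E.
Proof.
move=> mk; pose f U := (\int[mu]_x k x U)%E.
have f0 : f set0 = 0%E by rewrite /f integral0_eq.
have f_ge0 U : (0 <= f U)%E by exact: integral_ge0.
have f_sigma : semi_sigma_additive f.
  move=> F mF tF mUF.
  have -> : f (\bigcup_n F n) = (\sum_(i <oo) f (F i))%E.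
    rewrite /f -integral_nneseries//; last by move=> n; exact: mk.
    by apply: eq_integral => x _; rewrite measure_semi_bigcup.
  by apply: is_cvg_nneseries => n _ _; exact: f_ge0.
pose nu : {measure set Y -> \bar R} :=
  HB.pack f (isMeasure.Build _ _ _ f f0 f_ge0 f_sigma).
by exists nu.
Qed.

Section mixture.
Local Open Scope ereal_scope.
Context d d' (X : measurableType d) (Y : measurableType d') (R : realType).
Variables (mu : {measure set X -> \bar R}) (k : X -> {measure set Y -> \bar R}).
Hypothesis mk : forall U, measurable U -> measurable_fun [set: X] (k ^~ U).
Variable nu : {measure set Y -> \bar R}.
Hypothesis nuE : forall U, measurable U -> nu U = \int[mu]_x k x U.

Import HBNNSimple.

Let integral_mixture_nnsfun (f : {nnsfun Y >-> R}) :
  \int[nu]_y (f y)%:E = \int[mu]_x \int[k x]_y (f y)%:E.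
Proof.
have mf r : measurable (f @^-1` [set r]) by [].
have sint (m : {measure set Y -> \bar R}) :
    \int[m]_y (f y)%:E = \sum_(r \in range f) r%:E * m (f @^-1` [set r]).
  by rewrite integralT_nnsfun sintegralE.
rewrite sint; under [RHS]eq_integral do rewrite sint.
rewrite ge0_integral_fsum//; last 2 first.
- by move=> r; apply: measurable_funeM; exact: mk.
- by move=> r x _; exact: nnsfun_mulemu_ge0.
apply: eq_fsbigr => r _; have [r0|r0] := leP 0%R r.
  by rewrite ge0_integralZl ?nuE// ?lee_fin//; exact: mk.
rewrite integral0_eq ?preimage_nnfun0 ?measure0 ?mule0//.
by move=> x _; rewrite measure0 mule0.
Qed.

Lemma integral_mixture (f : Y -> \bar R) : (forall y, 0 <= f y) ->
  measurable_fun [set: Y] f ->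
  \int[nu]_y f y = \int[mu]_x \int[k x]_y f y.
Proof.
move=> f0 mf; pose f_ := nnsfun_approx measurableT mf.
have mf_ n : measurable_fun setT (fun y => (f_ n y)%:E) by exact/measurable_EFinP.
have f_0 n y : 0 <= (f_ n y)%:E by rewrite lee_fin.
have ndf_ y : {homo (fun n => (f_ n y)%:E) : m n / (m <= n)%N >-> m <= n}.
  by move=> m n mn; rewrite lee_fin; exact/lefP/nd_nnsfun_approx.
have approx (m : {measure set Y -> \bar R}) :
    \int[m]_y f y = limn (fun n => \int[m]_y (f_ n y)%:E).
  rewrite -monotone_convergence//.
  by apply: eq_integral => y _; apply/esym/cvg_lim => //; exact: cvg_nnsfun_approx.
rewrite approx; under eq_fun do rewrite integral_mixture_nnsfun.
rewrite -monotone_convergence//.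
- by apply: eq_integral => x _; rewrite approx.
- by move=> n; exact: measurable_fun_integral_kernel.
- by move=> n x _; exact: integral_ge0.
- by move=> x _ m n mn; apply: ge0_le_integral => // y _; exact: ndf_.
Qed.

End mixture.

Lemma integral_density d (T : measurableType d) (R : realType)
    (mu nu : {measure set T -> \bar R}) (p : T -> R) :
    (forall x, 0 <= p x) -> measurable_fun setT p ->
    (forall U, measurable U -> nu U = \int[mu]_(x in U) (p x)%:E)%E ->
  forall f : T -> \bar R, (forall x, 0 <= f x)%E -> measurable_fun setT f ->
  (\int[nu]_x f x = \int[mu]_x ((p x)%:E * f x))%E.
Proof.
move=> p0 mp nuE f f0 mf.
pose k x : {measure set T -> \bar R} := mscale (NngNum (p0 x)) (\d_x).
have kE x U : k x U = (p x * \1_U x)%:E.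
  by rewrite /k /= /mscale /= diracE indicE EFinM.
rewrite (@integral_mixture _ _ _ _ _ mu k)//.
- apply: eq_integral => x _; rewrite ge0_integral_mscale//.
  by rewrite integral_dirac// diracT mul1e.
- move=> U mU; apply: (eq_measurable_fun (fun x => (p x * \1_U x)%:E)).
    by move=> x _; rewrite kE.
  exact/measurable_EFinP/measurable_funM.
- move=> U mU; rewrite nuE// integral_mkcond; apply: eq_integral => x _.
  by rewrite kE patchE indicE; case: ifP; rewrite ?mulr1 ?mulr0.
Qed.

Section density_measure.
Local Open Scope ereal_scope.
Context d (T : measurableType d) (R : realType).
Variables (mu : {measure set T -> \bar R}) (p : T -> R).
Hypotheses (p0 : forall x, (0 <= p x)%R) (mp : measurable_fun setT p).

Lemma density_measure_ex : exists nu : {measure set T -> \bar R},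
  forall U, nu U = \int[mu]_(x in U) (p x)%:E.
Proof.
pose f U := \int[mu]_(x in U) (p x)%:E.
have f0 : f set0 = 0 by rewrite /f integral_set0.
have f_ge0 U : 0 <= f U by apply: integral_ge0 => x _; rewrite lee_fin.
have f_sigma : semi_sigma_additive f.
  move=> F mF tF mUF; rewrite /f ge0_integral_bigcup//; last 2 first.
  - exact/measurable_EFinP/measurable_funTS.
  - by move=> x _; rewrite lee_fin.
  by apply: is_cvg_nneseries => n _ _; exact: f_ge0.
pose nu : {measure set T -> \bar R} :=
  HB.pack f (isMeasure.Build _ _ _ f f0 f_ge0 f_sigma).
by exists nu.
Qed.

End density_measure.

(* The class [B] need not contain the whole space, so boxes of bounded sets qualify. *)
Lemma measurable_boxes d d' (rT : measurableType d) (aT : measurableType d')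
    (n : nat) (f : 'I_n -> aT -> rT) (B : set (set rT)) (K : nat -> set rT) :
    (measurable : set (set aT)) = g_sigma_preimage f ->
    B `<=` measurable -> (forall A m, measurable A -> B (A `&` K m)) ->
    (forall m p, (m <= p)%N -> K m `<=` K p) -> \bigcup_m K m = setT ->
  (measurable : set (set aT)) =
  <<s [set [set x | forall i, A i (f i x)] | A in [set A | forall i, B (A i)]] >>.
Proof.
move=> mE Bm BK ndK KT; apply/seteqP; split; last first.
  apply: smallest_sub; first exact: sigma_algebra_measurable.
  move=> _ [A /= BA <-].
  have -> : [set x | forall i, A i (f i x)] =
      \big[setI/setT]_(i < n) (f i @^-1` A i).
    by rewrite -bigcap_seq; apply/seteqP; split => [t Bt i _|t Bt i];
      [exact: Bt|exact: (Bt i (mem_index_enum i))].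
  apply: bigsetI_measurable => i _; rewrite mE; apply: sub_sigma_algebra.
  rewrite -bigcup_seq; exists i; first exact: mem_index_enum.
  by exists (A i); [exact: Bm|rewrite setTI].
rewrite mE; apply: smallest_sub; first exact: smallest_sigma_algebra.
move=> S; rewrite -bigcup_seq => -[i _ [A mA <-]]; rewrite setTI.
have KP x : exists m, K m x by have : [set: rT] x by []; rewrite -KT => -[m _]; exists m.
pose C m j := (if j == i then A else setT) `&` K m.
have -> : f i @^-1` A = \bigcup_m [set x | forall j, C m j (f j x)].
  apply/seteqP; split => [x Ax|x [m _ /(_ i)]]; last by rewrite /C eqxx => -[].
  have [h hK] := choice (fun j => KP (f j x)).
  exists (\max_j h j) => // j; split; first by case: eqP => // ->.
  by apply: ndK (hK j); exact: leq_bigmax.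
apply: sigma_algebra_bigcup => m; apply: sub_sigma_algebra; exists (C m) => // j.
by apply: BK; case: ifP.
Qed.

Section rV_measure.
Context (R : realType) (d : nat).

Lemma lebesgue_measure_affine (c h : R) (A : set R) : 0 < c -> measurable A ->
  (c%:E * lebesgue_measure [set x | A (c * x + h)%R] = lebesgue_measure A)%E.
Proof.
move=> c0 mA; pose f (x : measurableTypeR R) : measurableTypeR R := c * x + h.
have mf : measurable_fun setT f by apply: measurable_funD => //; exact: measurable_funM.
pose nu : {measure set (measurableTypeR R) -> \bar R} :=
  mscale (NngNum (ltW c0))
   (measure_function_pushforward__canonical__measure_function_Measure
     (@lebesgue_measure R) mf).
rewrite [RHS](@lebesgue_measure_unique R nu)// => _ [[a b] _ <-] /=.
rewrite /nu /= /mscale /pushforward /=.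
have fE : f @^-1` `]a, b] = `](a - h) / c, (b - h) / c]%classic.
  apply/seteqP; split => x; rewrite /= !in_itv/= /f ltr_pdivrMr// ler_pdivlMr//;
  rewrite ltrBlDr lerBrDr mulrC; exact.
rewrite /preimage/= in fE; rewrite [X in (_ * lebesgue_measure X)%E]fE.
rewrite !lebesgue_measure_itv/= !lte_fin ltr_pM2r ?invr_gt0// ltrD2r.
case: ifPn => _; last by rewrite mule0.
by rewrite -!EFinB -EFinM; congr (_%:E); field; rewrite gt_eqF.
Qed.

Lemma measurable_rV_box (A : 'I_d -> set R) : (forall i, measurable (A i)) ->
  measurable [set x : 'rV[R]_d | forall i, A i (x ord0 i)].
Proof.
move=> mA.
have -> : [set x : 'rV[R]_d | forall i, A i (x ord0 i)] =
    \big[setI/setT]_(i < d) ((fun x : 'rV[R]_d => x ord0 i) @^-1` A i).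
  by rewrite -bigcap_seq; apply/seteqP; split => [t Bt i _|t Bt i];
    [exact: Bt|exact: (Bt i (mem_index_enum i))].
apply: bigsetI_measurable => i _; rewrite -[X in measurable X]setTI.
exact: measurable_coord.
Qed.

Definition cube (m : nat) : set 'rV[R]_d := [set x | forall i, - m%:R <= x ord0 i <= m%:R].

Lemma measurable_cube m : measurable (cube m).
Proof.
apply: (measurable_rV_box (A := fun=> `[- m%:R, m%:R]%classic)) => i.
exact: measurable_itv.
Qed.

Lemma lebesgue_rV_cube_lty m : (lebesgue_rV (cube m) < +oo)%E.
Proof.
pose K : set R := `[- m%:R, m%:R]%classic.
have mK : measurable K by exact: measurable_itv.
rewrite -ge0_fin_numE//.
have := lebesgue_rV_box (fun _ : 'I_d => mK) => /= ->.
apply: (big_ind (fun x : \bar R => x \is a fin_num)) => //; first exact: fin_numM.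
by move=> i _; rewrite lebesgue_measure_itv/=; case: ifP.
Qed.

Lemma lebesgue_rV_unique (nu : {measure set 'rV[R]_d -> \bar R}) :
    (forall A : 'I_d -> set R, (forall i, measurable (A i)) ->
      nu [set x | forall i, A i (x ord0 i)] =
      (\prod_(i < d) lebesgue_measure (A i))%E) ->
  forall S, measurable S -> lebesgue_rV S = nu S.
Proof.
move=> nuE S mS; pose K m : set R := `[- m%:R, m%:R]%classic.
have mK m : measurable (K m) by exact: measurable_itv.
apply: (measure_unique [set [set x : 'rV[R]_d | forall i, A i (x ord0 i)] |
  A in [set A | forall i, measurable (A i)]] cube) => //.
- apply: (measurable_boxes (K := K)) => //.
  + by move=> A m mA; exact: measurableI.
  + move=> m p mp x; rewrite /K /= !in_itv/= => /andP[mx xm].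
    have : m%:R <= p%:R :> R by rewrite ler_nat.
    by move=> ?; apply/andP; split; lra.
  + apply/seteqP; split => // x _; exists (Num.truncn `|x|).+1 => //.
    by rewrite /K /= in_itv/= -ler_norml ltW// truncnS_gt.
- move=> _ _ [A mA <-] [B mB <-]; exists (fun i => A i `&` B i).
    by move=> i; exact: measurableI.
  by apply/seteqP; split => [x ABx|x [Ax Bx] i]; [split => i; case: (ABx i)|].
- by move=> m; exists (fun=> K m).
- apply/seteqP; split => // x _; exists (\max_i (Num.truncn `|x ord0 i|).+1) => // i.
  rewrite -ler_norml (le_trans (ltW (truncnS_gt _)))// ler_nat.
  by rewrite (@leq_bigmax _ (fun i => (Num.truncn `|x ord0 i|).+1)).
- by move=> _ [A mA <-]; rewrite nuE//; exact: lebesgue_rV_box.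
- exact: lebesgue_rV_cube_lty.
Qed.

Lemma lebesgue_rV_affine (c : R) (h : 'rV[R]_d) (S : set 'rV[R]_d) :
  0 < c -> measurable S ->
  ((c ^+ d)%:E * lebesgue_rV [set x | S (c *: x + h)%R] = lebesgue_rV S)%E.
Proof.
move=> c0 mS; pose f (x : 'rV[R]_d) : 'rV[R]_d := c *: x + h.
have mf : measurable_fun setT f.
  apply: measurable_fun_rV => i; rewrite /f; under eq_fun do rewrite !mxE.
  by apply: measurable_funD => //; apply: measurable_funM => //; exact: measurable_coord.
pose nu : {measure set 'rV[R]_d -> \bar R} :=
  mscale (NngNum (exprn_ge0 d (ltW c0)))
   (measure_function_pushforward__canonical__measure_function_Measure
     (@lebesgue_rV R d) mf).
rewrite [RHS](@lebesgue_rV_unique nu)// => A mA.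
transitivity ((c ^+ d)%:E * lebesgue_rV
    [set x | forall i, [set y | A i (c * y + h ord0 i)%R] (x ord0 i)])%E.
  congr (_ * lebesgue_rV _)%E.
  by apply/seteqP; split => x Ax i; have := Ax i; rewrite /f !mxE.
rewrite (@lebesgue_rV_box _ _ (fun i => [set y | A i (c * y + h ord0 i)%R])); last first.
  move=> i; rewrite -[X in measurable X]setTI.
  by apply: measurable_funD => //; exact: measurable_funM.
have -> : (c ^+ d)%:E = (\prod_(i < d) c%:E)%E by rewrite prodEFin prodr_const card_ord.
rewrite -big_split/=.
by apply: eq_bigr => i _; rewrite lebesgue_measure_affine.
Qed.

Lemma integral_shift_rV (h : 'rV[R]_d) (f : 'rV[R]_d -> \bar R) :
  (forall x, 0 <= f x)%E -> measurable_fun setT f ->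
  (\int[lebesgue_rV]_x f (x + h)%R = \int[lebesgue_rV]_x f x)%E.
Proof.
move=> f0 mf; pose s (x : 'rV[R]_d) : 'rV[R]_d := x + h.
have ms : measurable_fun setT s.
  apply: measurable_fun_rV => i; rewrite /s; under eq_fun do rewrite !mxE.
  by apply: measurable_funD => //; exact: measurable_coord.
transitivity (\int[pushforward (@lebesgue_rV R d) s]_x f x)%E.
  by rewrite [RHS]ge0_integral_pushforward// => y _; exact: f0.
apply: eq_measure_integral => A mA _.
rewrite -[RHS](@lebesgue_rV_affine 1 h)// expr1n mul1e /pushforward.
by congr lebesgue_rV; apply/seteqP; split => x; rewrite /= scale1r.
Qed.

End rV_measure.

(** * Euclidean norm and polar coordinates *)

Section enorm.
Context (R : realType) (d : nat).
Implicit Types x y : 'rV[R]_d.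

Lemma enorm_ge0 x : 0 <= enorm x.
Proof. exact: sqrtr_ge0. Qed.

Lemma sqr_enorm x : enorm x ^+ 2 = \sum_(i < d) x ord0 i ^+ 2.
Proof. by rewrite sqr_sqrtr// sumr_ge0// => i _; exact: sqr_ge0. Qed.

Lemma enormZ (c : R) x : 0 <= c -> enorm (c *: x) = c * enorm x.
Proof.
move=> c0; rewrite /enorm; under eq_bigr do rewrite mxE exprMn.
by rewrite -mulr_sumr sqrtrM ?sqr_ge0// sqrtr_sqr ger0_norm.
Qed.

Lemma enormN x : enorm (- x) = enorm x.
Proof. by rewrite /enorm; under eq_bigr do rewrite mxE sqrrN. Qed.

Lemma enorm0 : enorm (0 : 'rV[R]_d) = 0.
Proof. by rewrite -(scale0r 0) enormZ// mul0r. Qed.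

Lemma ler_coord_enorm x i : `|x ord0 i| <= enorm x.
Proof.
rewrite -sqrtr_sqr ler_sqrt; last by apply: sumr_ge0 => j _; exact: sqr_ge0.
by rewrite (bigD1 i)//= lerDl sumr_ge0// => j _; exact: sqr_ge0.
Qed.

Lemma measurable_enorm : measurable_fun setT (@enorm R d).
Proof.
apply: measurableT_comp.
  by apply: continuous_measurable_fun; exact: sqrt_continuous.
by apply: measurable_sum => i; apply: measurable_funX; exact: measurable_coord.
Qed.

Definition pball (r : R) : set 'rV[R]_d := [set x | 0 < enorm x <= r].

Lemma truncated_cone_sphere :
  [set s *: x | s in `]0, 1] & x in [set x : 'rV[R]_d | enorm x = 1]] =
  pball 1.
Proof.
rewrite /pball; apply/seteqP; split => [_ [s /= + [x /= x1 <-]]|x /= /andP[x0 x1]].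
  rewrite in_itv/= => /andP[s0 s1].
  by rewrite /pball/= enormZ ?(ltW s0)// x1 mulr1 s0.
exists (enorm x); first by rewrite /= in_itv/= x0.
exists ((enorm x)^-1 *: x); first by rewrite /= enormZ ?invr_ge0 ?(ltW x0)// mulVf ?gt_eqF.
by rewrite scalerA divff ?gt_eqF// scale1r.
Qed.

Lemma measurable_enorm_itv (i : interval R) : measurable [set x : 'rV[R]_d | enorm x \in i].
Proof.
by rewrite -[X in measurable X]setTI; exact: (measurable_enorm measurableT (measurable_itv i)).
Qed.

Lemma measurable_pball (r : R) : measurable (pball r).
Proof.
by rewrite /pball; have := measurable_enorm_itv `]0, r]; under eq_set do rewrite in_itv/=.
Qed.

Lemma lebesgue_rV_ball (r : R) : 0 < r ->
  lebesgue_rV (pball r) =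
  ((r ^+ d)%:E * lebesgue_rV (pball 1))%E.
Proof.
move=> r0; rewrite -(@lebesgue_rV_affine _ _ r 0) => [||]; [|by []|exact: measurable_pball].
congr (_ * lebesgue_rV _)%E; apply/seteqP; split => x /=;
  by rewrite /pball/= addr0 enormZ ?(ltW r0)// pmulr_rgt0// ger_pMr.
Qed.

Lemma lebesgue_rV_ball_lty (r : R) :
  (lebesgue_rV (pball r) < +oo)%E.
Proof.
apply: (le_lt_trans _ (lebesgue_rV_cube_lty R d (Num.truncn r).+1)).
apply: le_measure.
- by rewrite inE; exact: measurable_pball.
- by rewrite inE; exact: measurable_cube.
move=> x /= /andP[_ xr] i; rewrite -ler_norml (le_trans (ler_coord_enorm _ _))//.
by rewrite (le_trans xr)// ltW// truncnS_gt.
Qed.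

Lemma lebesgue_rV_unit_ball_gt0 : (0 < d)%N ->
  (0 < lebesgue_rV (pball 1))%E.
Proof.
move=> d0; have d0' : 0 < d%:R :> R by rewrite ltr0n.
pose A : set R := `]0, d%:R^-1]%classic.
have mA : measurable A by exact: measurable_itv.
apply: (@lt_le_trans _ _ (lebesgue_rV [set x : 'rV[R]_d | forall i, A (x ord0 i)])).
  rewrite (lebesgue_rV_box (fun _ : 'I_d => mA)).
  apply: (big_ind (fun x : \bar R => 0 < x)%E) => //; first by move=> x y; exact: mule_gt0.
  by move=> i _; rewrite lebesgue_measure_itv/= lte_fin invr_gt0 d0' sube0 lte_fin invr_gt0.
apply: le_measure.
- by rewrite inE; exact: (measurable_rV_box (fun _ : 'I_d => mA)).
- by rewrite inE; exact: measurable_pball.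
move=> x Ax; have Ax' i : 0 < x ord0 i <= d%:R^-1 by have := Ax i; rewrite /A /= in_itv.
have x0 : 0 < enorm x.
  apply: (lt_le_trans _ (ler_coord_enorm x (Ordinal d0))).
  by rewrite normr_gt0 gt_eqF//; case/andP: (Ax' (Ordinal d0)).
rewrite /pball/= x0 -(@ler_pXn2r _ 2)// ?nnegrE ?enorm_ge0// sqr_enorm expr1n.
apply: (@le_trans _ _ (\sum_(i < d) d%:R^-1)); last first.
  by rewrite sumr_const card_ord -[leLHS]mulr_natl divff// gt_eqF.
apply: ler_sum => i _; case/andP: (Ax' i) => xi0 xi1.
rewrite (le_trans _ xi1)// expr2 ler_piMr ?(ltW xi0)// (le_trans xi1)//.
by rewrite invf_le1// ler1n.
Qed.

Lemma sphere_areaE :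
  (sphere_area R d)%:E = (d%:R%:E * lebesgue_rV (pball 1))%E.
Proof.
rewrite /sphere_area /surface_measure truncated_cone_sphere /volume EFinM fineK//.
by rewrite ge0_fin_numE ?lebesgue_rV_ball_lty.
Qed.

Lemma sphere_area_gt0 : (0 < d)%N -> 0 < sphere_area R d.
Proof.
by move=> d0; rewrite -lte_fin sphere_areaE mule_gt0 ?lebesgue_rV_unit_ball_gt0// lte_fin ltr0n.
Qed.

Lemma lebesgue_rV_annulus (a b : R) : (0 < d)%N -> 0 <= a -> a < b ->
  lebesgue_rV [set x : 'rV[R]_d | enorm x \in `]a, b] ] =
  (sphere_area R d * (b ^+ d - a ^+ d) / d%:R)%:E.
Proof.
move=> d0 a0 ab; have b0 := le_lt_trans a0 ab.
have -> : [set x : 'rV[R]_d | enorm x \in `]a, b] ] = pball b `\` pball a.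
  apply/seteqP; split => x; rewrite /pball /= in_itv/=.
    move=> /andP[ax xb]; rewrite xb (le_lt_trans a0)//; split => // /andP[_].
    by rewrite leNgt ax.
  by move=> [/andP[x0 ->]] /negP; rewrite x0/= -ltNge => ->.
have [k kE] : exists k, lebesgue_rV (pball 1) = k%:E.
  by exists (fine (lebesgue_rV (pball 1))); rewrite fineK// ge0_fin_numE ?lebesgue_rV_ball_lty.
have sE : sphere_area R d = d%:R * k by apply: EFin_inj; rewrite sphere_areaE kE EFinM.
have dn0 : d%:R != 0 :> R by rewrite pnatr_eq0 -lt0n.
transitivity (lebesgue_rV (pball b) - lebesgue_rV (pball a))%E.
  rewrite [LHS]measureD; [|exact: measurable_pball|exact: measurable_pball|exact: lebesgue_rV_ball_lty].
  rewrite setIidr// => x; rewrite /pball/= => /andP[-> /le_trans->]//.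
  exact: ltW.
rewrite lebesgue_rV_ball//.
rewrite (_ : lebesgue_rV (pball a) = (a ^+ d * k)%:E); last first.
  move: a0; rewrite le_eqVlt => /predU1P[<-|a0]; last by rewrite lebesgue_rV_ball// kE.
  rewrite expr0n eqn0Ngt d0 mul0r (_ : pball 0 = set0) ?measure0//.
  by apply/seteqP; split => // x; rewrite /pball/= leNgt andbN.
by rewrite kE sE -EFinM -EFinB; congr (_%:E); field.
Qed.

Lemma integral_monomial (a b : R) : (0 < d)%N -> 0 <= a -> a < b ->
  (\int[lebesgue_measure]_(r in `]a, b]) (r ^+ d.-1)%:E =
    ((b ^+ d - a ^+ d) / d%:R)%:E)%E.
Proof.
move=> d0 a0 ab; rewrite integral_itv_obnd_cbnd; last first.
  apply/measurable_funTS/measurable_EFinP; exact: exprn_measurable.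
rewrite (@continuous_FTC2 _ _ (fun r => r ^+ d / d%:R))//.
- by rewrite -EFinB; congr (_%:E); field; rewrite pnatr_eq0 -lt0n.
- by apply: continuous_subspaceT => x; exact: exprn_continuous.
- have cF : continuous (fun r : R => r ^+ d / d%:R).
    by move=> x; apply: cvgM; [exact: exprn_continuous|exact: cvg_cst].
  split; [|exact/cvg_at_right_filter/cF|exact/cvg_at_left_filter/cF].
  by move=> x _; apply: derivableM => //; exact: exprn_derivable.
- move=> x _; rewrite derive1Mr//; last exact: exprn_derivable.
  by rewrite exp_derive1 /GRing.scale/= mulrAC divff ?mul1r// pnatr_eq0 -lt0n.
Qed.

End enorm.

Lemma measurable_invr (R : realType) : measurable_fun setT (fun x : R => x^-1).
Proof.
have mp : measurable_fun setT (fun x : R => powR x (-1)) by exact: measurable_powR.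
pose f (x : R) := if 0 <= x then powR x (-1) else - powR (- x) (-1).
have -> : (fun x : R => x^-1) = f.
  apply/funext => x; rewrite /f; case: (leP 0 x) => x0; first by rewrite powR_inv1.
  by rewrite powR_inv1 ?oppr_ge0 ?(ltW x0)// invrN opprK.
apply: measurable_fun_ifT; first exact: measurable_fun_ler.
- exact: mp.
- by apply: measurableT_comp => //; apply: (measurableT_comp mp).
Qed.

Lemma measurable_funV d (T : measurableType d) (R : realType) (D : set T) (f : T -> R) :
  measurable_fun D f -> measurable_fun D (fun x => (f x)^-1).
Proof. exact: measurableT_comp (@measurable_invr R). Qed.

Lemma integral_shift_itv (R : realType) (a b : R) (f : R -> \bar R) :
    measurable_fun `]0, b[ f -> (forall x, (0 < x < b)%R -> (0 <= f x)%E) ->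
  (\int[lebesgue_measure]_(x in `]a, (a + b)%R[) f (x - a)%R =
   \int[lebesgue_measure]_(x in `]0%R, b[) f x)%E.
Proof.
move=> mf f0.
pose s (x : measurableTypeR R) : measurableTypeR R := x - a.
have ms : measurable_fun setT s by exact: measurable_funB.
have sE : s @^-1` `]0, b[ = `]a, a + b[%classic.
  by apply/seteqP; split => x; rewrite /s /= !in_itv/= subr_gt0 ltrBlDl.
transitivity (\int[pushforward (@lebesgue_measure R) s]_(x in `]0%R, b[) f x)%E.
  rewrite [RHS]ge0_integral_pushforward//= ?sE//.
  by move=> y; rewrite inE/= in_itv/=; exact: f0.
apply: eq_measure_integral => A mA _.
rewrite -[RHS](@lebesgue_measure_affine R 1 (- a))// mul1e /pushforward.
by congr lebesgue_measure; apply/seteqP; split => x; rewrite /= mul1r.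
Qed.

Lemma measurable_shift_itv (R : realType) (a b : R) (f : R -> R) :
  measurable_fun `]0, b[ f -> measurable_fun `]a, a + b[ (fun x => f (x - a)).
Proof.
move=> mf; apply: (measurable_comp (F := `]0, b[%classic)) mf _ => //.
- by move=> _ [x + <-]; rewrite /= !in_itv/= subr_gt0 ltrBlDl.
- exact: measurable_funB.
Qed.

Section polar.
Context (R : realType) (d : nat) (d_gt0 : (0 < d)%N).

Let sa := sphere_area R d.

Let radial (r : R) : R := if 0 < r then sa * r ^+ d.-1 else 0.

Let radial_ge0 r : 0 <= radial r.
Proof.
rewrite /radial; case: ifP => // /ltW r0.
by rewrite mulr_ge0 ?exprn_ge0// ltW// sphere_area_gt0.
Qed.

Let measurable_radial : measurable_fun setT radial.
Proof.
apply: measurable_fun_ifT => //.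
- by apply: measurable_fun_ltr.
- by apply: measurable_funM => //; exact: measurable_funX.
Qed.

Lemma integral_radial (f : R -> \bar R) : (forall r, 0 <= f r)%E ->
    measurable_fun setT f ->
  (\int[lebesgue_rV]_(x in [set x : 'rV[R]_d | (0 < enorm x)%R]) f (enorm x) =
   \int[lebesgue_measure]_(r in `]0%R, +oo[) ((sphere_area R d * r ^+ d.-1)%:E * f r))%E.
Proof.
move=> f0 mf; pose D := [set x : 'rV[R]_d | (0 < enorm x)%R].
have mD : measurable D.
  by have := @measurable_enorm_itv R d `]0%R, +oo[; under eq_set do rewrite in_itv/= andbT.
have [nu0 nu0E] := @density_measure_ex _ _ _ (@lebesgue_rV R d) \1_D
  (fun x => ler0n _ _) (measurable_indic mD).
have {}nu0E U : measurable U -> nu0 U = lebesgue_rV (U `&` D).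
  by move=> mU; rewrite nu0E integral_indic// setIC.
have mE : measurable_fun setT (@enorm R d : _ -> measurableTypeR R).
  exact: measurable_enorm.
pose nu1 : {measure set (measurableTypeR R) -> \bar R} :=
   measure_function_pushforward__canonical__measure_function_Measure
     nu0 mE.
have nu1E (i : interval R) : nu1 [set` i] = lebesgue_rV ([set x | enorm x \in i] `&` D).
  by rewrite -nu0E//; exact: measurable_enorm_itv.
have [nu2 nu2E] := @density_measure_ex _ _ _ (@lebesgue_measure R) radial
  radial_ge0 measurable_radial.
have nu12 (S : set (measurableTypeR R)) : measurable S -> nu1 S = nu2 S.
  apply: (@measure_unique _ R (measurableTypeR R) (@ocitv R) (fun n => `]- n%:R, n%:R]%classic)) => //.
  - exact: ocitvI.
  - by move=> n; exact: is_ocitv.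
  - apply/seteqP; split => // x _; exists (Num.truncn `|x|).+1 => //=.
    have : `|x| < (Num.truncn `|x|).+1%:R by exact: truncnS_gt.
    by rewrite ltr_norml in_itv/= => /andP[-> /ltW].
  - move=> _ [[a b] _ <-] /=; rewrite nu1E nu2E.
    pose a' := Order.max a 0; have a'0 : 0 <= a' by rewrite /a' le_max lexx orbT.
    have [ba|ab] := leP b a'.
      rewrite (_ : _ `&` _ = set0) ?measure0; last first.
        apply/seteqP; split => // x; rewrite /D/= in_itv/= => -[/andP[ax xb] x0].
        by move: ba; rewrite leNgt => /negP; apply; rewrite /a' gt_max !(lt_le_trans _ xb).
      rewrite integral0_eq// => r; rewrite /= in_itv/= => /andP[ar rb].
      rewrite /radial; case: ifPn => // r0; exfalso.
      by move: ba; rewrite leNgt => /negP; apply; rewrite /a' gt_max !(lt_le_trans _ rb).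
    rewrite (_ : _ `&` _ = [set x | enorm x \in `]a', b] ]); last first.
      apply/seteqP; split => x; rewrite /D/= !in_itv/= /a' gt_max.
        by move=> [/andP[-> ->] ->].
      by move=> /andP[/andP[-> ->] ->].
    rewrite lebesgue_rV_annulus//.
    transitivity (\int[lebesgue_measure]_(r in `]a', b]) (sa%:E * (r ^+ d.-1)%:E))%E.
      rewrite ge0_integralZl ?integral_monomial ?lee_fin ?(ltW (sphere_area_gt0 _ _))//.
      - by rewrite -EFinM mulrA.
      - by apply/measurable_funTS/measurable_EFinP; exact: measurable_funX.
      - move=> r; rewrite /= in_itv/= => /andP[ar _].
        by rewrite lee_fin exprn_ge0// (le_trans a'0)// ltW.
    rewrite [LHS]integral_mkcond [RHS]integral_mkcond. apply: eq_integral => r _.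
    rewrite !patchE !mem_setE !in_itv/= /a' gt_max /radial.
    by case: (a < r); case: (r <= b); case: (0 < r); rewrite ?EFinM.
  - move=> n; rewrite nu1E.
    apply: le_lt_trans (lebesgue_rV_ball_lty d n%:R).
    apply: le_measure; rewrite ?inE.
    + by apply: measurableI => //; exact: measurable_enorm_itv.
    + exact: measurable_pball.
    + by move=> x [] /=; rewrite in_itv/= /pball /D/= => /andP[_ ->] ->.
transitivity (\int[nu1]_r f r)%E.
  rewrite [RHS]ge0_integral_pushforward// preimage_setT.
  rewrite (@integral_density _ _ _ lebesgue_rV nu0 \1_D)//.
  - rewrite [LHS]integral_mkcond; apply: eq_integral => x _.
    by rewrite patchE indicE; case: ifP; rewrite /= ?mul1e ?mul0e.
  - by move=> U mU; rewrite nu0E// integral_indic// setIC.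
  - by move=> x; exact: f0.
  - exact: measurableT_comp mf (@measurable_enorm R d).
transitivity (\int[nu2]_r f r)%E.
  by apply: eq_measure_integral => A mA _; exact: nu12.
rewrite (@integral_density _ _ _ lebesgue_measure nu2 radial)//.
rewrite [RHS]integral_mkcond; apply: eq_integral => r _.
by rewrite patchE /radial mem_setE in_itv/= andbT; case: ifP => //; rewrite mul0e.
Qed.

Lemma integral_annulus (rmin rlen : R) (f : R -> R) :
    0 <= rmin -> 0 < rlen -> measurable_fun `]0, rlen[ f ->
    (forall r, 0 < r < rlen -> 0 <= f r) ->
  (\int[lebesgue_rV]_(x in annulus rmin rlen)
     (f (enorm x - rmin)%R / enorm (x : 'rV[R]_d) ^+ d.-1)%:E =
   (sphere_area R d)%:E * \int[lebesgue_measure]_(r in `]0%R, rlen[) (f r)%:E)%E.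
Proof.
move=> rmin0 rlen0 mf f0.
pose G (s : R) : R := f (s - rmin) / s ^+ d.-1.
pose F (r : R) : \bar R := ((G \_ `]rmin, rmin + rlen[) r)%:E.
have G0 s : rmin < s < rmin + rlen -> 0 <= G s.
  move=> /andP[s0 s1]; have s0' := le_lt_trans rmin0 s0.
  by rewrite /G mulr_ge0 ?invr_ge0 ?exprn_ge0 ?(ltW s0')// f0// subr_gt0 s0 ltrBlDl.
have mG : measurable_fun `]rmin, rmin + rlen[ G.
  apply: measurable_funM; first exact: measurable_shift_itv.
  by apply: measurable_funV; exact: measurable_funX.
have annE x : (rmin < enorm x < rmin + rlen) = (0 < enorm (x : 'rV[R]_d)) &&
    (enorm x \in `]rmin, rmin + rlen[).
  rewrite in_itv/=; case: (ltP rmin (enorm x)) => [rx|]; last by rewrite andbF.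
  by rewrite (le_lt_trans rmin0 rx).
have mF : measurable_fun setT F.
  apply/measurable_EFinP.
  by apply/(measurable_restrictT G (measurable_itv `]rmin, rmin + rlen[)).
have F0 r : (0 <= F r)%E.
  rewrite /F lee_fin patchE; case: ifPn => //; rewrite mem_setE in_itv/=; exact: G0.
transitivity (\int[lebesgue_rV]_(x in [set x : 'rV[R]_d | (0 < enorm x)%R]) F (enorm x))%E.
  rewrite integral_mkcond [RHS]integral_mkcond; apply: eq_integral => x _.
  have A1 : (x \in annulus rmin rlen) = (rmin < enorm x < rmin + rlen).
    by apply/idP/idP => [/set_mem|/mem_set].
  have A2 : (x \in [set x : 'rV[R]_d | 0 < enorm x]) = (0 < enorm x).
    by apply/idP/idP => [/set_mem|/mem_set].
  rewrite !patchE /F patchE A1 A2 annE mem_setE.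
  by case: (0 < enorm x); case: (enorm x \in _).
rewrite integral_radial// -ge0_integralZl//; last 2 first.
- exact/measurable_EFinP.
- by rewrite lee_fin ltW// sphere_area_gt0.
transitivity (\int[lebesgue_measure]_(r in `]rmin, (rmin + rlen)%R[)
    ((sphere_area R d)%:E * (f (r - rmin))%:E))%E.
  rewrite integral_mkcond [RHS]integral_mkcond; apply: eq_integral => r _.
  rewrite !patchE /F patchE !mem_setE !in_itv/= andbT.
  case: ifPn => r0; case: ifPn => r1; rewrite ?mule0//; last first.
    by move: r0; rewrite (le_lt_trans rmin0)//; case/andP: r1.
  have rk : r ^+ d.-1 != 0.
    by rewrite expf_neq0// gt_eqF// (le_lt_trans rmin0)//; case/andP: r1.
  rewrite -!EFinM /G; congr (_%:E); move: rk; set k := r ^+ _ => rk.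
  by field.
rewrite (@integral_shift_itv _ _ _ (fun r => (sphere_area R d)%:E * (f r)%:E)%E)//.
- by apply: measurable_funeM; exact/measurable_EFinP.
- by move=> x /f0 fx; rewrite mule_ge0// lee_fin// ltW// sphere_area_gt0.
Qed.

End polar.

(** * Edge correction of the windows *)

Lemma prodr_onem_ge (R : realDomainType) (I : finType) (x : I -> R) :
  (forall i, 0 <= x i <= 1) -> 1 - \sum_i x i <= \prod_i (1 - x i).
Proof.
move=> x01.
have [] : 1 - \sum_i x i <= \prod_i (1 - x i) /\ 0 <= \prod_i (1 - x i) <= 1; last by [].
elim/big_rec2 : _ => [|i z y _ [zy /andP[y0 y1]]]; first by rewrite subr0 lexx ler01.
have /andP[xi0 xi1] := x01 i; split; last first.
  by rewrite mulr_ge0 ?subr_ge0//= mulr_ile1 ?subr_ge0// gerBl.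
have : x i * y <= x i by rewrite ler_piMr.
move: zy.
by lra.
Qed.

Section window.
Context (R : realType) (d : nat) (a : 'I_d -> R) (a_gt0 : forall i, 0 < a i).
Implicit Types (h u : 'rV[R]_d) (n : nat).

Lemma measurable_window n : measurable (window a n).
Proof.
apply: (measurable_rV_box (A := fun i => `[- (n%:R * a i), n%:R * a i]%classic)) => i.
exact: measurable_itv.
Qed.

Lemma mem_translate (A : set 'rV[R]_d) h u : translate A h u <-> A (u + h).
Proof.
split => [[v Av <-]|Auh]; first by rewrite subrK.
by exists (u + h) => //; rewrite addrK.
Qed.

Lemma lebesgue_rV_window_translate n h :
  lebesgue_rV (window a n `&` translate (window a n) h) =
  (\prod_(i < d) Order.max 0 (2 * (n%:R * a i) - `|h ord0 i|))%:E.
Proof.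
pose I i := `[Order.max (- (n%:R * a i)) (- (n%:R * a i) - h ord0 i),
              Order.min (n%:R * a i) (n%:R * a i - h ord0 i)].
have mI i : measurable [set` I i] by exact: measurable_itv.
transitivity (lebesgue_rV [set x : 'rV[R]_d | forall i, [set` I i] (x ord0 i)]).
  congr lebesgue_rV; apply/seteqP; split => x.
    move=> [Wx /mem_translate Wxh] i; have := Wx i; have := Wxh i.
    rewrite /I /= in_itv/= mxE ge_max le_min lerBlDr lerBrDr.
    by move=> /andP[-> ->] /andP[-> ->].
  move=> Ix; split; last apply/mem_translate; move=> i; have := Ix i.
    by rewrite /I /= in_itv/= ge_max le_min => /andP[/andP[-> _] /andP[-> _]].
  by rewrite /I /= in_itv/= ge_max le_min mxE lerBlDr lerBrDr => /andP[/andP[_ ->] /andP[_ ->]].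
rewrite (lebesgue_rV_box mI) -prodEFin; apply: eq_bigr => i _.
rewrite lebesgue_measure_itv/= lte_fin.
have := a_gt0 i; set L := n%:R * a i => ai0.
have L0 : 0 <= L by rewrite mulr_ge0 ?(ltW ai0).
have [h0|h0] := leP 0 (h ord0 i).
  have -> : Order.max (- L) (- L - h ord0 i) = - L by apply/max_idPl; lra.
  have -> : Order.min L (L - h ord0 i) = L - h ord0 i by apply/min_idPr; lra.
  rewrite ger0_norm//; case: ltP => H; rewrite -?EFinB; congr (_%:E).
    by rewrite (max_idPr _); lra.
  by apply/esym/max_idPl; lra.
have -> : Order.max (- L) (- L - h ord0 i) = - L - h ord0 i by apply/max_idPr; lra.
have -> : Order.min L (L - h ord0 i) = L by apply/min_idPl; lra.
rewrite ltr0_norm//; case: ltP => H; rewrite -?EFinB; congr (_%:E).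
  by rewrite (max_idPr _); lra.
by apply/esym/max_idPl; lra.
Qed.

Lemma lebesgue_rV_window n :
  lebesgue_rV (window a n) = (\prod_(i < d) (2 * (n%:R * a i)))%:E.
Proof.
transitivity (lebesgue_rV (window a n `&` translate (window a n) 0)).
  by congr lebesgue_rV; apply/seteqP; split => [x Wx|x []//]; split => //; apply/mem_translate; rewrite addr0.
rewrite lebesgue_rV_window_translate; congr (_%:E); apply: eq_bigr => i _.
by rewrite mxE normr0 subr0; apply/max_idPr; rewrite mulr_ge0// mulr_ge0// (ltW (a_gt0 i)).
Qed.

Lemma volume_window n : volume (window a n) = \prod_(i < d) (2 * (n%:R * a i)).
Proof. by rewrite /volume lebesgue_rV_window. Qed.

Lemma volume_window_gt0 n : (0 < n)%N -> 0 < volume (window a n).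
Proof.
move=> n0; rewrite volume_window; apply: prodr_gt0 => i _.
by rewrite !mulr_gt0 ?ltr0n.
Qed.

Lemma edge_correctionE n h : edge_correction (window a n) h =
  (\prod_(i < d) Order.max 0 (2 * (n%:R * a i) - `|h ord0 i|)) / volume (window a n).
Proof. by rewrite /edge_correction /volume lebesgue_rV_window_translate. Qed.

Lemma edge_correctionN n h : edge_correction (window a n) (- h) = edge_correction (window a n) h.
Proof. by rewrite !edge_correctionE; under eq_bigr do rewrite mxE normrN. Qed.

Lemma measurable_edge_correction n : measurable_fun setT (edge_correction (window a n)).
Proof.
apply: (eq_measurable_fun _ (fun h _ => esym (edge_correctionE n h))).
apply: measurable_funM => //; apply: measurable_prod => i _.
apply: measurable_maxr => //; apply: measurable_funB => //.
by apply: measurableT_comp => //; exact: measurable_coord.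
Qed.

Lemma near_edge_correction_ge (r : R) :
  \forall n \near \oo, forall h, enorm h <= r -> 2^-1 <= edge_correction (window a n) h.
Proof.
pose c := \sum_(i < d) `|r| / (2 * a i).
near=> n => h hr.
have n0 : (0 < n)%N by near: n; exact: nbhs_infty_gt.
have n0' : 0 < n%:R :> R by rewrite ltr0n.
have nc : 2 * c <= n%:R by near: n; exact: nbhs_infty_ger.
have xE i : `|r| / (2 * (n%:R * a i)) = n%:R^-1 * (`|r| / (2 * a i)).
  by field; rewrite !gt_eqF.
have csum i : `|r| / (2 * a i) <= c.
  rewrite /c (bigD1 i)//= lerDl sumr_ge0// => j _.
  by rewrite divr_ge0// mulr_ge0// ltW.
have x01 (i : 'I_d) : 0 <= `|r| / (2 * (n%:R * a i)) <= 1.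
  rewrite xE; apply/andP; split; first by rewrite -xE divr_ge0// !mulr_ge0// ltW.
  rewrite ler_pdivrMl// mulr1.
  have := csum i; have : 0 <= `|r| / (2 * a i) by rewrite divr_ge0// mulr_ge0// ltW.
  by lra.
apply: (@le_trans _ _ (\prod_(i < d) (1 - `|r| / (2 * (n%:R * a i))))).
  apply: le_trans (prodr_onem_ge x01).
  have -> : \sum_(i < d) `|r| / (2 * (n%:R * a i)) = n%:R^-1 * c.
    by rewrite /c mulr_sumr; apply: eq_bigr => i _; exact: xE.
  suff : n%:R^-1 * c <= 2^-1 by lra.
  by rewrite ler_pdivrMl//; lra.
rewrite edge_correctionE volume_window ler_pdivlMr; last first.
  by apply: prodr_gt0 => i _; rewrite !mulr_gt0.
rewrite -big_split/=; apply: ler_prod => i _.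
have /andP[_ x1] := x01 i; have La : 0 < 2 * (n%:R * a i) by rewrite !mulr_gt0.
rewrite mulr_ge0 ?subr_ge0 ?(ltW La)//= le_max mulrBl mul1r divfK ?gt_eqF//.
by rewrite lerB ?orbT// (le_trans (ler_coord_enorm h i))// (le_trans hr)// ler_norm.
Unshelve. all: by end_near. Qed.

End window.

(** * Campbell's formula *)

Fixpoint alltuples (T : Type) (s : seq T) (k : nat) : seq (k.-tuple T) :=
  if k is k'.+1 then [seq tuple_cons (x, t) | x <- s, t <- alltuples s k']
  else [:: [tuple]].

Section alltuples.
Variables (T : choiceType) (s : seq T).

Lemma mem_alltuples k (t : k.-tuple T) :
  (t \in alltuples s k) <-> forall i, tnth t i \in s.
Proof.
elim: k t => [|k IH] t /=; first by rewrite inE tuple0; split => // _ [].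
split => [/allpairsP[[x u] /= [xs us ->]] i|ts].
  case: (unliftP ord0 i) => [j ->|->]; last by rewrite tnth0.
  by rewrite tnthS; exact: (IH u).1.
case/tupleP: t ts => x u ts; apply/allpairsP; exists (x, u); split.
- by have := ts ord0; rewrite tnth0.
- by apply/IH => i; have := ts (lift ord0 i); rewrite tnthS.
- by [].
Qed.

Lemma alltuples_uniq k : uniq s -> uniq (alltuples s k).
Proof.
move=> us; elim: k => [//|k IH] /=; apply: allpairs_uniq => //.
by move=> [x u] [y v] _ _ [-> /val_inj ->].
Qed.

Lemma big_alltuplesS (R : Type) (idx : R) (op : Monoid.law idx) k (f : k.+1.-tuple T -> R) :
  \big[op/idx]_(t <- alltuples s k.+1) f t =
  \big[op/idx]_(x <- s) \big[op/idx]_(t <- alltuples s k) f (tuple_cons (x, t)).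
Proof. by rewrite /= big_allpairs_dep. Qed.

Lemma big_alltuples0 (R : Type) (idx : R) (op : Monoid.law idx) (f : 0.-tuple T -> R) :
  \big[op/idx]_(t <- alltuples s 0) f t = f [tuple].
Proof. by rewrite /= big_seq1. Qed.

Lemma prod_sum_alltuples (R : comPzSemiRingType) k (F : 'I_k -> T -> R) :
  \sum_(t <- alltuples s k) \prod_(i < k) F i (tnth t i) =
  \prod_(i < k) \sum_(x <- s) F i x.
Proof.
elim: k F => [|k IH] F; first by rewrite big_alltuples0 !big_ord0.
rewrite big_alltuplesS big_ord_recl -IH big_distrl/=; apply: eq_bigr => x _.
rewrite big_distrr/=; apply: eq_bigr => t _; rewrite big_ord_recl/= tnth0.
by congr (_ * _); apply: eq_bigr => i _; rewrite tnthS.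
Qed.

End alltuples.

Lemma counting_seq (R : realType) (T : choiceType) (u : seq T) (A : set T) : uniq u ->
  counting ([set` u] `&` A) = (\sum_(x <- u) \1_A x : R)%:E.
Proof.
move=> uu; have fin : finite_set ([set` u] `&` A) by apply: finite_setIl; exact: finite_seq.
rewrite /counting asboolT//; congr (_%:E).
have -> : \sum_(x <- u) \1_A x = (size [seq x <- u | x \in A])%:R :> R.
  rewrite size_filter -sum1_count natr_sum [RHS]big_mkcond/=.
  by apply: eq_bigr => x _; rewrite indicE; case: ifP.
congr (_%:R); apply/perm_size/uniq_perm; [exact: fset_uniq|exact: filter_uniq|].
move=> x; rewrite in_fset_set// mem_filter.
apply/idP/idP => [/set_mem[/= -> Ax]|/andP[/set_mem Ax xu]]; first by rewrite mem_set.
by apply/mem_set; split.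
Qed.

Lemma integral_counting_seq d (T : measurableType d) (R : realType)
    (m : {measure set T -> \bar R}) (u : seq T) (D : set T) (f : T -> \bar R) :
    measurable D -> {subset u <= D} ->
    (forall A, measurable A -> A `<=` D -> m A = (\sum_(x <- u) \1_A x)%:E) ->
    measurable_fun setT f -> (forall x, 0 <= f x)%E -> (forall x, ~ D x -> f x = 0)%E ->
  (\int[m]_x f x = \sum_(x <- u) f x)%E.
Proof.
move=> mD uD mE mf f0 fD.
transitivity (\int[m]_(x in D) f x)%E.
  rewrite [RHS]integral_mkcond; apply: eq_integral => x _.
  by rewrite patchE; case: ifPn => // /negP xD; apply: fD => Dx; apply: xD; exact: mem_set.
case: u uD mE => [_ mE|x0 u' uD mE].
  rewrite big_nil -(integral_measure_zero D f); apply: eq_measure_integral => A mA AD.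
  by rewrite mE// big_nil.
set u := x0 :: u' in uD mE *.
transitivity (\int[msum (fun n => \d_(nth x0 u n)) (size u)]_(x in D) f x)%E.
  apply: eq_measure_integral => A mA AD; rewrite mE// /msum/= (big_nth x0) big_mkord -sumEFin.
  by apply: eq_bigr => i _; rewrite indicE.
rewrite ge0_integral_measure_sum//; last exact: measurable_funTS.
rewrite (big_nth x0) big_mkord; apply: eq_bigr => i _.
rewrite integral_dirac//; last exact: measurable_funTS.
by rewrite diracE (uD _ _) ?mul1e// mem_nth.
Qed.

Section cubes.
Context (R : realType) (d : nat).

Lemma cube_mono m p : (m <= p)%N -> @cube R d m `<=` @cube R d p.
Proof.
move=> mp x cx i; have /andP[x0 x1] := cx i.
have : m%:R <= p%:R :> R by rewrite ler_nat.
by move=> ?; apply/andP; split; lra.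
Qed.

Lemma cube_cover : \bigcup_m @cube R d m = setT.
Proof.
apply/seteqP; split => // x _; exists (\max_i (Num.truncn `|x ord0 i|).+1) => // i.
rewrite -ler_norml (le_trans (ltW (truncnS_gt _)))// ler_nat.
by rewrite (@leq_bigmax _ (fun i => (Num.truncn `|x ord0 i|).+1)).
Qed.

Lemma bounded_cube m : bounded_set (@cube R d m).
Proof.
exists m%:R; split => // M mM x /= cx; rewrite /Num.norm/= mx_normrE.
apply: bigmax_le => [|[i j] _] /=; first by rewrite (le_trans _ (ltW mM)).
by rewrite ord1 (le_trans _ (ltW mM))// ler_norml; exact: cx.
Qed.

Lemma measurable_set1_rV (x : 'rV[R]_d) : measurable [set x].
Proof.
rewrite (_ : [set x] = [set y | forall i, [set x ord0 i] (y ord0 i)]).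
  by apply: (measurable_rV_box (A := fun i => [set x ord0 i])).
apply/seteqP; split => [y -> //|y xy]; apply/rowP => i; exact: xy.
Qed.

Lemma measurable_tuple_box d' (T : measurableType d') k (A : 'I_k -> set T) :
  (forall i, measurable (A i)) -> measurable (box A).
Proof.
move=> mA; have -> : box A = \big[setI/setT]_(i < k) ((fun t => tnth t i) @^-1` A i).
  by rewrite -bigcap_seq; apply/seteqP; split => [t Bt i _|t Bt i];
    [exact: Bt|exact: (Bt i (mem_index_enum i))].
apply: bigsetI_measurable => i _; rewrite -[X in measurable X]setTI.
exact: measurable_tnth.
Qed.

Lemma measurable_eq_rV d' (T : measurableType d') (f g : T -> 'rV[R]_d) :
  measurable_fun setT f -> measurable_fun setT g -> measurable [set x | f x = g x].
Proof.
move=> mf mg; rewrite (_ : [set x | f x = g x] =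
    \big[setI/setT]_(i < d) [set x | f x ord0 i - g x ord0 i = 0]).
  apply: bigsetI_measurable => i _.
  have mfg : measurable_fun setT (fun x => f x ord0 i - g x ord0 i).
    by apply: measurable_funB; apply: (measurableT_comp (@measurable_coord _ _ i)).
  by rewrite -[X in measurable X]setTI; exact: (mfg measurableT [set 0]).
rewrite -bigcap_seq; apply/seteqP; split => [x /= fg i _ /=|x fg /=]; first by rewrite fg subrr.
by apply/rowP => i; apply/eqP; rewrite -subr_eq0; apply/eqP/fg/mem_index_enum.
Qed.

Lemma measurable_uniq_tuple k : measurable [set t : k.-tuple 'rV[R]_d | uniq t].
Proof.
rewrite (_ : [set t : k.-tuple 'rV[R]_d | uniq t] = \big[setI/setT]_(i < k)
    \big[setI/setT]_(j < k | i != j) ~` [set t | tnth t i = tnth t j]).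
  apply: bigsetI_measurable => i _; apply: bigsetI_measurable => j _.
  by apply: measurableC; apply: measurable_eq_rV; exact: measurable_tnth.
apply/seteqP; split => t /=.
  move=> /tuple_uniqP tinj; rewrite -bigcap_seq => i _ /=.
  by rewrite -bigcap_seq_cond => j /andP[_ /eqP ij] /= /tinj.
rewrite -bigcap_seq => H; apply/tuple_uniqP => i j tij; apply/eqP/negPn/negP => ij.
have := H i (mem_index_enum i); rewrite -bigcap_seq_cond => /(_ j); apply => //=.
by rewrite ij mem_index_enum.
Qed.

Definition bounded_tuple_boxes k :=
  [set box A | A in [set A : 'I_k -> set 'rV[R]_d |
    forall i, measurable (A i) /\ exists m, A i `<=` @cube R d m]].

Lemma measurable_bounded_tuple_boxes k :
  (measurable : set (set (k.-tuple 'rV[R]_d))) = <<s @bounded_tuple_boxes k >>.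
Proof.
rewrite (@measurable_boxes _ _ 'rV[R]_d _ k (fun i t => tnth t i)
  [set A | measurable A /\ exists m, A `<=` @cube R d m] (@cube R d))//.
- by move=> A [].
- move=> A m mA; split; first by apply: measurableI => //; exact: measurable_cube.
  by exists m => x [].
- exact: cube_mono.
- exact: cube_cover.
Qed.

Lemma common_cube k (A : 'I_k -> set 'rV[R]_d) : (forall i, exists m, A i `<=` @cube R d m) ->
  exists m, forall i, A i `<=` @cube R d m.
Proof.
move=> /choice[m Am]; exists (\max_i m i) => i.
by apply: subset_trans (Am i) _; apply: cube_mono; exact: leq_bigmax.
Qed.

End cubes.

Section factorial_counting.
Context (R : realType) (d : nat) (dO : measure_display) (Omega : measurableType dO).
Variables (X : Omega -> set 'rV[R]_d) (X_pp : point_process X).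
Local Notation E := 'rV[R]_d.

Lemma enum_bounded (B : set E) omega : bounded_set B ->
  exists2 s : seq E, uniq s & X omega `&` B = [set` s].
Proof.
move=> /(X_pp.1 omega) /finite_seqP[s sE]; exists (undup s); first exact: undup_uniq.
by rewrite sE; apply/seteqP; split => x /=; rewrite mem_undup.
Qed.

Let measurable_point_set omega : measurable (X omega).
Proof.
rewrite -[X omega]setIT -(@cube_cover R d) setI_bigcupr.
apply: bigcup_measurable => m _; have [s _ ->] := enum_bounded omega (@bounded_cube R d m).
rewrite (_ : [set` s] = \bigcup_(x in [set` s]) [set x]); last by rewrite bigcup_imset1 image_id.
apply: fin_bigcup_measurable => [|x _]; first exact: finite_seq.
exact: measurable_set1_rV.
Qed.

Definition tuple_counting k omega : {measure set (k.-tuple E) -> \bar R} :=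
  mrestr counting (measurable_tuple_box (fun _ : 'I_k => measurable_point_set omega)).

Lemma tuple_counting_seq k omega (B : set E) (s : seq E) (S : set (k.-tuple E)) :
    uniq s -> X omega `&` B = [set` s] -> S `<=` box (fun=> B) ->
  tuple_counting k omega S = (\sum_(t <- alltuples s k) \1_S t)%:E.
Proof.
move=> us sE SB; rewrite -counting_seq; last exact: alltuples_uniq.
rewrite /tuple_counting/= /mrestr; congr counting.
have sP x : x \in s <-> X omega x /\ B x.
  by split => [xs|]; [have : [set` s] x by []; rewrite -sE|rewrite -[_ /\ _]/((X omega `&` B) x) sE].
apply/seteqP; split => t /=.
  move=> [St Xt]; split => //; apply/mem_alltuples => i; apply/sP; split; first exact: Xt.
  exact: (SB t St i).
by move=> [/mem_alltuples ts St]; split => // i; have /sP[] := ts i.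
Qed.

Let measurable_tuple_counting_box k (A : 'I_k -> set E) m :
    (forall i, measurable (A i)) -> (forall i, A i `<=` @cube R d m) ->
  measurable_fun setT (fun omega => tuple_counting k omega (box A)).
Proof.
move=> mA Am.
have bA i : bounded_set (A i).
  have [M [Mr MP]] := @bounded_cube R d m; exists M; split => // y /MP My x /Am; exact: My.
apply: (eq_measurable_fun (fun omega =>
    (\prod_(i < k) fine (counting (X omega `&` A i)))%:E)).
  move=> omega _; have [s us sE] := enum_bounded omega (@bounded_cube R d m).
  rewrite (tuple_counting_seq us sE); last by move=> t At i; exact: (Am i _ (At i)).
  congr (_%:E); transitivity (\sum_(t <- alltuples s k) \prod_(i < k) (\1_(A i) (tnth t i) : R)).
    rewrite (prod_sum_alltuples s (fun i x => \1_(A i) x : R)); apply: eq_bigr => i _.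
    rewrite -[A i](setIidr (Am i)) setIA sE counting_seq//=.
    apply: eq_bigr => x _; congr (\1_(_) x); apply/esym/setIidr; exact: Am.
  apply: eq_bigr => t _; rewrite indicE; case: (boolP (t \in box A)) => [|/negP] tA.
    by rewrite big1// => i _; rewrite indicE mem_set//; move/set_mem: tA; exact.
  apply/eqP/prodf_eq0; move: tA; apply: contra_notP => H; apply/mem_set => i.
  apply: contrapT => ntA; apply: H; exists i => //.
  by rewrite indicE memNset.
apply/measurable_EFinP; apply: measurable_prod => i _.
by apply: measurableT_comp; [exact: fine_measurable|exact: X_pp.2].
Qed.

Let tuple_counting_lty k omega m :
  (tuple_counting k omega (box (fun=> @cube R d m)) < +oo)%E.
Proof.
have [s us sE] := enum_bounded omega (@bounded_cube R d m).
by rewrite (tuple_counting_seq us sE)// ltry.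
Qed.

Lemma measurable_tuple_counting k (S : set (k.-tuple E)) : measurable S ->
  measurable_fun setT (fun omega => tuple_counting k omega S).
Proof.
pose K m : set (k.-tuple E) := box (fun=> @cube R d m).
have mK m : measurable (K m) by apply: measurable_tuple_box => i; exact: measurable_cube.
move=> mS; apply: (emeasurable_fun_cvg (fun m omega => tuple_counting k omega (S `&` K m))).
  move=> m; move: (mS); rewrite measurable_bounded_tuple_boxes.
  move: S {mS}; apply: dynkin_induction; first exact: measurable_bounded_tuple_boxes.
  - move=> _ _ [A mA <-] [B mB <-]; exists (fun i => A i `&` B i).
      move=> i; have [mAi [p Ap]] := mA i; have [mBi _] := mB i.
      by split; [exact: measurableI|exists p => x [/Ap]].
    by apply/seteqP; split => [t AB|t [tA tB] i]; [split => i; case: (AB i)|split; [exact: tA|exact: tB]].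
  - rewrite setTI; apply: (@measurable_tuple_counting_box _ _ m) => i //.
    exact: measurable_cube.
  - move=> _ [A mA <-]; rewrite (_ : _ `&` _ = box (fun i => A i `&` @cube R d m)).
      apply: (@measurable_tuple_counting_box _ _ m) => i; last by move=> x [].
      by apply: measurableI; [exact: (mA i).1|exact: measurable_cube].
    by apply/seteqP; split => [t [At Kt] i|t AK]; [split; [exact: At|exact: Kt]|split => i; case: (AK i)].
  - move=> S mS IH; apply: (eq_measurable_fun (fun omega =>
        tuple_counting k omega (K m) - tuple_counting k omega (S `&` K m))%E).
      move=> omega _; rewrite setIC (setIC (~` S)) -setDE.
      by rewrite [RHS]measureD//; exact: tuple_counting_lty.
    apply: emeasurable_funB => //.
    by apply: (@measurable_tuple_counting_box _ _ m) => i //; exact: measurable_cube.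
  - move=> F mF tF IH; apply: (eq_measurable_fun (fun omega =>
        \sum_(n <oo) tuple_counting k omega (F n `&` K m)))%E.
      move=> omega _; rewrite setI_bigcupl measure_semi_bigcup//.
      + by move=> n; exact: measurableI.
      + exact: trivIset_setIr.
      + by apply: bigcup_measurable => n _; exact: measurableI.
    exact: ge0_emeasurable_sum.
move=> omega _.
rewrite [X in _ --> tuple_counting _ _ X](_ : S = \bigcup_m (S `&` K m)); last first.
  apply/seteqP; split => [t St|t [m _ []]//].
  have [|m tm] := @common_cube R d k (fun i => [set tnth t i]).
    move=> i; have : [set: E] (tnth t i) by [].
    by rewrite -(@cube_cover R d) => -[m _ tm]; exists m => _ ->.
  by exists m => //; split => // i; exact: tm.
apply: nondecreasing_cvg_mu.
- by move=> m; exact: measurableI.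
- by apply: bigcup_measurable => m _; exact: measurableI.
- move=> m p mp; apply/subsetPset => t [St Kt]; split => // i.
  exact: cube_mono mp _ (Kt i).
Qed.

Definition factorial_counting k omega : {measure set (k.-tuple E) -> \bar R} :=
  mrestr (tuple_counting k omega) (@measurable_uniq_tuple R d k).

Lemma measurable_factorial_counting k (S : set (k.-tuple E)) : measurable S ->
  measurable_fun setT (fun omega => factorial_counting k omega S).
Proof.
move=> mS; apply: measurable_tuple_counting; apply: measurableI => //.
exact: measurable_uniq_tuple.
Qed.

Lemma factorial_counting_seq k omega (B : set E) (s : seq E) (S : set (k.-tuple E)) :
    uniq s -> X omega `&` B = [set` s] -> S `<=` box (fun=> B) ->
  factorial_counting k omega S = (\sum_(t <- [seq t : k.-tuple E <- alltuples s k | uniq t]) \1_S t)%:E.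
Proof.
move=> us sE SB; pose U : set (k.-tuple E) := [set t : k.-tuple E | uniq t].
rewrite [LHS](@tuple_counting_seq _ _ B s (S `&` U) us sE); last by move=> t [/SB].
rewrite big_filter [in RHS]big_mkcond/=; congr (_%:E); apply: eq_bigr => t _.
rewrite !indicE; case: ifP => ut; last by rewrite memNset// => -[_]; rewrite /U/= ut.
by congr (nat_of_bool _)%:R; apply/idP/idP => /set_mem; [move=> []/mem_set|move=> St; apply/mem_set].
Qed.

Lemma integral_factorial_counting k omega (B : set E) (s : seq E) (f : k.-tuple E -> \bar R) :
    measurable B -> uniq s -> X omega `&` B = [set` s] ->
    measurable_fun setT f -> (forall t, 0 <= f t)%E ->
    (forall t, ~ box (fun=> B) t -> f t = 0%E) ->
  (\int[factorial_counting k omega]_t f t = \sum_(t <- alltuples s k | uniq t) f t)%E.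
Proof.
move=> mB us sE mf f0 fB; rewrite -big_filter.
apply: (@integral_counting_seq _ _ _ _ _ (box (fun=> B))) => //.
- exact: measurable_tuple_box.
- move=> t; rewrite mem_filter => /andP[_ /mem_alltuples ts]; apply/mem_set => i.
  by have : [set` s] (tnth t i) := ts i; rewrite -sE => -[].
- by move=> A mA AB; rewrite (factorial_counting_seq us sE).
Qed.

End factorial_counting.

Section campbell.
Context (R : realType) (d : nat) (dO : measure_display) (Omega : measurableType dO).
Variables (P : probability Omega R) (X : Omega -> set 'rV[R]_d) (X_pp : point_process X).
Local Notation E := 'rV[R]_d.

Lemma esum_distinct_tuples k omega (A : 'I_k -> set E) m :
    (forall i, A i `<=` @cube R d m) ->
  (\esum_(t in distinct_tuples k (X omega)) (\prod_(i < k) \1_(A i) (tnth t i))%:E =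
   factorial_counting X_pp k omega (box A))%E.
Proof.
move=> Am; have [s us sE] := enum_bounded X_pp omega (@bounded_cube R d m).
rewrite (factorial_counting_seq X_pp us sE); last by move=> t At i; exact: (Am i _ (At i)).
set u := [seq t : k.-tuple E <- alltuples s k | uniq t].
have uu : uniq u by rewrite filter_uniq// alltuples_uniq.
have sP x : x \in s <-> X omega x /\ @cube R d m x.
  by split => [xs|]; [have : [set` s] x by []; rewrite -sE|
    rewrite -[_ /\ _]/((X omega `&` @cube R d m) x) sE].
have uD t : t \in u -> distinct_tuples k (X omega) t.
  rewrite mem_filter => /andP[ut /mem_alltuples ts]; split => // i.
  by have /sP[] := ts i.
have prodE (t : k.-tuple E) : \prod_(i < k) (\1_(A i) (tnth t i) : R) = \1_(box A) t.
  rewrite indicE; case: (boolP (t \in box A)) => [|/negP] tA.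
    by rewrite big1// => i _; rewrite indicE mem_set//; move/set_mem: tA; exact.
  apply/eqP/prodf_eq0; move: tA; apply: contra_notP => H; apply/mem_set => i.
  by apply: contrapT => ntA; apply: H; exists i => //; rewrite indicE memNset.
transitivity (\esum_(t in distinct_tuples k (X omega) `&` [set` u]) (\1_(box A) t : R)%:E)%E.
  rewrite [RHS]esum_mkcondr; apply: eq_esum => t [ut Xt]; rewrite prodE.
  case: ifPn => // /negP tu; rewrite indicE memNset// => At; apply: tu; apply/mem_set.
  rewrite /= mem_filter ut; apply/mem_alltuples => i; apply/sP; split; first exact: Xt.
  exact: (Am i _ (At i)).
rewrite (_ : _ `&` _ = [set` u]); last by apply/seteqP; split => [t []//|t tu]; split => //; exact: uD.
rewrite esum_fset; last 2 first.
- exact: finite_seq.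
- by move=> t _; rewrite lee_fin indicE.
by rewrite -fsbig_seq// sumEFin.
Qed.

Lemma campbell k (rho : k.-tuple E -> R) (f : k.-tuple E -> \bar R) :
    joint_intensity P X rho -> measurable_fun setT f -> (forall t, 0 <= f t)%E ->
  (\int[P]_omega \int[factorial_counting X_pp k omega]_t f t =
   \int[measure_power lebesgue_rV k]_t ((rho t)%:E * f t))%E.
Proof.
move=> [mrho rho0 rhoP] mf f0.
have [M ME] := mixture_measure_ex P (@measurable_factorial_counting _ _ _ _ _ X_pp k).
have [nu nuE] := density_measure_ex (measure_power (@lebesgue_rV R d) k) rho0 mrho.
rewrite -(integral_density rho0 mrho (nu := nu))//.
transitivity (\int[M]_t f t)%E.
  apply/esym; apply: (@integral_mixture _ _ _ _ _ P (factorial_counting X_pp k)) => //.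
  exact: measurable_factorial_counting.
apply: eq_measure_integral => S mS _.
apply: (measure_unique (@bounded_tuple_boxes R d k) (fun m => box (fun=> @cube R d m))) => //.
- exact: measurable_bounded_tuple_boxes.
- move=> _ _ [A mA <-] [B mB <-]; exists (fun i => A i `&` B i).
    move=> i; have [mAi [p Ap]] := mA i; have [mBi _] := mB i.
    by split; [exact: measurableI|exists p => x [/Ap]].
  by apply/seteqP; split => [t AB|t [tA tB] i]; [split => i; case: (AB i)|split; [exact: tA|exact: tB]].
- by move=> m; exists (fun=> @cube R d m) => // i; split; [exact: measurable_cube|exists m].
- apply/seteqP; split => // t _; have [|m tm] := @common_cube R d k (fun i => [set tnth t i]).
    move=> i; have : [set: E] (tnth t i) by [].
    by rewrite -(@cube_cover R d) => -[m _ tm]; exists m => _ ->.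
  by exists m => // i; exact: tm.
- move=> _ [A mA <-]; have [m Am] := common_cube (fun i => (mA i).2).
  have bA i : measurable (A i) /\ bounded_set (A i).
    split; first exact: (mA i).1.
    have [r [rr rP]] := @bounded_cube R d m; exists r; split => // y /rP ry x /Am; exact: ry.
  rewrite ME nuE -(rhoP A bA).1; apply: eq_integral => omega _.
  by rewrite (@esum_distinct_tuples _ _ _ m).
- move=> m; have bA (i : 'I_k) : measurable (@cube R d m) /\ bounded_set (@cube R d m).
    by split; [exact: measurable_cube|exact: bounded_cube].
  rewrite ME; have [eqm ltm] := rhoP _ bA.
  move: ltm; rewrite -eqm; apply: le_lt_trans.
  rewrite le_eqVlt; apply/orP; left; apply/eqP/eq_integral => omega _.
  by rewrite (@esum_distinct_tuples _ _ (fun=> @cube R d m) m) => // i x.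
Qed.

End campbell.

(** * Second moments of sums over pairs *)

Section integral_nonmeasurable.
Local Open Scope ereal_scope.
Context d (T : measurableType d) (R : realType).
Variable mu : {measure set T -> \bar R}.

(* Integrals of nonnegative functions are suprema over simple functions, so
   monotonicity and homogeneity need no measurability. *)
Lemma ge0_le_integral_any (f g : T -> \bar R) :
  (forall x, 0 <= f x) -> (forall x, f x <= g x) ->
  \int[mu]_x f x <= \int[mu]_x g x.
Proof.
move=> f0 fg; have g0 x : 0 <= g x by exact: le_trans (fg x).
rewrite !ge0_integralTE//; apply: ge_ereal_sup => _ [h hf <-].
by apply: ereal_sup_ubound; exists h => // x; exact: le_trans (fg x).
Qed.

Import HBNNSimple.

Let ge0_le_integralZl (c : R) (f : T -> \bar R) : (0 < c)%R ->
  (forall x, 0 <= f x) -> c%:E * \int[mu]_x f x <= \int[mu]_x (c%:E * f x).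
Proof.
move=> c0 f0; rewrite -lee_pdivlMl// [leLHS]ge0_integralTE//.
apply: ge_ereal_sup => _ [h hf <-]; rewrite lee_pdivlMl//.
rewrite -integralT_nnsfun -ge0_integralZl//.
- apply: ge0_le_integral_any => x; first by rewrite mule_ge0 ?lee_fin// ltW.
  by rewrite lee_wpmul2l ?lee_fin// ltW.
- exact/measurable_EFinP.
- by move=> x _; rewrite lee_fin.
- by rewrite lee_fin ltW.
Qed.

Lemma ge0_integralZl_any (c : R) (f : T -> \bar R) : (0 <= c)%R ->
  (forall x, 0 <= f x) -> \int[mu]_x (c%:E * f x) = c%:E * \int[mu]_x f x.
Proof.
rewrite le_eqVlt => /predU1P[<- f0|c0 f0].
  by rewrite mul0e integral0_eq// => x _; rewrite mul0e.
apply/eqP; rewrite eq_le ge0_le_integralZl// andbT -lee_pdivrMl//.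
apply: le_trans (ge0_le_integralZl _ _) _; rewrite ?invr_gt0//.
  by move=> x; rewrite mule_ge0// lee_fin ltW.
by apply: ge0_le_integral_any => x; rewrite muleA -EFinM mulVf ?gt_eqF// mul1e.
Qed.

End integral_nonmeasurable.

Section integral_measure_power.
Local Open Scope ereal_scope.
Context d (T : measurableType d) (R : realType).
Variable mu : {sigma_finite_measure set T -> \bar R}.

Lemma integral_measure_power0 (f : 0.-tuple T -> \bar R) : measurable_fun setT f ->
  \int[measure_power mu 0]_t f t = f [tuple].
Proof. by move=> mf; rewrite integral_dirac// diracT mul1e. Qed.

Lemma integral_measure_powerS k (f : k.+1.-tuple T -> \bar R) :
    measurable_fun setT f -> (forall t, 0 <= f t) ->
  \int[measure_power mu k.+1]_t f t =
  \int[mu]_x \int[measure_power mu k]_t f (tuple_cons (x, t)).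
Proof.
move=> mf f0; have mc := @measurable_tuple_cons _ T k.
pose mk : {sigma_finite_measure set (k.-tuple T) -> \bar R} := measure_power mu k.
transitivity (\int[pushforward (mu \x mk) (@tuple_cons T k)]_t f t).
  exact: eq_measure_integral.
rewrite ge0_integral_pushforward// preimage_setT.
rewrite fubini_tonelli1//; first exact: measurableT_comp mf mc.
by move=> x; exact: f0.
Qed.

Let measurable_tuple_cons2 k x (f : k.+1.-tuple T -> \bar R) : measurable_fun setT f ->
  measurable_fun setT (fun t : k.-tuple T => f (tuple_cons (x, t))).
Proof.
move=> mf; apply: (measurableT_comp mf).
exact: measurableT_comp (measurable_tuple_cons (k := k)) (pair1_measurable x).
Qed.

Lemma integral_measure_power2 (f : 2.-tuple T -> \bar R) :
    measurable_fun setT f -> (forall t, 0 <= f t) ->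
  \int[measure_power mu 2]_t f t = \int[mu]_u \int[mu]_v f [tuple u; v].
Proof.
move=> mf f0; rewrite integral_measure_powerS//; apply: eq_integral => u _.
rewrite integral_measure_powerS//; last exact: measurable_tuple_cons2.
apply: eq_integral => v _; rewrite integral_measure_power0; last first.
  exact: (@measurable_tuple_cons2 0 v _ (@measurable_tuple_cons2 1 u f mf)).
by congr f; exact: val_inj.
Qed.

Lemma integral_measure_power3 (f : 3.-tuple T -> \bar R) :
    measurable_fun setT f -> (forall t, 0 <= f t) ->
  \int[measure_power mu 3]_t f t = \int[mu]_u \int[mu]_v \int[mu]_x f [tuple u; v; x].
Proof.
move=> mf f0; rewrite integral_measure_powerS//; apply: eq_integral => u _.
rewrite integral_measure_power2//; last exact: measurable_tuple_cons2.
Qed.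

Lemma integral_measure_power4 (f : 4.-tuple T -> \bar R) :
    measurable_fun setT f -> (forall t, 0 <= f t) ->
  \int[measure_power mu 4]_t f t =
  \int[mu]_u \int[mu]_v \int[mu]_x \int[mu]_y f [tuple u; v; x; y].
Proof.
move=> mf f0; rewrite integral_measure_powerS//; apply: eq_integral => u _.
rewrite integral_measure_power3//; last exact: measurable_tuple_cons2.
Qed.

End integral_measure_power.

Section distinct_sums.
Variables (T : choiceType) (R : comNzRingType) (s : seq T) (us : uniq s).

Let sum_eq (u : T) (G : T -> R) : u \in s ->
  \sum_(x <- s) (u == x)%:R * G x = G u.
Proof.
move=> su; rewrite (bigD1_seq u)//= eqxx mul1r big1 ?addr0// => x.
by rewrite eq_sym => /negbTE->; rewrite mul0r.
Qed.

Lemma sum_alltuples2 (f : 2.-tuple T -> R) :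
  \sum_(t <- alltuples s 2 | uniq t) f t =
  \sum_(u <- s) \sum_(v <- s) (u != v)%:R * f [tuple u; v].
Proof.
rewrite big_mkcond big_alltuplesS; apply: eq_bigr => u _.
rewrite big_alltuplesS; apply: eq_bigr => v _; rewrite big_alltuples0/= !inE andbT.
rewrite (_ : tuple_cons _ = [tuple u; v]); last exact: val_inj.
by case: (u != v); rewrite ?mul1r ?mul0r.
Qed.

Lemma sum_alltuples3 (f : 3.-tuple T -> R) :
  \sum_(t <- alltuples s 3 | uniq t) f t =
  \sum_(u <- s) \sum_(v <- s) \sum_(x <- s)
    (uniq [:: u; v; x])%:R * f [tuple u; v; x].
Proof.
rewrite big_mkcond big_alltuplesS; apply: eq_bigr => u _.
rewrite big_alltuplesS; apply: eq_bigr => v _.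
rewrite big_alltuplesS; apply: eq_bigr => x _; rewrite big_alltuples0.
rewrite (_ : tuple_cons _ = [tuple u; v; x]); last exact: val_inj.
by case: (uniq _); rewrite ?mul1r ?mul0r.
Qed.

Lemma sum_alltuples4 (f : 4.-tuple T -> R) :
  \sum_(t <- alltuples s 4 | uniq t) f t =
  \sum_(u <- s) \sum_(v <- s) \sum_(x <- s) \sum_(y <- s)
    (uniq [:: u; v; x; y])%:R * f [tuple u; v; x; y].
Proof.
rewrite big_mkcond big_alltuplesS; apply: eq_bigr => u _.
rewrite big_alltuplesS; apply: eq_bigr => v _.
rewrite big_alltuplesS; apply: eq_bigr => x _.
rewrite big_alltuplesS; apply: eq_bigr => y _; rewrite big_alltuples0.
rewrite (_ : tuple_cons _ = [tuple u; v; x; y]); last exact: val_inj.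
by case: (uniq _); rewrite ?mul1r ?mul0r.
Qed.

Variable F : T -> T -> R.
Hypotheses (FC : forall u v, F u v = F v u) (F0 : forall u, F u u = 0).

Lemma sum_distinct2 :
  \sum_(t <- alltuples s 2 | uniq t) F (tnth t ord0) (tnth t (inord 1)) =
  \sum_(u <- s) \sum_(v <- s) F u v.
Proof.
rewrite sum_alltuples2; apply: eq_bigr => u _; apply: eq_bigr => v _.
rewrite /tnth/= inordK//=.
by have [->|_] := eqVneq u v; rewrite ?mul1r// F0 mulr0.
Qed.

(* Expand the square over [u, v, x, y] according to the coincidences between
   the pairs [(u, v)] and [(x, y)]. *)
Lemma sqr_sum_pairs :
  (\sum_(u <- s) \sum_(v <- s) F u v) ^+ 2 =
  \sum_(t <- alltuples s 4 | uniq t)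
    F (tnth t ord0) (tnth t (inord 1)) * F (tnth t (inord 2)) (tnth t (inord 3)) +
  4%:R * \sum_(t <- alltuples s 3 | uniq t)
    F (tnth t ord0) (tnth t (inord 1)) * F (tnth t ord0) (tnth t (inord 2)) +
  2%:R * \sum_(t <- alltuples s 2 | uniq t)
    F (tnth t ord0) (tnth t (inord 1)) ^+ 2.
Proof.
pose Q (f : T -> T -> T -> T -> R) :=
  \sum_(u <- s) \sum_(v <- s) \sum_(x <- s) \sum_(y <- s) f u v x y.
have QD f g : Q f + Q g = Q (fun u v x y => f u v x y + g u v x y).
  rewrite /Q; do 4 (rewrite -big_split/=; apply: eq_bigr => ? _); by [].
have eqQ f g : (forall u v x y, f u v x y = g u v x y) -> Q f = Q g.
  by move=> fg; do 4 (apply: eq_bigr => ? _); rewrite fg.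
pose T2 := \sum_(u <- s) \sum_(v <- s) F u v ^+ 2.
pose T3 := \sum_(u <- s) \sum_(v <- s) \sum_(x <- s) F u v * F u x.
set S4 := \sum_(t <- alltuples s 4 | _) _.
set S3 := \sum_(t <- alltuples s 3 | _) _.
set S2 := \sum_(t <- alltuples s 2 | _) _.
have S2E : S2 = T2.
  rewrite /S2 sum_alltuples2; apply: eq_bigr => u _; apply: eq_bigr => v _.
  rewrite /tnth/= inordK//=.
  by have [->|_] := eqVneq u v; rewrite ?mul1r// F0 expr0n mulr0.
have T3E : T3 = S3 + T2.
  rewrite /S3 sum_alltuples3 /T3 /T2 -big_split/=; apply: eq_bigr => u _.
  rewrite -big_split/=; apply: eq_big_seq => v sv.
  rewrite -[X in _ + X](sum_eq (fun x => F u v * F u x))// -big_split/=.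
  apply: eq_bigr => x _; rewrite /tnth/= !inordK//= !inE negb_or !andbT.
  have [->|_] := eqVneq u v; first by rewrite F0 !mul0r !mulr0 addr0.
  have [->|_] := eqVneq u x; first by rewrite F0 !mulr0 addr0.
  by have [->|_] := eqVneq v x; rewrite ?mul1r ?mul0r ?addr0 ?add0r.
have T31 : Q (fun u v x y => (u == x)%:R * (F u v * F x y)) = T3.
  apply: eq_big_seq => u su; apply: eq_bigr => v _; rewrite exchange_big/=.
  by apply: eq_bigr => y _; rewrite (sum_eq (fun x => F u v * F x y)).
have T32 : Q (fun u v x y => (u == y)%:R * (F u v * F x y)) = T3.
  apply: eq_big_seq => u su; apply: eq_bigr => v _; apply: eq_bigr => x _.
  by rewrite (sum_eq (fun y => F u v * F x y))// (FC x).
have T33 : Q (fun u v x y => (v == x)%:R * (F u v * F x y)) = T3.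
  rewrite -T31 /Q exchange_big/=; do 4 (apply: eq_bigr => ? _).
  by rewrite (FC _ _ : F _ _ = F _ _).
have T34 : Q (fun u v x y => (v == y)%:R * (F u v * F x y)) = T3.
  rewrite -T32 /Q exchange_big/=; do 4 (apply: eq_bigr => ? _).
  by rewrite (FC _ _ : F _ _ = F _ _).
have T21 : Q (fun u v x y => (u == x)%:R * ((v == y)%:R * (F u v * F x y))) = T2.
  apply: eq_big_seq => u su; apply: eq_big_seq => v sv; rewrite exchange_big/=.
  rewrite -[RHS](sum_eq (fun y => F u v * F u y))//; apply: eq_bigr => y _.
  by rewrite (sum_eq (fun x => (v == y)%:R * (F u v * F x y))).
have T22 : Q (fun u v x y => (u == y)%:R * ((v == x)%:R * (F u v * F x y))) = T2.
  apply: eq_big_seq => u su; apply: eq_big_seq => v sv.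
  transitivity (\sum_(x <- s) (v == x)%:R * (F u v * F x u)); last first.
    by rewrite (sum_eq (fun x => F u v * F x u))// (FC v u) expr2.
  apply: eq_bigr => x _.
  by rewrite (sum_eq (fun y => (v == x)%:R * (F u v * F x y))).
have -> : (\sum_(u <- s) \sum_(v <- s) F u v) ^+ 2 = Q (fun u v x y => F u v * F x y).
  rewrite expr2 big_distrl/=; apply: eq_bigr => u _.
  rewrite big_distrl/=; apply: eq_bigr => v _.
  by rewrite big_distrr/=; apply: eq_bigr => x _; rewrite big_distrr.
have S4E : S4 = Q (fun u v x y => (uniq [:: u; v; x; y])%:R * (F u v * F x y)).
  rewrite /S4 sum_alltuples4; do 4 (apply: eq_bigr => ? _).
  by rewrite /tnth/= !inordK.
have key : Q (fun u v x y => F u v * F x y) +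
    (Q (fun u v x y => (u == x)%:R * ((v == y)%:R * (F u v * F x y))) +
     Q (fun u v x y => (u == y)%:R * ((v == x)%:R * (F u v * F x y)))) =
    S4 + (Q (fun u v x y => (u == x)%:R * (F u v * F x y)) +
          Q (fun u v x y => (u == y)%:R * (F u v * F x y)) +
          Q (fun u v x y => (v == x)%:R * (F u v * F x y)) +
          Q (fun u v x y => (v == y)%:R * (F u v * F x y))).
  rewrite S4E !QD; apply: eqQ => u v x y /=; rewrite !inE !negb_or !andbT.
  have [<-|uv] := eqVneq u v; first by rewrite F0 !(mul0r, mulr0, addr0).
  have [<-|xy] := eqVneq x y; first by rewrite F0 !(mul0r, mulr0, addr0).
  have [ux|ux] := eqVneq u x; have [uy|uy] := eqVneq u y;
  have [vx|vx] := eqVneq v x; have [vy|vy] := eqVneq v y;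
  rewrite ?(mul0r, mul1r, addr0, add0r) //=;
  by move: uv xy; subst; rewrite ?eqxx.
rewrite -[LHS](addrK (T2 + T2)) -{1}T21 -{1}T22 key T31 T32 T33 T34 T3E S2E.
by ring.
Qed.

End distinct_sums.

Section measurable_tuples.
Context d d' (T : measurableType d) (E : measurableType d').
Variables (f1 f2 f3 f4 : T -> E).
Hypotheses (m1 : measurable_fun setT f1) (m2 : measurable_fun setT f2)
  (m3 : measurable_fun setT f3) (m4 : measurable_fun setT f4).

Lemma measurable_tuple1 : measurable_fun setT (fun x => [tuple f1 x]).
Proof. exact: measurable_cons m1 (measurable_cst [tuple]). Qed.

Lemma measurable_tuple2 : measurable_fun setT (fun x => [tuple f1 x; f2 x]).
Proof. exact: measurable_cons m1 (measurable_cons m2 (measurable_cst [tuple])). Qed.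

Lemma measurable_tuple4 : measurable_fun setT (fun x => [tuple f1 x; f2 x; f3 x; f4 x]).
Proof.
exact: measurable_cons m1 (measurable_cons m2 (measurable_cons m3
  (measurable_cons m4 (measurable_cst [tuple])))).
Qed.

End measurable_tuples.

Section rV_measurable_fun.
Context (R : realType) (n : nat) d (T : measurableType d).
Variables (f g : T -> 'rV[R]_n).
Hypotheses (mf : measurable_fun setT f) (mg : measurable_fun setT g).

Let measurable_coordf (h : T -> 'rV[R]_n) (mh : measurable_fun setT h) i :
  measurable_fun setT (fun x => h x ord0 i).
Proof. exact: (measurableT_comp (@measurable_coord R n i) mh). Qed.

Lemma measurable_addrV : measurable_fun setT (fun x => f x + g x).
Proof.
apply: measurable_fun_rV => i; under eq_fun do rewrite mxE.
by apply: measurable_funD; exact: measurable_coordf.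
Qed.

Lemma measurable_subrV : measurable_fun setT (fun x => f x - g x).
Proof.
apply: measurable_fun_rV => i; under eq_fun do rewrite !mxE.
by apply: measurable_funB; exact: measurable_coordf.
Qed.

End rV_measurable_fun.

Section joint_intensities.
Context (R : realType) (d : nat) (dO : measure_display) (Omega : measurableType dO).
Variables (P : probability Omega R) (X : Omega -> set 'rV[R]_d).
Variable rho : forall k : nat, k.-tuple 'rV[R]_d -> R.
Hypothesis rho_joint : forall k : nat, (1 <= k <= 4)%N -> joint_intensity P X (@rho k).
Variables (rho_min : R) (rho_min_gt0 : 0 < rho_min).
Hypothesis rho_ge : forall u, rho_min <= intensity rho u.
Local Notation E := 'rV[R]_d.

Lemma intensity_gt0 u : 0 < intensity rho u.
Proof. exact: lt_le_trans (rho_ge u). Qed.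

Lemma measurable_intensity : measurable_fun setT (intensity rho).
Proof.
have [mrho _ _] := @rho_joint 1%N isT.
by apply: (measurableT_comp mrho); exact: measurable_tuple1.
Qed.

Lemma measurable_normalized_intensity k : (1 <= k <= 4)%N ->
  measurable_fun setT (@normalized_intensity R d rho k).
Proof.
move=> /rho_joint[mrho _ _]; apply: measurable_funM => //; apply: measurable_funV.
apply: measurable_prod => i _; apply: (measurableT_comp measurable_intensity).
exact: measurable_tnth.
Qed.

Lemma normalized_intensity_ge0 k (t : k.-tuple E) : (1 <= k <= 4)%N ->
  0 <= normalized_intensity rho t.
Proof.
move=> /rho_joint[_ rho0 _]; rewrite divr_ge0// prodr_ge0// => i _.
exact/ltW/intensity_gt0.
Qed.

Lemma joint_intensityE k (t : k.-tuple E) :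
  rho t = normalized_intensity rho t * \prod_(i < k) intensity rho (tnth t i).
Proof.
rewrite divfK// gt_eqF// prodr_gt0// => i _; exact: intensity_gt0.
Qed.

End joint_intensities.

Section pair_integral.
Context (R : realType) (d : nat).
Local Notation E := 'rV[R]_d.
Variables (W : set E) (mW : measurable W).

Lemma measurable_translate h : measurable (translate W h).
Proof.
rewrite (_ : translate W h = (fun u => u + h) @^-1` W); last first.
  by apply/seteqP; split => u /mem_translate.
by rewrite -[X in measurable X]setTI; apply: measurable_addrV.
Qed.

Lemma integral_pair (G : E -> R) : (forall h, 0 <= G h) -> measurable_fun setT G ->
  (\int[lebesgue_rV]_u \int[lebesgue_rV]_v (\1_W u * \1_W v * G (v - u))%:E =
   \int[lebesgue_rV]_h ((G h)%:E * lebesgue_rV (W `&` translate W h)))%E.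
Proof.
move=> G0 mG.
pose f (p : E * E) := (\1_W p.1 * \1_W (p.2 + p.1) * G p.2)%:E.
have mf : measurable_fun setT f.
  apply/measurable_EFinP; apply: measurable_funM; last exact: measurableT_comp mG measurable_snd.
  apply: measurable_funM; first exact: measurableT_comp (measurable_indic mW) measurable_fst.
  apply: measurableT_comp (measurable_indic mW) _.
  exact: measurable_addrV measurable_snd measurable_fst.
have f0 p : (0 <= f p)%E by rewrite lee_fin mulr_ge0// mulr_ge0.
transitivity (\int[lebesgue_rV]_u \int[lebesgue_rV]_h f (u, h))%E.
  apply: eq_integral => u _.
  rewrite -(@integral_shift_rV _ _ u); last 2 first.
  - by move=> v; rewrite lee_fin mulr_ge0// mulr_ge0.
  - apply/measurable_EFinP; apply: measurable_funM.
      by apply: measurable_funM => //; exact: measurable_indic.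
    by apply: (measurableT_comp mG); exact: measurable_subrV.
  by apply: eq_integral => h _; rewrite addrK.
rewrite (@fubini_tonelli _ _ E E R lebesgue_rV lebesgue_rV f mf f0).
apply: eq_integral => h _.
transitivity (\int[lebesgue_rV]_u ((G h)%:E * (\1_(W `&` translate W h) u)%:E))%E.
  apply: eq_integral => u _; rewrite -EFinM mulrC indicI /=; congr EFin.
  congr (_ * _ * _).
  by rewrite !indicE; congr (nat_of_bool _)%:R; apply/idP/idP => /set_mem;
    rewrite addrC => H; apply/mem_set/mem_translate.
rewrite ge0_integralZl_any ?integral_indic ?setIT//.
by apply: measurableI => //; exact: measurable_translate.
Qed.

End pair_integral.

Section kernel_moments.
Context (R : realType) (d : nat) (d_gt0 : (0 < d)%N).
Local Notation E := 'rV[R]_d.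
Variables (rmin rlen : R) (rmin_ge0 : 0 <= rmin) (rlen_gt0 : 0 < rlen).
Variables (w : R -> R) (w_weight : weight_function rlen w).
Variables (W : set E) (mW : measurable W).
Let volW := volume W.
Let e := edge_correction W.
Hypotheses (W_fin : (lebesgue_rV W < +oo)%E) (volW_gt0 : 0 < volume W).
Hypotheses (me : measurable_fun setT e) (eN : forall h, e (- h) = e h).
Hypothesis e_ge : forall h, annulus rmin rlen h -> 2^-1 <= e h.
Variables (psi : R -> R) (mpsi : measurable_fun `]0, rlen[ psi).
Hypothesis psi_ge0 : forall r, 0 < r < rlen -> 0 <= psi r.
Hypothesis psi_norm :
  (\int[lebesgue_measure]_(r in `]0%R, rlen[) (psi r ^+ 2 * w r)%:E <= 1)%E.

Let sa := sphere_area R d.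

Definition pair_kernel (h : E) : R :=
  ((fun h => psi (enorm h - rmin) * w (enorm h - rmin) /
    (enorm h ^+ d.-1 * edge_correction W h)) \_ (annulus rmin rlen)) h.

Local Notation k := pair_kernel.

Let annulus_itv (h : E) : annulus rmin rlen h -> 0 < enorm h - rmin < rlen.
Proof. by rewrite /annulus/= subr_gt0 ltrBlDl. Qed.

Let annulus_gt0 (h : E) : annulus rmin rlen h -> 0 < enorm h.
Proof. by move=> /andP[+ _]; exact: le_lt_trans. Qed.

Lemma measurable_annulus : measurable (@annulus R d rmin rlen).
Proof.
have := @measurable_enorm_itv R d `]rmin, rmin + rlen[.
by under eq_set do rewrite in_itv/=.
Qed.

Lemma measurable_annulus_comp (f : R -> R) : measurable_fun `]0, rlen[ f ->
  measurable_fun (@annulus R d rmin rlen) (fun h => f (enorm h - rmin)).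
Proof.
move=> mf; apply: (measurable_comp (F := `]0, rlen[%classic)) mf _ => //.
- by move=> _ [h /annulus_itv + <-] /=; rewrite in_itv.
- by apply: measurable_funB => //; apply/measurable_funTS; exact: measurable_enorm.
Qed.

Let e_gt0 h : annulus rmin rlen h -> 0 < e h.
Proof. by move=> /e_ge; apply: lt_le_trans; rewrite invr_gt0. Qed.

Lemma pair_kernel_ge0 h : 0 <= k h.
Proof.
rewrite /k patchE; case: ifPn => // /set_mem ann; have rr := annulus_itv ann.
have [_ w0 _] := w_weight; rewrite mulr_ge0//.
  by rewrite mulr_ge0 ?psi_ge0 ?w0.
by rewrite invr_ge0 mulr_ge0 ?exprn_ge0 ?enorm_ge0// ltW ?e_gt0.
Qed.

Lemma pair_kernelN h : k (- h) = k h.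
Proof.
rewrite /k !patchE (_ : (- h \in annulus rmin rlen) = (h \in annulus rmin rlen)); last first.
  by apply/idP/idP => /set_mem H; apply/mem_set; move: H; rewrite /annulus/= enormN.
by rewrite enormN -/e eN.
Qed.

Lemma pair_kernel0 : k 0 = 0.
Proof.
rewrite /k patchE memNset// /annulus/= enorm0.
by move=> /andP[]; rewrite ltNge rmin_ge0.
Qed.

Lemma measurable_pair_kernel : measurable_fun setT k.
Proof.
apply/(measurable_restrictT _ measurable_annulus).
have [mw _ _] := w_weight.
apply: measurable_funM; first by apply: measurable_funM; exact: measurable_annulus_comp.
apply: measurable_funV; apply: measurable_funM; last exact: measurable_funTS.
by apply: measurable_funX; apply: measurable_funTS; exact: measurable_enorm.
Qed.

Lemma lebesgue_rV_translate h :
  lebesgue_rV (W `&` translate W h) = (volume W * e h)%:E.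
Proof.
rewrite /e /edge_correction mulrC divfK ?gt_eqF// /volume fineK// ge0_fin_numE//.
apply: le_lt_trans W_fin; apply: le_measure.
- by apply/mem_set; apply: measurableI => //; exact: measurable_translate.
- exact/mem_set.
- by move=> u [].
Qed.

(* The edge correction in the kernel cancels the relative volume of the overlap. *)
Lemma integral_kernel_edge (phi : R -> R) :
    measurable_fun `]0, rlen[ phi -> (forall r, 0 < r < rlen -> 0 <= phi r) ->
  (\int[lebesgue_rV]_h ((k h * ((fun h => phi (enorm h - rmin)) \_ (annulus rmin rlen)) h)%:E *
     lebesgue_rV (W `&` translate W h)) =
   (volume W * sa)%:E *
     \int[lebesgue_measure]_(r in `]0%R, rlen[) (psi r * w r * phi r)%:E)%E.
Proof.
move=> mphi phi0; have [mw w0 _] := w_weight.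
have F0 r : 0 < r < rlen -> 0 <= psi r * w r * phi r.
  by move=> rr; rewrite !mulr_ge0 ?psi_ge0 ?w0 ?phi0.
have mF : measurable_fun `]0, rlen[ (fun r => psi r * w r * phi r).
  by apply: measurable_funM => //; exact: measurable_funM.
rewrite EFinM -muleA -(integral_annulus d_gt0 rmin_ge0 rlen_gt0 mF F0).
rewrite [in RHS]integral_mkcond -ge0_integralZl_any ?(ltW volW_gt0)//; last first.
  move=> h; rewrite patchE; case: ifPn => // /set_mem ann.
  by rewrite lee_fin divr_ge0 ?F0 ?annulus_itv ?exprn_ge0 ?enorm_ge0.
apply: eq_integral => h _; rewrite lebesgue_rV_translate -EFinM /k !patchE.
case: ifPn => [/set_mem ann|_]; last by rewrite mul0r mul0r mule0.
rewrite -EFinM; congr (_%:E); have := e_gt0 ann; rewrite -/e => e0.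
have r0 : enorm h ^+ d.-1 != 0 by rewrite expf_neq0// gt_eqF// annulus_gt0.
by field; rewrite r0 gt_eqF.
Qed.

End kernel_moments.

Section second_moment.
Context (R : realType) (d : nat) (d_gt0 : (0 < d)%N).
Context (dO : measure_display) (Omega : measurableType dO).
Variables (P : probability Omega R) (X : Omega -> set 'rV[R]_d) (X_pp : point_process X).
Local Notation E := 'rV[R]_d.
Variable rho : forall k : nat, k.-tuple 'rV[R]_d -> R.
Hypothesis rho_joint : forall k : nat, (1 <= k <= 4)%N -> joint_intensity P X (@rho k).
Variables (rho_min : R) (rho_min_gt0 : 0 < rho_min).
Hypothesis rho_ge : forall u, rho_min <= intensity rho u.
Variable g : R -> R.
Hypothesis g_isotropic : forall u v : E,
  normalized_intensity rho [tuple u; v] = g (enorm (v - u)).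
Variable g3 : E -> E -> R.
Hypothesis g3_invariant : forall v1 v2 v3 : E,
  normalized_intensity rho [tuple v1; v2; v3] = g3 (v2 - v1) (v3 - v1).
Variable g4 : E -> E -> E -> R.
Hypothesis g4_invariant : forall v1 v2 v3 v4 : E,
  normalized_intensity rho [tuple v1; v2; v3; v4] = g4 (v2 - v1) (v3 - v1) (v4 - v1).
Variables (rmin rlen : R) (rmin_ge0 : 0 <= rmin) (rlen_gt0 : 0 < rlen).
Variables (w : R -> R) (w_weight : weight_function rlen w).
Hypothesis g_L2 : L2w rlen w (fun r => g (r + rmin)).
Variables (C2 C3 C4 : R) (C2_ge0 : 0 <= C2) (C3_ge0 : 0 <= C3).
Hypothesis V2g : forall h : E, annulus rmin rlen h ->
  g (enorm h) * w (enorm h - rmin) <= C2 * enorm h ^+ d.-1.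
Hypothesis V2g3 : forall h1 h2 : E, annulus rmin rlen h1 -> annulus rmin rlen h2 ->
  g3 h1 h2 <= C3.
Hypothesis V3 : forall h1 h2 : E, annulus rmin rlen h1 -> annulus rmin rlen h2 ->
  (\int[lebesgue_rV]_h3 `|g4 h1 h3 (h2 + h3)%R - g (enorm h1) * g (enorm h2)|%:E <= C4%:E)%E.
Variables (W : set E) (mW : measurable W) (bW : bounded_set W).
Hypotheses (W_fin : (lebesgue_rV W < +oo)%E) (volW_gt0 : 0 < volume W).
Hypothesis me : measurable_fun setT (edge_correction W).
Hypothesis eN : forall h, edge_correction W (- h) = edge_correction W h.
Hypothesis e_ge : forall h, annulus rmin rlen h -> 2^-1 <= edge_correction W h.
Variables (psi : R -> R) (mpsi : measurable_fun `]0, rlen[ psi).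
Hypothesis psi_ge0 : forall r, 0 < r < rlen -> 0 <= psi r.
Hypothesis psi_norm :
  (\int[lebesgue_measure]_(r in `]0%R, rlen[) (psi r ^+ 2 * w r)%:E <= 1)%E.

Let sa := sphere_area R d.
Let volW := volume W.
Let k := pair_kernel rmin rlen w W psi.
Let ri := intensity rho.

Let ri_gt0 u : 0 < ri u. Proof. exact: intensity_gt0 rho_min_gt0 rho_ge u. Qed.
Let mri : measurable_fun setT ri. Proof. exact: measurable_intensity rho_joint. Qed.

Let k_ge0 h : 0 <= k h. Proof. exact: pair_kernel_ge0. Qed.
Let mk : measurable_fun setT k. Proof. exact: measurable_pair_kernel. Qed.

Definition pair_weight u v : R := \1_W u * \1_W v * k (v - u) / (ri u * ri v).
Local Notation F := pair_weight.

Let FC u v : F u v = F v u.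
Proof.
rewrite /F [\1_W u * _]mulrC [ri u * _]mulrC; congr (_ * _ / _).
by rewrite -opprB /k pair_kernelN.
Qed.

Let F0 u : F u u = 0.
Proof. by rewrite /F subrr /k pair_kernel0// mulr0 mul0r. Qed.

Let F_ge0 u v : 0 <= F u v.
Proof. by rewrite /F !mulr_ge0// invr_ge0 mulr_ge0// ltW. Qed.

Let measurable_F d' (T : measurableType d') (f1 f2 : T -> E) :
  measurable_fun setT f1 -> measurable_fun setT f2 ->
  measurable_fun setT (fun x => F (f1 x) (f2 x)).
Proof.
move=> m1 m2; have mi := @measurable_indic _ _ R setT _ mW.
apply: measurable_funM; last first.
  by apply: measurable_funV; apply: measurable_funM; exact: measurableT_comp mri _.
apply: measurable_funM; last by apply: (measurableT_comp mk); exact: measurable_subrV.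
by apply: measurable_funM; exact: measurableT_comp mi _.
Qed.

Let F_W u v : F u v != 0 -> W u /\ W v.
Proof.
rewrite /F => Fn; split; apply: contrapT => nW; move: Fn.
  by rewrite [\1_W u]indicE memNset// !mul0r eqxx.
by rewrite [\1_W v]indicE memNset// mulr0 !mul0r eqxx.
Qed.

Lemma theta_hatE omega (s : seq E) : uniq s -> X omega `&` W = [set` s] ->
  theta_hat ri rmin rlen w psi W (X omega) =
  (sa * volW)^-1 * \sum_(u <- s) \sum_(v <- s) F u v.
Proof.
move=> us sE; rewrite /theta_hat; congr (_ * _).
have sP x : x \in s <-> (X omega `&` W) x by rewrite sE.
pose ps := [seq (u, v) | u <- s, v <- s].
have ups : uniq ps by apply: allpairs_uniq => // -[u v] [u' v'] _ _ [-> ->].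
set D := (X in \sum_(p \in X) _).
transitivity (\sum_(p \in D) F p.1 p.2).
  apply: eq_fsbigr => -[u v] /set_mem[/= [Xu Wu] [Xv Wv] _ ann].
  rewrite /F !indicE !mem_set// !mul1r /k /pair_kernel patchE mem_set//.
  rewrite -[RHS]mulrA -invfM /=; congr (_ / _); ring.
rewrite (@fsbig_fwiden _ _ _ _ ps)//; first by rewrite big_allpairs_dep.
- by move=> [u v] [/= Xu Xv _ _]; apply/allpairsP; exists (u, v); split => //; apply/sP.
- move=> _ [/allpairsP[[u v] /= [/sP Xu /sP Xv ->]] nD] /=.
  have [->|uv] := eqVneq u v; first exact: F0.
  rewrite /F /k /pair_kernel patchE memNset ?mulr0 ?mul0r// => ann.
  by apply: nD; split => //; exact/eqP.
Qed.

Let f2 (t : 2.-tuple E) := F (tnth t ord0) (tnth t (inord 1)).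
Let f3 (t : 3.-tuple E) := F (tnth t ord0) (tnth t (inord 1)) * F (tnth t ord0) (tnth t (inord 2)).
Let f4 (t : 4.-tuple E) := F (tnth t ord0) (tnth t (inord 1)) * F (tnth t (inord 2)) (tnth t (inord 3)).

Let mf2 : measurable_fun setT f2.
Proof. by apply: measurable_F; exact: measurable_tnth. Qed.

Let mf3 : measurable_fun setT f3.
Proof. by apply: measurable_funM; apply: measurable_F; exact: measurable_tnth. Qed.

Let mf4 : measurable_fun setT f4.
Proof. by apply: measurable_funM; apply: measurable_F; exact: measurable_tnth. Qed.

Let f2_W t : ~ box (fun=> W) t -> f2 t = 0.
Proof.
apply: contra_notP => /eqP /F_W[W0 W1] i.
have [->|->//] : i = ord0 \/ i = inord 1; last by [].
by case: i => -[|[|]]//= ?; [left|right]; apply: val_inj; rewrite //= inordK.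
Qed.

Let f3_W t : ~ box (fun=> W) t -> f3 t = 0.
Proof.
apply: contra_notP => /eqP; rewrite /f3 mulf_eq0 negb_or => /andP[/F_W[W0 W1] /F_W[_ W2]] i.
have [->|[->|->]] : i = ord0 \/ i = inord 1 \/ i = inord 2; [|by []..].
by case: i => -[|[|[|]]]//= ?; [left|right; left|right; right];
  apply: val_inj; rewrite //= inordK.
Qed.

Let f4_W t : ~ box (fun=> W) t -> f4 t = 0.
Proof.
apply: contra_notP => /eqP; rewrite /f4 mulf_eq0 negb_or => /andP[/F_W[W0 W1] /F_W[W2 W3]] i.
have [->|[->|[->|->]]] : i = ord0 \/ i = inord 1 \/ i = inord 2 \/ i = inord 3; [|by []..].
by case: i => -[|[|[|[|]]]]//= ?;
  [left|right; left|right; right; left|right; right; right];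
  apply: val_inj; rewrite //= inordK.
Qed.

Let theta omega := theta_hat ri rmin rlen w psi W (X omega).
Let c := (sa * volW)^-1.

Let c_ge0 : 0 <= c.
Proof. by rewrite invr_ge0 mulr_ge0 ?ltW ?sphere_area_gt0. Qed.

Let thetaE omega :
  ((theta omega)%:E = c%:E * \int[factorial_counting X_pp 2 omega]_t (f2 t)%:E)%E.
Proof.
have [s us sE] := enum_bounded X_pp omega bW.
rewrite (integral_factorial_counting X_pp mW us sE)//.
- by rewrite sumEFin sum_distinct2// -EFinM /theta (theta_hatE us sE).
- exact/measurable_EFinP.
- by move=> t; rewrite lee_fin; exact: F_ge0.
- by move=> t /f2_W ->.
Qed.

Let theta2E omega : ((theta omega ^+ 2)%:E = (c ^+ 2)%:E *
  (\int[factorial_counting X_pp 4 omega]_t (f4 t)%:E +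
   (4 : R)%:E * \int[factorial_counting X_pp 3 omega]_t (f3 t)%:E +
   (2 : R)%:E * \int[factorial_counting X_pp 2 omega]_t (f2 t ^+ 2)%:E))%E.
Proof.
have [s us sE] := enum_bounded X_pp omega bW.
rewrite !(integral_factorial_counting X_pp mW us sE)//.
- by rewrite !sumEFin -!EFinM /theta (theta_hatE us sE) exprMn
    (sqr_sum_pairs us FC F0).
- by apply/measurable_EFinP; exact: measurable_funX.
- by move=> t; rewrite lee_fin sqr_ge0.
- by move=> t /f2_W ->; rewrite expr0n.
- exact/measurable_EFinP.
- by move=> t; rewrite lee_fin; apply: mulr_ge0; exact: F_ge0.
- by move=> t /f3_W ->.
- exact/measurable_EFinP.
- by move=> t; rewrite lee_fin; apply: mulr_ge0; exact: F_ge0.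
- by move=> t /f4_W ->.
Qed.

Lemma measurable_theta_hat : measurable_fun setT theta.
Proof.
apply: (eq_measurable_fun (fun omega =>
   c * fine (\int[factorial_counting X_pp 2 omega]_t (f2 t)%:E))).
  move=> omega _; apply: EFin_inj; rewrite thetaE EFinM fineK//.
  have [s us sE] := enum_bounded X_pp omega bW.
  rewrite (integral_factorial_counting X_pp mW us sE)//.
  - by rewrite sumEFin.
  - exact/measurable_EFinP.
  - by move=> t; rewrite lee_fin; exact: F_ge0.
  - by move=> t /f2_W ->.
apply: measurable_funM => //; apply: measurableT_comp; first exact: fine_measurable.
apply: measurable_fun_integral_kernel; first exact: measurable_factorial_counting.
- by move=> t; rewrite lee_fin; exact: F_ge0.
- exact/measurable_EFinP.
Qed.

Lemma theta_hat_ge0 omega : 0 <= theta omega.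
Proof.
have [s us sE] := enum_bounded X_pp omega bW.
by rewrite /theta (theta_hatE us sE) mulr_ge0// !sumr_ge0// => u _; rewrite sumr_ge0.
Qed.

Let g2 (h : E) := g (enorm h).

Let g2E h : g2 h = normalized_intensity rho [tuple 0; h].
Proof. by rewrite g_isotropic subr0. Qed.

Let g2_ge0 h : 0 <= g2 h.
Proof. by rewrite g2E; exact: (normalized_intensity_ge0 rho_joint rho_min_gt0 rho_ge). Qed.

Let mnorm j := @measurable_normalized_intensity _ _ _ _ _ _ _ rho_joint j.

Let mg2 : measurable_fun setT g2.
Proof.
have -> : g2 = (fun h => normalized_intensity rho [tuple 0; h]).
  by apply/funext => h; rewrite g2E.
by apply: (measurableT_comp (@mnorm 2 isT)); exact: measurable_tuple2.
Qed.

Let measurable_g4 d' (T : measurableType d') (h1 h2 h3 : T -> E) :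
  measurable_fun setT h1 -> measurable_fun setT h2 -> measurable_fun setT h3 ->
  measurable_fun setT (fun x => g4 (h1 x) (h2 x) (h3 x)).
Proof.
move=> m1 m2 m3.
have -> : (fun x => g4 (h1 x) (h2 x) (h3 x)) =
    (fun x => normalized_intensity rho [tuple 0; h1 x; h2 x; h3 x]).
  by apply/funext => x; rewrite g4_invariant !subr0.
by apply: (measurableT_comp (@mnorm 4 isT)); exact: measurable_tuple4.
Qed.

Let rho2E u v : rho [tuple u; v] = g2 (v - u) * (ri u * ri v).
Proof.
rewrite (joint_intensityE rho_min_gt0 rho_ge) g_isotropic.
by rewrite !big_ord_recl big_ord0 mulr1.
Qed.

Let rho3E u v x : rho [tuple u; v; x] = g3 (v - u) (x - u) * (ri u * ri v * ri x).
Proof.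
rewrite (joint_intensityE rho_min_gt0 rho_ge) g3_invariant.
by congr (_ * _); rewrite !big_ord_recl big_ord0 mulr1 -[RHS]mulrA.
Qed.

Let rho4E u v x y :
  rho [tuple u; v; x; y] = g4 (v - u) (x - u) (y - u) * (ri u * ri v * (ri x * ri y)).
Proof.
rewrite (joint_intensityE rho_min_gt0 rho_ge) g4_invariant.
by congr (_ * _); rewrite !big_ord_recl big_ord0 mulr1 -[RHS]mulrA.
Qed.

Let f2E u v : f2 [tuple u; v] = F u v.
Proof. by rewrite /f2 /tnth/= inordK. Qed.

Let f3E u v x : f3 [tuple u; v; x] = F u v * F u x.
Proof. by rewrite /f3 /tnth/= !inordK. Qed.

Let f4E u v x y : f4 [tuple u; v; x; y] = F u v * F x y.
Proof. by rewrite /f4 /tnth/= !inordK. Qed.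

Let rho_ge0 j (t : j.-tuple E) : (1 <= j <= 4)%N -> 0 <= rho t.
Proof. by move=> /rho_joint[]. Qed.

Let measurable_rho j : (1 <= j <= 4)%N -> measurable_fun setT (@rho j).
Proof. by move=> /rho_joint[]. Qed.

Lemma g_ge0 s : 0 <= s -> 0 <= g s.
Proof.
move=> s0; pose v : E := s *: delta_mx ord0 (Ordinal d_gt0).
have -> : s = enorm v; last exact: g2_ge0.
rewrite /v enormZ// /enorm (bigD1 (Ordinal d_gt0))//= big1 ?addr0; last first.
  by move=> i /negbTE id; rewrite mxE id andbF expr0n.
by rewrite mxE !eqxx expr1n sqrtr1 mulr1.
Qed.

Definition theta_coef := (\int[lebesgue_measure]_(r in `]0%R, rlen[)
  (psi r * w r * g (r + rmin))%:E)%E.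
Local Notation th := theta_coef.

Let kernel_edge (phi : R -> R) :
    measurable_fun `]0, rlen[ phi -> (forall r, 0 < r < rlen -> 0 <= phi r) ->
  (\int[lebesgue_rV]_h ((k h * ((fun h => phi (enorm h - rmin)) \_ (annulus rmin rlen)) h)%:E *
     lebesgue_rV (W `&` translate W h)) =
   (volW * sa)%:E *
     \int[lebesgue_measure]_(r in `]0%R, rlen[) (psi r * w r * phi r)%:E)%E.
Proof. exact: integral_kernel_edge. Qed.

Let k_out h : ~ annulus rmin rlen h -> k h = 0.
Proof. by move=> nh; rewrite /k /pair_kernel patchE memNset. Qed.

Let integral_kg : (\int[lebesgue_rV]_u \int[lebesgue_rV]_v
    (\1_W u * \1_W v * (k (v - u) * g2 (v - u)))%:E = (volW * sa)%:E * th)%E.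
Proof.
have [mgL _] := g_L2.
rewrite (integral_pair mW (G := fun h => k h * g2 h)); last 2 first.
- by move=> h; rewrite mulr_ge0.
- exact: measurable_funM.
rewrite /th -(kernel_edge mgL); last first.
  by move=> r /andP[r0 _]; apply: g_ge0; rewrite addr_ge0// ltW.
apply: eq_integral => h _; congr (_%:E * _)%E; rewrite patchE.
case: ifPn => [_|/negP nh]; first by rewrite subrK.
by rewrite k_out ?mul0r// => ?; apply: nh; exact/mem_set.
Qed.

Let integral_rho2 :
  (\int[measure_power lebesgue_rV 2]_t ((rho t)%:E * (f2 t)%:E) = (volW * sa)%:E * th)%E.
Proof.
rewrite integral_measure_power2; last 2 first.
- apply/measurable_EFinP; apply: measurable_funM => //; exact: measurable_rho.
- by move=> t; rewrite lee_fin; apply: mulr_ge0; [exact: rho_ge0|exact: F_ge0].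
rewrite -integral_kg; apply: eq_integral => u _; apply: eq_integral => v _.
rewrite -EFinM rho2E f2E /F; congr (_%:E).
have := ri_gt0 u; have := ri_gt0 v; set a := ri u; set b := ri v => b0 a0.
by field; rewrite !gt_eqF.
Qed.

Let iw := fine (\int[lebesgue_measure]_(r in `]0%R, rlen[) (w r)%:E)%E.

Let iwE : (\int[lebesgue_measure]_(r in `]0%R, rlen[) (w r)%:E = iw%:E)%E.
Proof.
have [_ w0 wfin] := w_weight; rewrite /iw fineK// ge0_fin_numE//.
by apply: integral_ge0 => r /=; rewrite in_itv/= => /w0; rewrite lee_fin.
Qed.

Let iw_ge0 : 0 <= iw.
Proof.
have [_ w0 _] := w_weight; apply/fine_ge0/integral_ge0 => r /=.
by rewrite in_itv/= => /w0; rewrite lee_fin.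
Qed.

Let mw : measurable_fun `]0, rlen[ w. Proof. by case: w_weight. Qed.

Let K1 := sa * (1 + iw).

Let sa_gt0 : 0 < sa. Proof. exact: sphere_area_gt0. Qed.

Let K1_ge0 : 0 <= K1. Proof. by rewrite mulr_ge0 ?addr_ge0// ltW. Qed.

Let integral_k_le : (\int[lebesgue_rV]_h (k h)%:E <= K1%:E)%E.
Proof.
have [_ w0 _] := w_weight.
pose f r := 2 * (psi r * w r).
have mf : measurable_fun `]0, rlen[ f by apply: measurable_funM => //; exact: measurable_funM.
have f0 r : 0 < r < rlen -> 0 <= f r by move=> rr; rewrite !mulr_ge0 ?psi_ge0 ?w0.
apply: (@le_trans _ _ (sa%:E * \int[lebesgue_measure]_(r in `]0%R, rlen[) (f r)%:E)%E).
  rewrite -(integral_annulus d_gt0 rmin_ge0 rlen_gt0 mf f0) [leRHS]integral_mkcond.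
  apply: ge0_le_integral_any => h; first by rewrite lee_fin.
  rewrite /k /pair_kernel !patchE; case: ifPn => // /set_mem ann.
  have rr : 0 < enorm h - rmin < rlen by move: ann; rewrite /annulus/= subr_gt0 ltrBlDl.
  have h0 : 0 < enorm h by move: ann => /andP[+ _]; exact: le_lt_trans.
  have e2 : (edge_correction W h)^-1 <= 2.
    by rewrite -[leRHS]invrK lef_pV2 ?e_ge// posrE; [apply: lt_le_trans (e_ge ann)|]; rewrite invr_gt0.
  have t0 : 0 <= psi (enorm h - rmin) * w (enorm h - rmin) / enorm h ^+ d.-1.
    by rewrite divr_ge0 ?mulr_ge0 ?psi_ge0 ?w0 ?exprn_ge0 ?ltW.
  rewrite lee_fin /= invfM mulrA /f -[2 * _ / _]mulrA [leRHS]mulrC.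
  exact: ler_wpM2l.
rewrite [K1%:E](EFinM sa) lee_wpmul2l ?lee_fin ?(ltW sa_gt0)//.
apply: (@le_trans _ _ (\int[lebesgue_measure]_(r in `]0%R, rlen[)
    ((psi r ^+ 2 * w r)%:E + (w r)%:E))%E).
  apply: ge0_le_integral => //.
  - exact/measurable_EFinP.
  - apply: emeasurable_funD; apply/measurable_EFinP => //.
    by apply: measurable_funM => //; exact: measurable_funX.
  - move=> r /=; rewrite in_itv/= => rr; rewrite -EFinD lee_fin /f.
    have := w0 r rr; set a := w r; set b := psi r => a0.
    have : 0 <= a * (b - 1) ^+ 2 by rewrite mulr_ge0// sqr_ge0.
    by rewrite expr2 => ?; rewrite expr2; lra.
rewrite ge0_integralD//.
- by rewrite iwE (EFinD 1) leeD2r.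
- by move=> r /=; rewrite in_itv/= => rr; rewrite lee_fin mulr_ge0 ?sqr_ge0 ?w0.
- by apply/measurable_EFinP; apply: measurable_funM => //; exact: measurable_funX.
- exact/measurable_EFinP.
Qed.

Let ik := fine (\int[lebesgue_rV]_h (k h)%:E)%E.

Let ikE : (\int[lebesgue_rV]_h (k h)%:E = ik%:E)%E.
Proof.
rewrite /ik fineK// ge0_fin_numE; first exact: le_lt_trans integral_k_le (ltry _).
by apply: integral_ge0 => h _; rewrite lee_fin.
Qed.

Let ik_ge0 : 0 <= ik.
Proof. by rewrite /ik; apply: fine_ge0; apply: integral_ge0 => h _; rewrite lee_fin. Qed.

Let ik_le : ik <= K1.
Proof. by rewrite -lee_fin -ikE. Qed.

Let integral_k_shift u : (\int[lebesgue_rV]_v (k (v - u))%:E = ik%:E)%E.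
Proof.
rewrite -ikE -(@integral_shift_rV _ _ u); last 2 first.
- by move=> v; rewrite lee_fin.
- by apply/measurable_EFinP; apply: (measurableT_comp mk); exact: measurable_subrV.
by apply: eq_integral => v _; rewrite addrK.
Qed.

Let integral_indic_W : (\int[lebesgue_rV]_u (\1_W u)%:E = volW%:E)%E.
Proof. by rewrite integral_indic// setIT /volW /volume fineK// ge0_fin_numE. Qed.

Let integral_rho2_sqr :
  (\int[measure_power lebesgue_rV 2]_t ((rho t)%:E * (f2 t ^+ 2)%:E) <=
   (2 * C2 * sa * volW / rho_min ^+ 2)%:E)%E.
Proof.
have [_ w0 _] := w_weight.
pose q := 2 * C2 / rho_min ^+ 2.
have q0 : 0 <= q by apply: divr_ge0; [apply: mulr_ge0|exact: sqr_ge0].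
pose phi r := q * psi r.
have mphi : measurable_fun `]0, rlen[ phi by exact: measurable_funM.
have phi0 r : 0 < r < rlen -> 0 <= phi r by move=> rr; rewrite mulr_ge0// psi_ge0.
pose p (h : E) := ((fun h => phi (enorm h - rmin)) \_ (annulus rmin rlen)) h.
have mp : measurable_fun setT p.
  by apply/(measurable_restrictT _ (measurable_annulus _ _)); exact: measurable_annulus_comp.
have p0 h : 0 <= p h.
  rewrite /p patchE; case: ifPn => // /set_mem ann; apply: phi0.
  by move: ann; rewrite /annulus/= subr_gt0 ltrBlDl.
rewrite integral_measure_power2; last 2 first.
- apply/measurable_EFinP; apply: measurable_funM; first exact: measurable_rho.
  exact: measurable_funX.
- by move=> t; rewrite lee_fin; apply: mulr_ge0; [exact: rho_ge0|exact: sqr_ge0].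
apply: (@le_trans _ _ (\int[lebesgue_rV]_u \int[lebesgue_rV]_v
    (\1_W u * \1_W v * (k (v - u) * p (v - u)))%:E)%E).
  apply: ge0_le_integral_any => u.
    apply: integral_ge0 => v _.
    by rewrite lee_fin; apply: mulr_ge0; [exact: rho_ge0|exact: sqr_ge0].
  apply: ge0_le_integral_any => v.
    by rewrite lee_fin; apply: mulr_ge0; [exact: rho_ge0|exact: sqr_ge0].
  rewrite -EFinM lee_fin rho2E f2E /F.
  have := ri_gt0 u; have := ri_gt0 v; set b := ri v; set a := ri u => b0 a0.
  have ab : (a * b)^-1 <= (rho_min ^+ 2)^-1.
    by rewrite lef_pV2 ?posrE ?mulr_gt0 ?exprn_gt0// expr2 ler_pM ?rho_ge// ltW.
  have i2 : (\1_W u * \1_W v) ^+ 2 = \1_W u * \1_W v :> R.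
    by rewrite -natrM -natrX; congr (_%:R); case: (u \in W); case: (v \in W).
  have kg : k (v - u) * g2 (v - u) * (a * b)^-1 <= p (v - u).
    have [ann|nann] := pselect (annulus rmin rlen (v - u)); last by rewrite k_out ?mul0r.
    rewrite /p patchE mem_set// /phi /q /=.
    have pe : 0 <= psi (enorm (v - u) - rmin).
      by apply: psi_ge0; move: ann; rewrite /annulus/= subr_gt0 ltrBlDl.
    have kg2 : k (v - u) * g2 (v - u) <= 2 * C2 * psi (enorm (v - u) - rmin).
      rewrite /k /pair_kernel patchE mem_set//.
      have n0 : 0 < enorm (v - u) ^+ d.-1.
        by rewrite exprn_gt0//; move: ann => /andP[+ _]; exact: le_lt_trans.
      have e1 := e_ge ann; have e0 : 0 < edge_correction W (v - u).
        by apply: lt_le_trans e1; rewrite invr_gt0.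
      have gw := V2g ann; rewrite -/(g2 _) in gw.
      move: n0 e1 e0 gw pe; set n := enorm _ ^+ _; set e := edge_correction _ _.
      set b1 := psi _; set b2 := w _; set b3 := g2 _ => n0 e1 e0 gw pe.
      rewrite (_ : _ * b3 = b1 * (b3 * b2) / (n * e)); last by ring.
      rewrite (ler_pdivrMr _ _ (mulr_gt0 n0 e0)).
      apply: (@le_trans _ _ (b1 * (C2 * n))); first exact: ler_wpM2l.
      rewrite (_ : 2 * C2 * b1 * (n * e) = b1 * (C2 * n) * (2 * e)); last by ring.
      by rewrite ler_peMr ?mulr_ge0 ?(ltW n0)//; lra.
    apply: (@le_trans _ _ (2 * C2 * psi (enorm (v - u) - rmin) / (rho_min ^+ 2))).
      by rewrite ler_pM ?mulr_ge0 ?invr_ge0 ?mulr_ge0 ?(ltW a0) ?(ltW b0).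
    by rewrite mulrAC.
  rewrite [leLHS](_ : _ = \1_W u * \1_W v * (k (v - u) * (k (v - u) * g2 (v - u) * (a * b)^-1))).
    by rewrite ler_wpM2l ?mulr_ge0// ler_wpM2l.
  rewrite -[in RHS]i2; field; rewrite !gt_eqF//.
rewrite (integral_pair mW (G := fun h => k h * p h)); last 2 first.
- by move=> h; rewrite mulr_ge0.
- exact: measurable_funM.
rewrite kernel_edge//.
apply: (@le_trans _ _ ((volW * sa)%:E * q%:E)%E); last first.
  by rewrite -EFinM lee_fin le_eqVlt; apply/orP; left; apply/eqP; rewrite /q; ring.
rewrite lee_wpmul2l ?lee_fin ?(mulr_ge0 (ltW volW_gt0) (ltW sa_gt0))//.
apply: (@le_trans _ _
    (\int[lebesgue_measure]_(r in `]0%R, rlen[) (q%:E * (psi r ^+ 2 * w r)%:E))%E).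
  rewrite le_eqVlt; apply/orP; left; apply/eqP/eq_integral => r _.
  by rewrite -EFinM; congr (_%:E); rewrite /phi; ring.
rewrite ge0_integralZl//.
- by rewrite -[leRHS]mule1 lee_wpmul2l.
- by apply/measurable_EFinP; apply: measurable_funM => //; exact: measurable_funX.
- by move=> r /=; rewrite in_itv/= => rr; rewrite lee_fin mulr_ge0 ?sqr_ge0 ?w0.
Qed.

Hypothesis C4_ge0 : 0 <= C4.

Let F_le u v : F u v * (ri u * ri v) = \1_W u * \1_W v * k (v - u).
Proof. by rewrite divfK// gt_eqF// mulr_gt0. Qed.

Let integral_rho3 :
  (\int[measure_power lebesgue_rV 3]_t ((rho t)%:E * (f3 t)%:E) <=
   (C3 / rho_min * volW * K1 ^+ 2)%:E)%E.
Proof.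
rewrite integral_measure_power3; last 2 first.
- apply/measurable_EFinP; apply: measurable_funM => //; exact: measurable_rho.
- by move=> t; rewrite lee_fin; apply: mulr_ge0; [exact: rho_ge0|apply: mulr_ge0; exact: F_ge0].
pose q := C3 / rho_min.
have q0 : 0 <= q by rewrite divr_ge0// ltW.
have i0 u : 0 <= \1_W u :> R by [].
have pos u v x : (0 <= (rho [tuple u; v; x])%:E * (f3 [tuple u; v; x])%:E)%E.
  by rewrite lee_fin; apply: mulr_ge0; [exact: rho_ge0|apply: mulr_ge0; exact: F_ge0].
apply: (@le_trans _ _ (\int[lebesgue_rV]_u \int[lebesgue_rV]_v \int[lebesgue_rV]_x
    (q * \1_W u * k (v - u) * k (x - u))%:E)%E).
  apply: ge0_le_integral_any => u.
    by apply: integral_ge0 => v _; apply: integral_ge0.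
  apply: ge0_le_integral_any => v; first by apply: integral_ge0.
  apply: ge0_le_integral_any => x; first exact: pos.
  rewrite -EFinM lee_fin rho3E f3E.
  have [a1|n1] := pselect (annulus rmin rlen (v - u)); last first.
    by rewrite /F (k_out n1) !(mulr0, mul0r).
  have [a2|n2] := pselect (annulus rmin rlen (x - u)); last first.
    by rewrite /F (k_out n2) !(mulr0, mul0r).
  have := V2g3 a1 a2; set c3 := g3 _ _ => c3C.
  have c30 : 0 <= c3.
    rewrite /c3 -g3_invariant.
    exact: (normalized_intensity_ge0 rho_joint rho_min_gt0 rho_ge).
  have ru := rho_ge u; rewrite -/ri in ru; have ru0 := ri_gt0 u.
  have rv0 := ri_gt0 v; have rx0 := ri_gt0 x.
  rewrite [leLHS](_ : _ = \1_W u * k (v - u) * k (x - u) *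
      (\1_W u * \1_W v * \1_W x * (c3 / ri u))); last first.
    rewrite /F; move: ru0 rv0 rx0; set a1' := ri u; set a2' := ri v; set a3' := ri x.
    by move=> *; field; rewrite !gt_eqF.
  rewrite [leRHS](_ : _ = \1_W u * k (v - u) * k (x - u) * q); last by ring.
  rewrite ler_wpM2l ?mulr_ge0//.
  apply: (@le_trans _ _ (c3 / ri u)).
    by rewrite ler_piMl ?divr_ge0 ?(ltW ru0)//.
  by rewrite ler_pM ?invr_ge0 ?(ltW ru0)// lef_pV2 ?posrE.
apply: (@le_trans _ _ (q * volW * ik ^+ 2)%:E); last first.
  rewrite lee_fin ler_wpM2l ?(mulr_ge0 q0 (ltW volW_gt0))//.
  by rewrite ler_pXn2r// nnegrE.
rewrite le_eqVlt; apply/orP; left; apply/eqP.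
transitivity (\int[lebesgue_rV]_u ((q * ik ^+ 2)%:E * (\1_W u)%:E))%E.
  apply: eq_integral => u _.
  transitivity (\int[lebesgue_rV]_v ((q * \1_W u * ik)%:E * (k (v - u))%:E))%E.
    apply: eq_integral => v _.
    transitivity (\int[lebesgue_rV]_x ((q * \1_W u * k (v - u))%:E * (k (x - u))%:E))%E.
      by apply: eq_integral => x _; rewrite -EFinM.
    rewrite ge0_integralZl_any; [|exact: mulr_ge0 (mulr_ge0 q0 (i0 _)) (k_ge0 _)|
      by move=> x; rewrite lee_fin].
    by rewrite integral_k_shift -!EFinM; congr (_%:E); ring.
  rewrite ge0_integralZl_any; [|exact: mulr_ge0 (mulr_ge0 q0 (i0 _)) ik_ge0|
    by move=> x; rewrite lee_fin].
  by rewrite integral_k_shift -!EFinM; congr (_%:E); ring.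
rewrite ge0_integralZl_any; [|exact: mulr_ge0 q0 (sqr_ge0 _)|by move=> x; rewrite lee_fin].
by rewrite integral_indic_W -EFinM; congr (_%:E); ring.
Qed.

Lemma theta_coef_fin : th \is a fin_num.
Proof.
have [_ w0 _] := w_weight; have [mgL gL] := g_L2.
have gr0 r : 0 < r < rlen -> 0 <= g (r + rmin).
  by move=> /andP[r0 _]; apply: g_ge0; rewrite addr_ge0// ltW.
rewrite ge0_fin_numE; last first.
  by apply: integral_ge0 => r /=; rewrite in_itv/= => rr; rewrite lee_fin !mulr_ge0 ?psi_ge0 ?w0 ?gr0.
apply: (@le_lt_trans _ _ (\int[lebesgue_measure]_(r in `]0%R, rlen[)
    ((psi r ^+ 2 * w r)%:E + (g (r + rmin) ^+ 2 * w r)%:E))%E).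
  apply: ge0_le_integral => //.
  - by move=> r /=; rewrite in_itv/= => rr; rewrite lee_fin !mulr_ge0 ?psi_ge0 ?w0 ?gr0.
  - by apply/measurable_EFinP; apply: measurable_funM => //; exact: measurable_funM.
  - by apply: emeasurable_funD; apply/measurable_EFinP; apply: measurable_funM => //; exact: measurable_funX.
  - move=> r /=; rewrite in_itv/= => rr; rewrite -EFinD lee_fin.
    have := w0 r rr; set a := w r; set b := psi r; set b' := g _ => a0.
    have : 0 <= a * (b - b') ^+ 2 by rewrite mulr_ge0// sqr_ge0.
    have : 0 <= a * (b + b') ^+ 2 by rewrite mulr_ge0// sqr_ge0.
    by rewrite !expr2 => ? ?; lra.
rewrite ge0_integralD//.
- rewrite lte_add_pinfty//; exact: le_lt_trans psi_norm (ltry _).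
- by move=> r /=; rewrite in_itv/= => rr; rewrite lee_fin mulr_ge0 ?sqr_ge0 ?w0.
- by apply/measurable_EFinP; apply: measurable_funM => //; exact: measurable_funX.
- by move=> r /=; rewrite in_itv/= => rr; rewrite lee_fin mulr_ge0 ?sqr_ge0 ?w0.
- by apply/measurable_EFinP; apply: measurable_funM => //; exact: measurable_funX.
Qed.

Let D h1 h3 h2 := `|g4 h1 h3 (h2 + h3) - g2 h1 * g2 h2|.

Let D_ge0 h1 h3 h2 : 0 <= D h1 h3 h2. Proof. exact: normr_ge0. Qed.

Let measurable_D d' (T : measurableType d') (h1 h3 h2 : T -> E) :
  measurable_fun setT h1 -> measurable_fun setT h3 -> measurable_fun setT h2 ->
  measurable_fun setT (fun x => D (h1 x) (h3 x) (h2 x)).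
Proof.
move=> m1 m3 m2; apply: measurableT_comp => //; apply: measurable_funB.
  by apply: measurable_g4 => //; exact: measurable_addrV.
by apply: measurable_funM; exact: measurableT_comp mg2 _.
Qed.

Let integral_kD h1 : annulus rmin rlen h1 ->
  (\int[lebesgue_rV]_h3 \int[lebesgue_rV]_h2 (k h2 * D h1 h3 h2)%:E <= (C4 * ik)%:E)%E.
Proof.
move=> a1; pose f (p : E * E) := (k p.2 * D h1 p.1 p.2)%:E.
have mf : measurable_fun setT f.
  apply/measurable_EFinP; apply: measurable_funM; first exact: measurableT_comp mk measurable_snd.
  by apply: measurable_D; [exact: measurable_cst|exact: measurable_fst|exact: measurable_snd].
have f0 p : (0 <= f p)%E by rewrite lee_fin; apply: mulr_ge0; [exact: k_ge0|exact: D_ge0].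
rewrite (@fubini_tonelli _ _ E E R lebesgue_rV lebesgue_rV f mf f0).
apply: (@le_trans _ _ (\int[lebesgue_rV]_h2 (C4%:E * (k h2)%:E))%E); last first.
  by rewrite ge0_integralZl_any ?ikE// => h; rewrite lee_fin.
apply: ge0_le_integral_any => h2; first by apply: integral_ge0.
have [a2|n2] := pselect (annulus rmin rlen h2); last first.
  rewrite (k_out n2) mule0 integral0_eq// => h3 _.
  by rewrite /f /= (k_out n2) mul0r.
apply: (@le_trans _ _ (\int[lebesgue_rV]_h3 ((k h2)%:E * (D h1 h3 h2)%:E))%E) => //.
rewrite ge0_integralZl_any//; last by move=> h3; rewrite lee_fin /D.
by rewrite muleC lee_wpmul2r ?lee_fin//; exact: V3.
Qed.

Let integral_kD_shift u v x : (\int[lebesgue_rV]_y (k (y - x) * D (v - u) (x - u) (y - x))%:E =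
  \int[lebesgue_rV]_h2 (k h2 * D (v - u) (x - u) h2)%:E)%E.
Proof.
rewrite -(@integral_shift_rV _ _ x) => [||].
- by apply: eq_integral => y _; rewrite addrK.
- by move=> y; rewrite lee_fin; apply: mulr_ge0; [exact: k_ge0|exact: D_ge0].
- apply/measurable_EFinP; apply: measurable_funM.
    by apply: (measurableT_comp mk); exact: measurable_subrV.
  by apply: measurable_D => //; exact: measurable_subrV.
Qed.

Let integral_kD_shift2 u v :
  (\int[lebesgue_rV]_x \int[lebesgue_rV]_y (k (y - x) * D (v - u) (x - u) (y - x))%:E =
   \int[lebesgue_rV]_h3 \int[lebesgue_rV]_h2 (k h2 * D (v - u) h3 h2)%:E)%E.
Proof.
under eq_integral do rewrite integral_kD_shift.
pose f (p : E * E) := (k p.2 * D (v - u) p.1 p.2)%:E.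
have mf : measurable_fun setT f.
  apply/measurable_EFinP; apply: measurable_funM; first exact: measurableT_comp mk measurable_snd.
  by apply: measurable_D; [exact: measurable_cst|exact: measurable_fst|exact: measurable_snd].
have f0 p : (0 <= f p)%E by rewrite lee_fin; apply: mulr_ge0; [exact: k_ge0|exact: D_ge0].
have mF := @measurable_fun_fubini_tonelli_F _ _ E E R lebesgue_rV f mf f0.
have fF0 x : (0 <= fubini_F lebesgue_rV f x)%E by exact: integral_ge0.
transitivity (\int[lebesgue_rV]_x fubini_F lebesgue_rV f (x - u)%R)%E.
  by apply: eq_integral.
rewrite -(@integral_shift_rV _ _ u) => [||].
- by apply: eq_integral => x _; rewrite addrK.
- by move=> x; exact: fF0.
- by apply: (measurableT_comp mF); exact: measurable_subrV.
Qed.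

Let integral_rho4 :
  (\int[measure_power lebesgue_rV 4]_t ((rho t)%:E * (f4 t)%:E) <=
   ((volW * sa)%:E * th) ^+ 2 + (C4 * volW * K1 ^+ 2)%:E)%E.
Proof.
pose b u v := \1_W u * \1_W v * (k (v - u) * g2 (v - u)).
have b0 u v : 0 <= b u v by rewrite !mulr_ge0.
have mb d' (T : measurableType d') (h1 h2 : T -> E) : measurable_fun setT h1 ->
    measurable_fun setT h2 -> measurable_fun setT (fun x => b (h1 x) (h2 x)).
  move=> m1 m2; have mi := @measurable_indic _ _ R setT _ mW.
  apply: measurable_funM; first by apply: measurable_funM; exact: measurableT_comp mi _.
  by apply: measurable_funM; [apply: (measurableT_comp mk)|apply: (measurableT_comp mg2)];
    exact: measurable_subrV.
pose a u v x y := \1_W u * k (v - u) * (k (y - x) * D (v - u) (x - u) (y - x)).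
have a0 u v x y : 0 <= a u v x y by rewrite !mulr_ge0.
pose t0 (t : 4.-tuple E) := tnth t ord0.
pose t1 (t : 4.-tuple E) := tnth t (inord 1).
pose t2 (t : 4.-tuple E) := tnth t (inord 2).
pose t3 (t : 4.-tuple E) := tnth t (inord 3).
have [mt0 mt1 mt2 mt3] : [/\ measurable_fun setT t0, measurable_fun setT t1,
    measurable_fun setT t2 & measurable_fun setT t3].
  by split; exact: measurable_tnth.
pose A t := (a (t0 t) (t1 t) (t2 t) (t3 t))%:E.
pose B t := (b (t0 t) (t1 t) * b (t2 t) (t3 t))%:E.
have mA : measurable_fun setT A.
  apply/measurable_EFinP; apply: measurable_funM.
    apply: measurable_funM; first exact: measurableT_comp (measurable_indic mW) mt0.
    by apply: (measurableT_comp mk); exact: measurable_subrV.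
  apply: measurable_funM; first by apply: (measurableT_comp mk); exact: measurable_subrV.
  by apply: measurable_D; exact: measurable_subrV.
have mB : measurable_fun setT B.
  by apply/measurable_EFinP; apply: measurable_funM; exact: mb.
have A0 t : (0 <= A t)%E by rewrite lee_fin.
have B0 t : (0 <= B t)%E by rewrite lee_fin mulr_ge0.
have tE (t : 4.-tuple E) : t = [tuple t0 t; t1 t; t2 t; t3 t].
  apply: val_inj; rewrite /t0 /t1 /t2 /t3 !(tnth_nth 0) !inordK//=.
  by case: t => -[|u [|v [|x [|y []]]]].
have AE u v x y : A [tuple u; v; x; y] = (a u v x y)%:E.
  by rewrite /A /t0 /t1 /t2 /t3 !(tnth_nth 0) !inordK.
have BE u v x y : B [tuple u; v; x; y] = (b u v * b x y)%:E.
  by rewrite /B /t0 /t1 /t2 /t3 !(tnth_nth 0) !inordK.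
apply: (@le_trans _ _ (\int[measure_power lebesgue_rV 4]_t (B t + A t))%E).
  apply: ge0_le_integral_any => t.
    by rewrite lee_fin; apply: mulr_ge0; [exact: rho_ge0|apply: mulr_ge0; exact: F_ge0].
  rewrite (tE t); move: (t0 t) (t1 t) (t2 t) (t3 t) => u v x y {t}.
  rewrite AE BE -EFinM -EFinD lee_fin rho4E f4E.
  rewrite [leLHS](_ : _ = g4 (v - u) (x - u) (y - u) *
    ((F u v * (ri u * ri v)) * (F x y * (ri x * ri y)))); last by ring.
  rewrite !F_le /a /b /D subrKA.
  have := ler_norm (g4 (v - u) (x - u) (y - u) - g2 (v - u) * g2 (y - x)).
  set d1 := `|_|; set c4 := g4 _ _ _; set c1 := g2 _; set c2 := g2 _ => dle.
  set k1 := k _; set k2 := k _.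
  have kk0 : 0 <= k1 * k2 by apply: mulr_ge0; exact: k_ge0.
  have d0 : 0 <= d1 by exact: normr_ge0.
  have kkd : 0 <= k1 * (k2 * d1) by rewrite mulrA; exact: mulr_ge0.
  rewrite !indicE; case: (u \in W) => /=; last by rewrite !(mul0r, mulr0) addr0.
  case: (v \in W) => /=; last by rewrite !(mul0r, mulr0, mul1r) add0r.
  case: (x \in W) => /=; last by rewrite !(mul0r, mulr0, mul1r) add0r.
  case: (y \in W) => /=; last by rewrite !(mul0r, mulr0, mul1r) add0r.
  rewrite !mul1r (_ : _ + _ = (c1 * c2 + d1) * (k1 * k2)); last by ring.
  by rewrite ler_wpM2r//; lra.
rewrite ge0_integralD//; apply: leeD.
  rewrite integral_measure_power4//.
  rewrite le_eqVlt; apply/orP; left; apply/eqP.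
  have [r rE] : exists r, ((volW * sa)%:E * th)%E = r%:E.
    by exists (fine ((volW * sa)%:E * th)%E); rewrite fineK// fin_numM// theta_coef_fin.
  have kgE := integral_kg; rewrite rE in kgE; rewrite rE.
  have r0 : 0 <= r.
    rewrite -lee_fin -kgE; apply: integral_ge0 => u _; apply: integral_ge0 => v _.
    by rewrite lee_fin; exact: b0.
  have bpos u : (0 <= \int[lebesgue_rV]_v (b u v)%:E)%E.
    by apply: integral_ge0 => v _; rewrite lee_fin.
  transitivity (\int[lebesgue_rV]_u (r%:E * \int[lebesgue_rV]_v (b u v)%:E))%E; last first.
    by rewrite ge0_integralZl_any// kgE expe2.
  apply: eq_integral => u _.
  transitivity (\int[lebesgue_rV]_v (r%:E * (b u v)%:E))%E; last first.
    by rewrite ge0_integralZl_any// => v; rewrite lee_fin.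
  apply: eq_integral => v _.
  transitivity (\int[lebesgue_rV]_x ((b u v)%:E * \int[lebesgue_rV]_y (b x y)%:E))%E; last first.
    by rewrite ge0_integralZl_any// kgE muleC.
  apply: eq_integral => x _.
  transitivity (\int[lebesgue_rV]_y ((b u v)%:E * (b x y)%:E))%E.
    by apply: eq_integral => y _; rewrite BE EFinM.
  by rewrite ge0_integralZl_any// => y; rewrite lee_fin.
rewrite integral_measure_power4//.
have i0 u : 0 <= \1_W u :> R by [].
apply: (@le_trans _ _ (\int[lebesgue_rV]_u \int[lebesgue_rV]_v
    (\1_W u * k (v - u) * (C4 * ik))%:E)%E).
  apply: ge0_le_integral_any => u; first by do 3 (apply: integral_ge0 => ? _).
  apply: ge0_le_integral_any => v; first by do 2 (apply: integral_ge0 => ? _).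
  have uk0 : 0 <= \1_W u * k (v - u) by rewrite mulr_ge0.
  have pos x : (0 <= \int[lebesgue_rV]_y (k (y - x) * D (v - u) (x - u) (y - x))%:E)%E.
    by apply: integral_ge0 => y _; rewrite lee_fin mulr_ge0.
  rewrite (_ : integral _ _ _ = ((\1_W u * k (v - u))%:E *
    \int[lebesgue_rV]_x \int[lebesgue_rV]_y (k (y - x) * D (v - u) (x - u) (y - x))%:E)%E).
    have [a1|n1] := pselect (annulus rmin rlen (v - u)); last first.
      by rewrite (k_out n1) mulr0 mul0r mul0e.
    by rewrite [leRHS]EFinM lee_wpmul2l ?lee_fin// integral_kD_shift2; exact: integral_kD.
  transitivity (\int[lebesgue_rV]_x ((\1_W u * k (v - u))%:E *
    \int[lebesgue_rV]_y (k (y - x) * D (v - u) (x - u) (y - x))%:E))%E; last first.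
    by rewrite ge0_integralZl_any.
  apply: eq_integral => x _.
  transitivity (\int[lebesgue_rV]_y ((\1_W u * k (v - u))%:E *
    (k (y - x) * D (v - u) (x - u) (y - x))%:E))%E.
    by apply: eq_integral => y _; rewrite AE /a EFinM.
  by rewrite ge0_integralZl_any// => y; rewrite lee_fin; apply: mulr_ge0; [exact: k_ge0|exact: D_ge0].
apply: (@le_trans _ _ (C4 * volW * ik ^+ 2)%:E); last first.
  rewrite lee_fin ler_wpM2l ?(mulr_ge0 C4_ge0 (ltW volW_gt0))//.
  by rewrite ler_pXn2r// nnegrE.
rewrite le_eqVlt; apply/orP; left; apply/eqP.
transitivity (\int[lebesgue_rV]_u ((C4 * ik ^+ 2)%:E * (\1_W u)%:E))%E.
  apply: eq_integral => u _.
  transitivity (\int[lebesgue_rV]_v ((\1_W u * (C4 * ik))%:E * (k (v - u))%:E))%E.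
    by apply: eq_integral => v _; rewrite -EFinM; congr (_%:E); ring.
  rewrite ge0_integralZl_any; [|exact: mulr_ge0 (i0 _) (mulr_ge0 C4_ge0 ik_ge0)|
    by move=> x; rewrite lee_fin].
  by rewrite integral_k_shift -!EFinM; congr (_%:E); ring.
rewrite ge0_integralZl_any; [|exact: mulr_ge0 C4_ge0 (sqr_ge0 _)|by move=> x; rewrite lee_fin].
by rewrite integral_indic_W -EFinM; congr (_%:E); ring.
Qed.

Lemma expectation_theta_hat : (\int[P]_omega (theta omega)%:E = th)%E.
Proof.
under eq_integral do rewrite thetaE.
rewrite ge0_integralZl_any ?c_ge0//; last first.
  by move=> omega; apply: integral_ge0 => t _; rewrite lee_fin; exact: F_ge0.
rewrite (campbell X_pp (@rho_joint 2 isT)); last 2 first.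
- exact/measurable_EFinP.
- by move=> t; rewrite lee_fin; exact: F_ge0.
rewrite integral_rho2 muleA -EFinM /c mulrC [sa * _]mulrC divff ?mul1e//.
by rewrite gt_eqF// mulr_gt0.
Qed.

Lemma mean_square_error_theta_hat :
  (\int[P]_omega ((theta omega - fine th) ^+ 2)%:E <=
   ((C4 * K1 ^+ 2 + 4 * (C3 / rho_min * K1 ^+ 2) + 4 * (C2 * sa / rho_min ^+ 2)) /
    sa ^+ 2 / volume W)%:E)%E.
Proof.
set Cst := _ / sa ^+ 2; set t := fine th.
have thE : th = t%:E by rewrite fineK// theta_coef_fin.
have t0 : 0 <= t by rewrite -lee_fin -thE -expectation_theta_hat; apply: integral_ge0 => omega _;
  rewrite lee_fin; exact: theta_hat_ge0.
have kpos j (f : j.-tuple E -> R) omega : (forall t, 0 <= f t) ->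
    (0 <= \int[factorial_counting X_pp j omega]_t (f t)%:E)%E.
  by move=> f0; apply: integral_ge0 => u _; rewrite lee_fin.
have mker j (f : j.-tuple E -> R) : (forall t, 0 <= f t) -> measurable_fun setT f ->
    measurable_fun setT (fun omega => \int[factorial_counting X_pp j omega]_t (f t)%:E)%E.
  move=> f0 mf; apply: measurable_fun_integral_kernel.
  - exact: measurable_factorial_counting.
  - by move=> u; rewrite lee_fin.
  - exact/measurable_EFinP.
have f2s0 u : 0 <= f2 u ^+ 2 by exact: sqr_ge0.
have f30 u : 0 <= f3 u by apply: mulr_ge0; exact: F_ge0.
have f40 u : 0 <= f4 u by apply: mulr_ge0; exact: F_ge0.
have mf2s : measurable_fun setT (fun u => f2 u ^+ 2) by exact: measurable_funX.
have camp j (f : j.-tuple E -> R) (j4 : (1 <= j <= 4)%N) : (forall t, 0 <= f t) ->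
    measurable_fun setT f ->
    (\int[P]_omega \int[factorial_counting X_pp j omega]_t (f t)%:E =
     \int[measure_power lebesgue_rV j]_t ((rho t)%:E * (f t)%:E))%E.
  move=> f0 mf; apply: (campbell X_pp (@rho_joint j j4)); first exact/measurable_EFinP.
  by move=> u; rewrite lee_fin.
have p4 omega := kpos 4%N f4 omega f40.
have p3 omega : (0 <= (4 : R)%:E * \int[factorial_counting X_pp 3 omega]_t (f3 t)%:E)%E.
  by apply: mule_ge0; [rewrite lee_fin|exact: kpos].
have p2 omega : (0 <= (2 : R)%:E * \int[factorial_counting X_pp 2 omega]_t (f2 t ^+ 2)%:E)%E.
  by apply: mule_ge0; [rewrite lee_fin|exact: kpos].
have M2 : (\int[P]_omega (theta omega ^+ 2)%:E <= (t ^+ 2 + Cst / volW)%:E)%E.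
  under eq_integral do rewrite theta2E.
  rewrite ge0_integralZl_any ?sqr_ge0//; last first.
    by move=> omega; exact: adde_ge0 (adde_ge0 (p4 omega) (p3 omega)) (p2 omega).
  rewrite (@ge0_integralD _ _ _ P _ measurableT).
  - rewrite (@ge0_integralD _ _ _ P _ measurableT).
    + rewrite !ge0_integralZl_any//; [|by move=> omega; exact: kpos..].
      rewrite (camp 4%N _ isT f40 mf4) (camp 3%N _ isT f30 mf3) (camp 2%N _ isT f2s0 mf2s).
      apply: (@le_trans _ _ ((c ^+ 2)%:E * (((volW * sa)%:E * th) ^+ 2 + (C4 * volW * K1 ^+ 2)%:E +
        (4 : R)%:E * (C3 / rho_min * volW * K1 ^+ 2)%:E +
        (2 : R)%:E * (2 * C2 * sa * volW / rho_min ^+ 2)%:E))%E).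
        apply: lee_wpmul2l; first by rewrite lee_fin sqr_ge0.
        apply: leeD; last by apply: lee_wpmul2l; [rewrite lee_fin|exact: integral_rho2_sqr].
        by apply: leeD; [exact: integral_rho4|
          apply: lee_wpmul2l; [rewrite lee_fin|exact: integral_rho3]].
      rewrite thE expe2 -!EFinM lee_fin le_eqVlt; apply/orP; left; apply/eqP.
      rewrite /Cst /c; move: sa_gt0 volW_gt0; rewrite -/volW => s0 v0.
      by field; rewrite !gt_eqF.
    + by move=> omega _; exact: p4.
    + exact: mker.
    + by move=> omega _; exact: p3.
    + by apply: measurable_funeM; exact: mker.
  - by move=> omega _; exact: adde_ge0 (p4 omega) (p3 omega).
  - by apply: emeasurable_funD; [|apply: measurable_funeM]; exact: mker.
  - by move=> omega _; exact: p2.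
  - by apply: measurable_funeM; exact: mker.
have mth := measurable_theta_hat.
have th0 omega : 0 <= theta omega by exact: theta_hat_ge0.
have key : (\int[P]_omega ((theta omega - t) ^+ 2)%:E + (2 * t ^+ 2)%:E =
    \int[P]_omega (theta omega ^+ 2)%:E + (t ^+ 2)%:E)%E.
  have P1 : (\int[P]_omega (t ^+ 2)%:E = (t ^+ 2)%:E)%E.
    transitivity ((t ^+ 2)%:E * P setT)%E; first exact: integral_cst.
    by rewrite probability_setT mule1.
  rewrite -[in RHS]P1 -ge0_integralD//.
  - rewrite (_ : (2 * t ^+ 2)%:E = \int[P]_omega ((2 * t)%:E * (theta omega)%:E))%E; last first.
      rewrite ge0_integralZl_any ?mulr_ge0// expectation_theta_hat thE -EFinM.
      by congr (_%:E); ring.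
    rewrite -ge0_integralD//.
    + by apply: eq_integral => omega _; rewrite -EFinM -!EFinD; congr (_%:E); ring.
    + by move=> omega _; rewrite lee_fin sqr_ge0.
    + by apply/measurable_EFinP; apply: measurable_funX; exact: measurable_funB.
    + by move=> omega _; rewrite -EFinM lee_fin; apply: mulr_ge0 (th0 _); exact: mulr_ge0.
    + by apply: measurable_funeM; exact/measurable_EFinP.
  - by move=> omega _; rewrite lee_fin sqr_ge0.
  - by apply/measurable_EFinP; exact: measurable_funX.
  - by move=> omega _; rewrite lee_fin sqr_ge0.
rewrite -(@leeD2rE _ (2 * t ^+ 2)%:E)// key.
apply: (@le_trans _ _ ((t ^+ 2 + Cst / volW)%:E + (t ^+ 2)%:E)%E); first exact: leeD2r.
by rewrite -!EFinD lee_fin /volW; lra.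
Qed.

End second_moment.

Section signed_coefficient.
Context (R : realType) (d : nat) (d_gt0 : (0 < d)%N).
Context (dO : measure_display) (Omega : measurableType dO).
Variables (P : probability Omega R) (X : Omega -> set 'rV[R]_d) (X_pp : point_process X).
Local Notation E := 'rV[R]_d.
Variable rho : forall k : nat, k.-tuple 'rV[R]_d -> R.
Hypothesis rho_joint : forall k : nat, (1 <= k <= 4)%N -> joint_intensity P X (@rho k).
Variables (rho_min : R) (rho_min_gt0 : 0 < rho_min).
Hypothesis rho_ge : forall u, rho_min <= intensity rho u.
Variable g : R -> R.
Hypothesis g_isotropic : forall u v : E,
  normalized_intensity rho [tuple u; v] = g (enorm (v - u)).
Variable g3 : E -> E -> R.
Hypothesis g3_invariant : forall v1 v2 v3 : E,
  normalized_intensity rho [tuple v1; v2; v3] = g3 (v2 - v1) (v3 - v1).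
Variable g4 : E -> E -> E -> R.
Hypothesis g4_invariant : forall v1 v2 v3 v4 : E,
  normalized_intensity rho [tuple v1; v2; v3; v4] = g4 (v2 - v1) (v3 - v1) (v4 - v1).
Variables (rmin rlen : R) (rmin_ge0 : 0 <= rmin) (rlen_gt0 : 0 < rlen).
Variables (w : R -> R) (w_weight : weight_function rlen w).
Hypothesis g_L2 : L2w rlen w (fun r => g (r + rmin)).
Variables (C2 C3 C4 : R) (C2_ge0 : 0 <= C2) (C3_ge0 : 0 <= C3) (C4_ge0 : 0 <= C4).
Hypothesis V2g : forall h : E, annulus rmin rlen h ->
  g (enorm h) * w (enorm h - rmin) <= C2 * enorm h ^+ d.-1.
Hypothesis V2g3 : forall h1 h2 : E, annulus rmin rlen h1 -> annulus rmin rlen h2 ->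
  g3 h1 h2 <= C3.
Hypothesis V3 : forall h1 h2 : E, annulus rmin rlen h1 -> annulus rmin rlen h2 ->
  (\int[lebesgue_rV]_h3 `|g4 h1 h3 (h2 + h3)%R - g (enorm h1) * g (enorm h2)|%:E <= C4%:E)%E.
Variables (W : set E) (mW : measurable W) (bW : bounded_set W).
Hypotheses (W_fin : (lebesgue_rV W < +oo)%E) (volW_gt0 : 0 < volume W).
Hypothesis me : measurable_fun setT (edge_correction W).
Hypothesis eN : forall h, edge_correction W (- h) = edge_correction W h.
Hypothesis e_ge : forall h, annulus rmin rlen h -> 2^-1 <= edge_correction W h.
Variables (phi : R -> R) (mphi : measurable_fun `]0, rlen[ phi).
Hypothesis phi_norm :
  (\int[lebesgue_measure]_(r in `]0%R, rlen[) (phi r ^+ 2 * w r)%:E <= 1)%E.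

Let sa := sphere_area R d.
Let K1 := sa * (1 + fine (\int[lebesgue_measure]_(r in `]0%R, rlen[) (w r)%:E)%E).

(* Four times the constant of [mean_square_error_theta_hat]: splitting [phi] into its
   positive and negative parts costs a factor 2 twice. *)
Definition mse_constant : R :=
  4 * ((C4 * K1 ^+ 2 + 4 * (C3 / rho_min * K1 ^+ 2) + 4 * (C2 * sa / rho_min ^+ 2)) /
  sa ^+ 2).

Let theta (psi : R -> R) omega := theta_hat (intensity rho) rmin rlen w psi W (X omega).

Let part_le (psi : R -> R) : measurable_fun `]0, rlen[ psi -> (forall r, psi r ^+ 2 <= phi r ^+ 2) ->
  (\int[lebesgue_measure]_(r in `]0%R, rlen[) (psi r ^+ 2 * w r)%:E <= 1)%E.
Proof.
have [mw w0 _] := w_weight; move=> mpsi psiphi; apply: le_trans phi_norm.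
apply: ge0_le_integral => //.
- by move=> r /=; rewrite in_itv/= => rr; rewrite lee_fin mulr_ge0 ?sqr_ge0 ?w0.
- by apply/measurable_EFinP; apply: measurable_funM => //; exact: measurable_funX.
- by apply/measurable_EFinP; apply: measurable_funM => //; exact: measurable_funX.
- by move=> r /=; rewrite in_itv/= => rr; rewrite lee_fin ler_wpM2r ?w0.
Qed.

Let mp : measurable_fun `]0, rlen[ phi^\+. Proof. exact: measurable_funrpos. Qed.
Let mn : measurable_fun `]0, rlen[ phi^\-. Proof. exact: measurable_funrneg. Qed.

Let pE r : phi^\+ r = Order.max (phi r) 0. Proof. by []. Qed.
Let nE r : phi^\- r = Order.max (- phi r) 0. Proof. by []. Qed.

Let p2 r : phi^\+ r ^+ 2 <= phi r ^+ 2.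
Proof. by rewrite pE; case: (leP (phi r) 0) => // _; rewrite expr0n sqr_ge0. Qed.

Let n2 r : phi^\- r ^+ 2 <= phi r ^+ 2.
Proof. by rewrite nE; case: (leP (- phi r) 0) => _; rewrite ?sqrrN// expr0n sqr_ge0. Qed.

Let phiE r : phi r = phi^\+ r - phi^\- r.
Proof. by rewrite pE nE; case: (leP (phi r) 0); case: (leP (- phi r) 0); lra. Qed.

Let thetaE omega : theta phi omega = theta phi^\+ omega - theta phi^\- omega.
Proof.
have [s us sE] := enum_bounded X_pp omega bW.
rewrite /theta !(theta_hatE rho rlen rmin_ge0 w _ us sE) -mulrBr; congr (_ * _).
rewrite -sumrB; apply: eq_bigr => u _; rewrite -sumrB; apply: eq_bigr => v _.
rewrite /pair_weight -mulrBl -mulrBr; congr (_ * _ / _).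
by rewrite /pair_kernel !patchE; case: ifP => _; rewrite ?subrr// -mulrBl -mulrBl -phiE.
Qed.

Lemma measurable_theta_hat_signed : measurable_fun setT (theta phi).
Proof.
apply: (eq_measurable_fun (fun omega => theta phi^\+ omega - theta phi^\- omega)).
  by move=> omega _; rewrite thetaE.
by apply: measurable_funB; apply: (measurable_theta_hat X_pp rho_joint rho_min_gt0 rho_ge) => //.
Qed.

Let th (psi : R -> R) := fine (theta_coef g rmin rlen w psi).

Let th_fin (psi : R -> R) : measurable_fun `]0, rlen[ psi -> (forall r, 0 <= psi r) ->
  (forall r, psi r ^+ 2 <= phi r ^+ 2) ->
  theta_coef g rmin rlen w psi \is a fin_num.
Proof.
move=> mpsi psi0 psiphi.
by apply: (theta_coef_fin d_gt0 rho_joint rho_min_gt0 rho_ge g_isotropic) => //; exact: part_le.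
Qed.

Let coefE : L2w_coef rlen w (fun r => g (r + rmin)) phi = th phi^\+ - th phi^\-.
Proof.
have [mw w0 _] := w_weight; have [mgL _] := g_L2.
have int (psi : R -> R) : measurable_fun `]0, rlen[ psi -> (forall r, 0 <= psi r) ->
  (forall r, psi r ^+ 2 <= phi r ^+ 2) ->
  (@lebesgue_measure R).-integrable `]0, rlen[ (EFin \o (fun r => psi r * w r * g (r + rmin))).
  move=> mpsi psi0 psiphi; apply/integrableP; split.
    by apply/measurable_EFinP; apply: measurable_funM => //; exact: measurable_funM.
  have := th_fin mpsi psi0 psiphi; rewrite ge0_fin_numE; last first.
    apply: integral_ge0 => r /=; rewrite in_itv/= => rr; rewrite lee_fin !mulr_ge0 ?w0//.
    apply: (g_ge0 d_gt0 rho_joint rho_min_gt0 rho_ge g_isotropic).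
    by case/andP: rr => r0 _; rewrite addr_ge0// ltW.
  apply: le_lt_trans; rewrite le_eqVlt; apply/orP; left; apply/eqP; apply: eq_integral => r /set_mem /=.
  rewrite in_itv/= => rr; rewrite ger0_norm// !mulr_ge0 ?w0//.
  apply: (g_ge0 d_gt0 rho_joint rho_min_gt0 rho_ge g_isotropic).
  by case/andP: rr => r0 _; rewrite addr_ge0// ltW.
rewrite /L2w_coef; under eq_Rintegral do rewrite phiE.
transitivity (\int[lebesgue_measure]_(r in `]0, rlen[)
    (phi^\+ r * w r * g (r + rmin) - phi^\- r * w r * g (r + rmin))).
  by apply: eq_Rintegral => r _; ring.
rewrite RintegralB//.
- by apply: int => // r; exact: funrpos_ge0.
- by apply: int => // r; exact: funrneg_ge0.
Qed.

Lemma mean_square_error_theta_hat_signed :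
  (\int[P]_omega ((theta phi omega - L2w_coef rlen w (fun r => g (r + rmin)) phi) ^+ 2)%:E <=
   (mse_constant / volume W)%:E)%E.
Proof.
have bound (psi : R -> R) : measurable_fun `]0, rlen[ psi -> (forall r, 0 <= psi r) ->
    (forall r, psi r ^+ 2 <= phi r ^+ 2) ->
    measurable_fun setT (theta psi) /\
    (\int[P]_omega ((theta psi omega - th psi) ^+ 2)%:E <= (mse_constant / 4 / volume W)%:E)%E.
  move=> mpsi psi0 psiphi; split.
    by apply: (measurable_theta_hat X_pp rho_joint rho_min_gt0 rho_ge) => // r _; exact: psi0.
  rewrite (_ : mse_constant / 4 = (C4 * K1 ^+ 2 + 4 * (C3 / rho_min * K1 ^+ 2) +
      4 * (C2 * sa / rho_min ^+ 2)) / sa ^+ 2); last by rewrite /mse_constant mulrAC divff ?mul1r.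
  apply: (mean_square_error_theta_hat d_gt0 X_pp rho_joint rho_min_gt0 rho_ge
    g_isotropic g3_invariant g4_invariant) => //; exact: part_le.
have [mP bP] := bound _ mp (funrpos_ge0 phi) p2.
have [mN bN] := bound _ mn (funrneg_ge0 phi) n2.
rewrite coefE; set t1 := th _; set t2 := th _.
have m1 : measurable_fun setT (fun omega => (theta phi^\+ omega - t1) ^+ 2).
  by apply: measurable_funX; exact: measurable_funB.
have m2 : measurable_fun setT (fun omega => (theta phi^\- omega - t2) ^+ 2).
  by apply: measurable_funX; exact: measurable_funB.
apply: (@le_trans _ _ (\int[P]_omega ((2 : R)%:E * (((theta phi^\+ omega - t1) ^+ 2)%:E +
    ((theta phi^\- omega - t2) ^+ 2)%:E)))%E).
  apply: ge0_le_integral_any => omega; first by rewrite lee_fin sqr_ge0.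
  rewrite thetaE -EFinD -EFinM lee_fin.
  have := sqr_ge0 ((theta phi^\+ omega - t1) + (theta phi^\- omega - t2)).
  by rewrite !expr2; lra.
rewrite ge0_integralZl_any//; last by move=> omega; rewrite adde_ge0 ?lee_fin ?sqr_ge0.
rewrite ge0_integralD//; [|by move=> omega _; rewrite lee_fin sqr_ge0
  |exact/measurable_EFinP|by move=> omega _; rewrite lee_fin sqr_ge0|exact/measurable_EFinP].
apply: (@le_trans _ _ ((2 : R)%:E * ((mse_constant / 4 / volume W)%:E + (mse_constant / 4 / volume W)%:E))%E).
  by apply: lee_wpmul2l; [rewrite lee_fin|exact: leeD].
by rewrite -EFinD -EFinM lee_fin; lra.
Qed.

End signed_coefficient.

(** * Orthonormal series *)

Lemma cvg_limn_einf (R : realType) (u : (\bar R)^nat) l : u @ \oo --> l -> limn_einf u = l.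
Proof. by case/cvg_limn_einf_sup. Qed.

Lemma cvg_limn_esup (R : realType) (u : (\bar R)^nat) l : u @ \oo --> l -> limn_esup u = l.
Proof. by case/cvg_limn_einf_sup. Qed.

Section orthonormal_series.
Local Open Scope ereal_scope.
Context dT (T : measurableType dT) (R : realType).
Variables (mu : {measure set T -> \bar R}) (mu_fin : mu setT < +oo).
Variable e : nat -> T -> R.
Hypothesis me : forall k, measurable_fun setT (e k).
Hypothesis e_orth : forall k l, \int[mu]_x (e k x * e l x)%:E = ((k == l)%:R)%:E.

Let e_sqr k : \int[mu]_x (e k x ^+ 2)%:E = 1.
Proof. by have := e_orth k k; rewrite eqxx; under eq_integral do rewrite -expr2. Qed.

Let isqr k : mu.-integrable setT (fun x => (e k x ^+ 2)%:E).
Proof.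
apply/integrableP; split; first exact/measurable_EFinP/measurable_funX.
under eq_integral do rewrite abse_EFin ger0_norm ?sqr_ge0//.
by rewrite e_sqr ltry.
Qed.

Let iprod k l : mu.-integrable setT (fun x => (e k x * e l x)%:E).
Proof.
apply: (le_integrable measurableT _ _ (integrableD measurableT (isqr k) (isqr l))).
  by apply/measurable_EFinP; exact: measurable_funM.
move=> x _; rewrite -EFinD !abse_EFin lee_fin normrM [leRHS]ger0_norm ?addr_ge0 ?sqr_ge0//.
rewrite -(real_normK (num_real (e k x))) -(real_normK (num_real (e l x))).
have := sqr_ge0 (`|e k x| - `|e l x|)%R.
by have := mulr_ge0 (normr_ge0 (e k x)) (normr_ge0 (e l x)); nra.
Qed.

Lemma integral_sqr_sum (a : nat -> R) m n :
  \int[mu]_x ((\sum_(m <= k < n) a k * e k x) ^+ 2)%:E = (\sum_(m <= k < n) a k ^+ 2)%:E.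
Proof.
have -> : (fun x => ((\sum_(m <= k < n) a k * e k x) ^+ 2)%:E) =
    (fun x => \sum_(k <- index_iota m n) \sum_(l <- index_iota m n)
       (a k * a l)%:E * (e k x * e l x)%:E).
  apply/funext => x; rewrite expr2 big_distrlr/= -sumEFin; apply: eq_bigr => k _.
  by rewrite -sumEFin; apply: eq_bigr => l _; rewrite -EFinM mulrACA.
have ikl k l : mu.-integrable setT (fun x => (a k * a l)%:E * (e k x * e l x)%:E).
  exact: integrableZl.
rewrite integral_sum//; last by move=> k; exact: integrable_sum.
rewrite -sumEFin; apply: eq_big_seq => k km.
rewrite integral_sum//.
under eq_bigr do rewrite integralZl// e_orth -EFinM.
rewrite (bigD1_seq k)//= ?iota_uniq// eqxx mulr1 big1 ?adde0 ?expr2//.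
by move=> l lk; rewrite eq_sym (negbTE lk) mulr0.
Qed.

Lemma integral_abs_orthonormal k : \int[mu]_x `|e k x|%:E <= 1 + mu setT.
Proof.
rewrite -(e_sqr k) -[mu setT]mul1e -(integral_cst mu measurableT) -ge0_integralD//.
- apply: ge0_le_integral => //.
  + by apply/measurable_EFinP; exact: measurableT_comp.
  + by apply: emeasurable_funD => //; exact/measurable_EFinP/measurable_funX.
  move=> x _; rewrite -EFinD lee_fin -(real_normK (num_real (e k x))).
  have := sqr_ge0 (`|e k x| - 1)%R; have := normr_ge0 (e k x); nra.
- by move=> x _; rewrite lee_fin sqr_ge0.
- exact/measurable_EFinP/measurable_funX.
Qed.

Lemma ae_cvg_orthonormal_series (a : nat -> R) : \sum_(0 <= k <oo) `|a k|%:E < +oo ->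
  {ae mu, forall x, cvgn (fun m => \sum_(0 <= k < m) a k * e k x)%R}.
Proof.
move=> a_fin; pose F x := \sum_(0 <= k <oo) (`|a k| * `|e k x|)%:E.
have mak k : measurable_fun setT (fun x => (`|a k| * `|e k x|)%:E).
  by apply/measurable_EFinP; apply: measurable_funM => //; exact: measurableT_comp.
have F0 x : 0 <= F x by apply: nneseries_ge0 => k _ _; rewrite lee_fin mulr_ge0.
have iF : mu.-integrable setT F.
  apply/integrableP; split.
    by apply: ge0_emeasurable_sum => // k x _ _; rewrite lee_fin mulr_ge0.
  under eq_integral do rewrite gee0_abs//.
  rewrite integral_nneseries//.
  apply: (@le_lt_trans _ _ (\sum_(0 <= k <oo) (1 + mu setT) * `|a k|%:E)).
    apply: lee_nneseries => [k _ _|k _].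
      by apply: integral_ge0 => x _; rewrite lee_fin mulr_ge0.
    under eq_integral do rewrite EFinM.
    rewrite ge0_integralZl//; last by apply/measurable_EFinP; exact: measurableT_comp.
    by rewrite muleC lee_wpmul2r// ?lee_fin// integral_abs_orthonormal.
  have M_fin : 1 + mu setT \is a fin_num.
    by rewrite fin_numD fin_numE /= ge0_fin_numE.
  rewrite -(fineK M_fin) nneseriesZl//.
  by rewrite lte_mul_pinfty// ?lee_fin ?fine_ge0 ?adde_ge0.
have /= := integrable_ae measurableT iF; apply: filterS => x /(_ I) Fx.
apply: (@normed_cvg R R^o (fun k => a k * e k x)%R).
apply: nondecreasing_is_cvgn.
  by apply: (@nondecreasing_series R (fun k => `|a k * e k x|%R) xpredT 0) => k _.
exists (fine (F x)) => _ [m _ <-]; rewrite -lee_fin fineK//.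
rewrite /= /series/= -sumEFin.
apply: le_trans (nneseries_lim_ge m _); last by move=> k _ _; rewrite lee_fin mulr_ge0.
by rewrite le_eqVlt; apply/orP; left; apply/eqP; apply: eq_bigr => k _; rewrite normrM.
Qed.

(* A version of the sum, defined everywhere and jointly measurable in [x] and any parameter
   of [a]: the upper limit is a finite limit almost everywhere when [a] is absolutely
   summable. *)
Definition series_sum (a : nat -> R) (x : T) : R :=
  fine (limn_esup (fun m => (\sum_(0 <= k < m) a k * e k x)%R%:E)).

Lemma measurable_series_sum (a : nat -> R) : measurable_fun setT (series_sum a).
Proof.
apply: measurableT_comp; first exact: fine_measurable.
apply: measurable_fun_limn_esup => n; apply/measurable_EFinP.
by apply: measurable_sum => k; exact: measurable_funM.
Qed.

Lemma ae_series_sum_cvg (a : nat -> R) : \sum_(0 <= k <oo) `|a k|%:E < +oo ->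
  {ae mu, forall x, (\sum_(0 <= k < m) a k * e k x)%R @[m --> \oo] --> series_sum a x}.
Proof.
move=> /ae_cvg_orthonormal_series; apply: filterS => x /cvg_ex[/= l sl].
rewrite /series_sum (_ : limn_esup _ = l%:E)//.
by apply: cvg_limn_esup; apply/cvg_EFin; [exact: nearW|exact: sl].
Qed.

Lemma integral_series_sum_tail (a : nat -> R) m : \sum_(0 <= k <oo) `|a k|%:E < +oo ->
  \int[mu]_x ((series_sum a x - \sum_(0 <= k < m) a k * e k x) ^+ 2)%:E <=
  \sum_(m <= k <oo) (a k ^+ 2)%:E.
Proof.
move=> a_fin; pose S n x := (\sum_(0 <= k < n) a k * e k x)%R.
have mS n : measurable_fun setT (S n) by apply: measurable_sum => k; exact: measurable_funM.
pose F n x := ((S (n + m)%N x - S m x) ^+ 2)%:E.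
have mF n : measurable_fun setT (F n).
  by apply/measurable_EFinP; apply: measurable_funX; exact: measurable_funB.
have F0 n x : setT x -> 0 <= F n x by rewrite lee_fin sqr_ge0.
have FE n x : F n x = ((\sum_(m <= k < n + m) a k * e k x) ^+ 2)%:E.
  by rewrite /F /S (@big_cat_nat _ _ _ m)//= ?leq_addl// addrAC subrr add0r.
apply: (@le_trans _ _ (\int[mu]_x limn_einf (F^~ x))); last first.
  apply: le_trans (fatou mu measurableT mF F0) _.
  rewrite (_ : (fun n => _) = (fun n => (\sum_(m <= k < n + m) (a k ^+ 2)%:E))); last first.
    apply/funext => n; under eq_integral do rewrite FE.
    by rewrite integral_sqr_sum sumEFin.
  rewrite (cvg_limn_einf (l := \sum_(m <= k <oo) (a k ^+ 2)%:E))//.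
  apply: (@cvg_comp _ _ _ (fun n => n + m)%N (fun n => \sum_(m <= k < n) (a k ^+ 2)%:E)).
    exact: cvg_addnr.
  by apply: is_cvg_nneseries => k _ _; rewrite lee_fin sqr_ge0.
apply: ae_ge0_le_integral => //.
- by move=> x _; rewrite lee_fin sqr_ge0.
- apply/measurable_EFinP; apply: measurable_funX; apply: measurable_funB => //.
    exact: measurable_series_sum.
  exact: mS.
- move=> x _; rewrite limn_einf_lim; apply: lime_ge; first exact: is_cvg_einfs.
  by apply: nearW => n; apply: le_ereal_inf_tmp => _ [j _ <-]; exact: F0.
- apply: measurableT_comp => //.
  by apply: measurable_fun_limn_esup => n; exact: measurableT_comp.
- have := ae_series_sum_cvg a_fin; apply: filterS => x Sx _.
  rewrite (cvg_limn_einf (l := ((series_sum a x - S m x) ^+ 2)%:E))//.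
  apply: cvg_EFin; first exact: nearW.
  have Sm : (S (n + m)%N x - S m x)%R @[n --> \oo] --> (series_sum a x - S m x)%R.
    apply: cvgB; last exact: cvg_cst.
    by apply: cvg_comp Sx; exact: cvg_addnr.
  by rewrite expr2; apply: cvg_trans (cvgM Sm Sm); apply: near_eq_cvg; exact: nearW.
Qed.

End orthonormal_series.

Lemma nneseries_sqr_fin (R : realType) (a : nat -> R) :
  (\sum_(0 <= k <oo) `|a k|%:E < +oo -> \sum_(0 <= k <oo) (a k ^+ 2)%:E < +oo)%E.
Proof.
move=> a_fin; pose M := (\sum_(0 <= k <oo) `|a k|%:E)%E.
have M_fin : M \is a fin_num by rewrite ge0_fin_numE// nneseries_ge0.
apply: (@le_lt_trans _ _ (\sum_(0 <= k <oo) (fine M)%:E * `|a k|%:E)%E).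
  apply: lee_nneseries => [k _ _|k _]; first by rewrite lee_fin sqr_ge0.
  rewrite -(real_normK (num_real (a k))) expr2 -EFinM lee_fin ler_wpM2r//.
  rewrite -lee_fin fineK//; apply: le_trans (nneseries_lim_ge k.+1 _) => //.
  by rewrite big_nat_recr//= leeDr// sume_ge0.
by rewrite nneseriesZl// lte_mul_pinfty// lee_fin fine_ge0// nneseries_ge0.
Qed.

Lemma le_sqrD3 (R : realType) (x y z : R) :
  (x + y + z) ^+ 2 <= 3 * x ^+ 2 + 3 * y ^+ 2 + 3 * z ^+ 2.
Proof.
have := sqr_ge0 (x - y); have := sqr_ge0 (y - z); have := sqr_ge0 (x - z).
nra.
Qed.

Section random_orthonormal_series.
Local Open Scope ereal_scope.
Context dT (T : measurableType dT) (R : realType).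
Variables (mu : {sigma_finite_measure set T -> \bar R}) (mu_fin : mu setT < +oo).
Variable e : nat -> T -> R.
Hypothesis me : forall k, measurable_fun setT (e k).
Hypothesis e_orth : forall k l, \int[mu]_x (e k x * e l x)%:E = ((k == l)%:R)%:E.

Lemma series_sum_cvg (a : nat -> R) : \sum_(0 <= k <oo) `|a k|%:E < +oo ->
  \int[mu]_x ((series_sum e a x - \sum_(0 <= k < m) a k * e k x) ^+ 2)%:E @[m --> \oo] --> 0.
Proof.
move=> a_fin.
have tail := nneseries_tail_cvg (nneseries_sqr_fin a_fin) (fun k _ => sqr_ge0 (a k)).
apply: squeeze_cvge; [apply: nearW => m|exact: cvg_cst|exact: tail].
apply/andP; split; last exact: integral_series_sum_tail.
by apply: integral_ge0 => x _; rewrite lee_fin sqr_ge0.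
Qed.

Variables (g : T -> R) (mg : measurable_fun setT g).
Variable theta : nat -> R.
Hypothesis g_series :
  \int[mu]_x ((g x - \sum_(0 <= k < m) theta k * e k x) ^+ 2)%:E @[m --> \oo] --> 0.

Let mS (a : nat -> R) m : measurable_fun setT (fun x => (\sum_(0 <= k < m) a k * e k x)%R).
Proof. by apply: measurable_sum => k; exact: measurable_funM. Qed.

Let m3 (f : T -> R) : measurable_fun setT f -> measurable_fun setT (fun x => (3 * f x ^+ 2)%:E).
Proof. by move=> mf; apply/measurable_EFinP; apply: measurable_funM => //; exact: measurable_funX. Qed.

Let int3 (f1 f2 f3 : T -> R) : measurable_fun setT f1 -> measurable_fun setT f2 ->
    measurable_fun setT f3 ->
  \int[mu]_x ((f1 x + f2 x + f3 x) ^+ 2)%:E <=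
  3%:E * (\int[mu]_x (f1 x ^+ 2)%:E) + 3%:E * (\int[mu]_x (f2 x ^+ 2)%:E) +
  3%:E * (\int[mu]_x (f3 x ^+ 2)%:E).
Proof.
move=> mf1 mf2 mf3.
have E (f : T -> R) : measurable_fun setT f ->
    3%:E * (\int[mu]_x (f x ^+ 2)%:E) = \int[mu]_x (3 * f x ^+ 2)%:E.
  move=> mf; under [RHS]eq_integral do rewrite EFinM.
  rewrite ge0_integralZl// ?lee_fin//.
  - exact/measurable_EFinP/measurable_funX.
  - by move=> x _; rewrite lee_fin sqr_ge0.
have p3 (f : T -> R) x : setT x -> 0 <= (3 * f x ^+ 2)%:E.
  by move=> _; rewrite lee_fin mulr_ge0 ?sqr_ge0.
rewrite !E// -ge0_integralD//; try first [exact: m3|exact: p3].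
rewrite -ge0_integralD//; try first [exact: m3|exact: p3]; last 2 first.
- by move=> x _; rewrite adde_ge0// ?p3.
- by apply: emeasurable_funD; exact: m3.
apply: ge0_le_integral => //.
- by move=> x _; rewrite lee_fin sqr_ge0.
- apply/measurable_EFinP; apply: measurable_funX.
  by apply: measurable_funD => //; exact: measurable_funD.
- by apply: emeasurable_funD; [apply: emeasurable_funD|]; exact: m3.
by move=> x _; rewrite -!EFinD lee_fin le_sqrD3.
Qed.

Lemma coef_sqr_fin : \int[mu]_x (g x ^+ 2)%:E < +oo ->
  \sum_(0 <= k <oo) (theta k ^+ 2)%:E < +oo.
Proof.
move=> g_fin.
apply: (@le_lt_trans _ _ (3%:E * \int[mu]_x (g x ^+ 2)%:E)); last first.
  by rewrite lte_mul_pinfty.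
have S_cvg : (\sum_(0 <= k < m) (theta k ^+ 2)%:E) @[m --> \oo] --> \sum_(0 <= k <oo) (theta k ^+ 2)%:E.
  by apply: is_cvg_nneseries => k _ _; rewrite lee_fin sqr_ge0.
pose v m := \int[mu]_x ((g x - \sum_(0 <= k < m) theta k * e k x) ^+ 2)%:E.
have v_cvg : (3%:E * \int[mu]_x (g x ^+ 2)%:E + 3%:E * v m) @[m --> \oo] -->
    3%:E * \int[mu]_x (g x ^+ 2)%:E + 3%:E * 0.
  by apply: cvgeD; [rewrite mule0 fin_num_adde_defl|exact: cvg_cst|exact: cvgeZl].
rewrite mule0 adde0 in v_cvg.
rewrite -(cvg_lim _ S_cvg)// -(cvg_lim _ v_cvg)//; apply: lee_lim.
- exact: cvgP S_cvg.
- exact: cvgP v_cvg.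
apply: nearW => m; rewrite sumEFin -(integral_sqr_sum me e_orth).
pose S x := (\sum_(0 <= k < m) theta k * e k x)%R.
have -> : (fun x => (S x ^+ 2)%:E) = (fun x => ((g x + - (g x - S x) + cst 0 x) ^+ 2)%:E).
  by apply/funext => x; congr (_ ^+ 2)%:E; rewrite /cst; ring.
apply: le_trans (int3 _ _ _) _ => //.
  by apply: measurableT_comp => //; apply: measurable_funB => //; exact: mS.
rewrite [X in _ + _ + 3%:E * X <= _](_ : _ = 0) ?mule0 ?adde0; last first.
  by rewrite integral0_eq// => x _; rewrite expr0n.
by under [X in _ + 3%:E * X <= _]eq_integral do rewrite sqrrN.
Qed.

Lemma integral_sqr_series_le (a : nat -> R) (G : T -> R) : measurable_fun setT G ->
    \int[mu]_x ((G x - \sum_(0 <= k < m) a k * e k x) ^+ 2)%:E @[m --> \oo] --> 0 ->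
  \int[mu]_x ((G x - g x) ^+ 2)%:E <= 3%:E * \sum_(0 <= k <oo) ((a k - theta k) ^+ 2)%:E.
Proof.
move=> mG Ga; set D := \sum_(0 <= k <oo) _.
have D0 : 0 <= D by apply: nneseries_ge0 => k _ _; rewrite lee_fin sqr_ge0.
pose u m := \int[mu]_x ((G x - \sum_(0 <= k < m) a k * e k x) ^+ 2)%:E.
pose v m := \int[mu]_x ((g x - \sum_(0 <= k < m) theta k * e k x) ^+ 2)%:E.
have le m : \int[mu]_x ((G x - g x) ^+ 2)%:E <= 3%:E * u m + 3%:E * D + 3%:E * v m.
  pose S1 x := (\sum_(0 <= k < m) a k * e k x)%R.
  pose S2 x := (\sum_(0 <= k < m) theta k * e k x)%R.
  have -> : (fun x => ((G x - g x) ^+ 2)%:E) =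
      (fun x => (((G x - S1 x) + (S1 x - S2 x) - (g x - S2 x)) ^+ 2)%:E).
    by apply/funext => x; congr (_ ^+ 2)%:E; ring.
  apply: le_trans (int3 _ _ _) _ => //; try by apply: measurable_funB => //; exact: mS.
    by apply: measurableT_comp => //; apply: measurable_funB => //; exact: mS.
  under [X in _ + _ + 3%:E * X <= _]eq_integral do rewrite sqrrN.
  apply: leeD => //; apply: leeD => //; apply: lee_wpmul2l => //.
  have -> : (fun x => ((S1 x - S2 x) ^+ 2)%:E) =
     (fun x => ((\sum_(0 <= k < m) (a k - theta k) * e k x) ^+ 2)%:E).
    apply/funext => x; rewrite /S1 /S2 -sumrB; congr (_ ^+ 2)%:E.
    by apply: eq_bigr => k _; rewrite mulrBl.
  rewrite (integral_sqr_sum me e_orth) -sumEFin; apply: nneseries_lim_ge => k _ _.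
  by rewrite lee_fin sqr_ge0.
have lim : (3%:E * u m + 3%:E * D + 3%:E * v m) @[m --> \oo] --> 3%:E * 0 + 3%:E * D + 3%:E * 0.
  apply: cvgeD; [by rewrite mule0 fin_num_adde_defl| |exact: cvgeZl].
  apply: cvgeD; [by rewrite mule0 fin_num_adde_defr|exact: cvgeZl|exact: cvg_cst].
rewrite !mule0 add0e adde0 in lim.
exact: cvge_to_ge lim (nearW _ le).
Qed.

Context dO (Omega : measurableType dO) (P : probability Omega R).
Variables (c : nat -> Omega -> R) (mc : forall k, measurable_fun setT (c k)).

Lemma mean_integral_sqr_series_le (G : Omega -> T -> R) :
    measurable_fun setT (fun p : Omega * T => G p.1 p.2) ->
    {ae P, forall omega,
      \int[mu]_x ((G omega x - \sum_(0 <= k < m) c k omega * e k x) ^+ 2)%:E @[m --> \oo] --> 0} ->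
  \int[mu]_x \int[P]_omega ((G omega x - g x) ^+ 2)%:E <=
  3%:E * \sum_(0 <= k <oo) \int[P]_omega ((c k omega - theta k) ^+ 2)%:E.
Proof.
move=> mG Gc.
have mc2 k : measurable_fun setT (fun omega => ((c k omega - theta k) ^+ 2)%:E).
  by apply/measurable_EFinP; apply: measurable_funX; exact: measurable_funB.
have c20 k omega : setT omega -> 0 <= ((c k omega - theta k) ^+ 2)%:E.
  by move=> _; rewrite lee_fin sqr_ge0.
pose F (p : Omega * T) := ((G p.1 p.2 - g p.2) ^+ 2)%:E.
have mF : measurable_fun setT F.
  apply/measurable_EFinP; apply: measurable_funX; apply: measurable_funB => //.
  by apply: measurableT_comp => //; exact: measurable_snd.
have F0 p : 0 <= F p by rewrite lee_fin sqr_ge0.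
have mG1 omega : measurable_fun setT (G omega).
  exact: (measurableT_comp mG (pair1_measurable omega)).
rewrite -(fubini_tonelli (m1 := P) (m2 := mu) F)// -integral_nneseries//.
have mD : measurable_fun setT (fun omega => \sum_(0 <= k <oo) ((c k omega - theta k) ^+ 2)%:E).
  by apply: ge0_emeasurable_sum => // k x _ _; exact: c20.
rewrite -ge0_integralZl// ?lee_fin//; last first.
  by move=> omega _; apply: nneseries_ge0 => k _ _; exact: c20.
apply: ae_ge0_le_integral => //.
- by move=> omega _; exact: integral_ge0.
- exact: measurable_fun_fubini_tonelli_F.
- by move=> omega _; rewrite mule_ge0//; apply: nneseries_ge0 => k _ _; exact: c20.
- exact: measurable_funeM.
- apply: filterS Gc => omega Gc _.
  exact: (integral_sqr_series_le (G := G omega)).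
Qed.

Hypothesis c_fin : \sum_(0 <= k <oo) \int[P]_omega `|c k omega|%:E < +oo.

Lemma measurable_random_series_sum :
  measurable_fun setT (fun p : Omega * T => series_sum e (c ^~ p.1) p.2).
Proof.
apply: measurableT_comp; first exact: fine_measurable.
apply: measurable_fun_limn_esup => n; apply/measurable_EFinP.
apply: measurable_sum => k; apply: measurable_funM; exact: measurableT_comp.
Qed.

Lemma ae_random_series_sum_cvg : {ae P, forall omega,
  \int[mu]_x ((series_sum e (c ^~ omega) x - \sum_(0 <= k < m) c k omega * e k x) ^+ 2)%:E
    @[m --> \oo] --> 0}.
Proof.
have mac k : measurable_fun setT (fun omega => `|c k omega|%:E).
  by apply/measurable_EFinP; exact: measurableT_comp.
pose F omega := \sum_(0 <= k <oo) `|c k omega|%:E.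
have iF : P.-integrable setT F.
  apply/integrableP; split; first by apply: ge0_emeasurable_sum.
  under eq_integral do rewrite gee0_abs ?nneseries_ge0//.
  by rewrite integral_nneseries.
have /= := integrable_ae measurableT iF; apply: filterS => omega /(_ I) Fx.
by apply: series_sum_cvg; rewrite -ge0_fin_numE// nneseries_ge0.
Qed.

End random_orthonormal_series.

Lemma finite_measure_sigma_finite_ex d (T : measurableType d) (R : realType)
    (m : {measure set T -> \bar R}) : (m setT < +oo)%E ->
  exists nu : {sigma_finite_measure set T -> \bar R}, forall U, nu U = m U.
Proof.
move=> m_fin.
by exists (mfrestr measurableT m_fin) => U; rewrite /= /mfrestr /mrestr/= setIT.
Qed.

Section weighted_L2.
Context (R : realType) (rlen : R).
Variables (w : R -> R) (w_weight : weight_function rlen w).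
Local Notation J := (`]0, rlen[%classic : set R).
Local Open Scope ereal_scope.

Lemma weight_measure_ex :
  exists nu : {sigma_finite_measure set (measurableTypeR R) -> \bar R},
  [/\ nu setT < +oo,
      forall H : R -> \bar R, measurable_fun setT H -> (forall x, 0 <= H x) ->
        \int[nu]_x H x = \int[lebesgue_measure]_(r in J) (H r * (w r)%:E)
    & forall f : R -> R, measurable_fun J f ->
        \int[nu]_x ((f \_ J) x)%:E = \int[lebesgue_measure]_(r in J) (f r * w r)%:E].
Proof.
have [mw w0 w_fin] := w_weight.
have mJ : measurable J by exact: measurable_itv.
have p0 x : (0 <= (w \_ J) x)%R.
  by rewrite patchE; case: ifPn => // /set_mem/=; rewrite in_itv/=; exact: w0.
have mp : measurable_fun setT (w \_ J) by exact/(measurable_restrictT _ mJ).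
have [nu0 nu0E] := @density_measure_ex _ _ R (@lebesgue_measure R) _ p0 mp.
have nu0_fin : nu0 setT < +oo.
  rewrite nu0E; apply: le_lt_trans w_fin; rewrite [leRHS]integral_mkcond.
  rewrite le_eqVlt; apply/orP; left; apply/eqP; apply: eq_integral => x _.
  by rewrite !patchE; case: ifP.
have [nu nuE] := finite_measure_sigma_finite_ex nu0_fin.
have nuI (H : R -> \bar R) : measurable_fun setT H -> (forall x, 0 <= H x) ->
    \int[nu]_x H x = \int[lebesgue_measure]_(r in J) (H r * (w r)%:E).
  move=> mH H0; rewrite (@integral_density _ _ _ (@lebesgue_measure R) nu _ p0 mp)//;
    last by move=> U _; exact: etrans (nuE U) (nu0E U).
  rewrite [RHS]integral_mkcond; apply: eq_integral => x _.
  by rewrite !patchE; case: ifP; rewrite ?mul0e// muleC.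
exists nu; split => [| |f mf]; first by apply: le_lt_trans nu0_fin; rewrite le_eqVlt (nuE setT) eqxx.
  exact: nuI.
have mH : measurable_fun setT (fun x => ((f \_ J) x)%:E).
  by apply/measurable_EFinP; exact/(measurable_restrictT _ mJ).
rewrite [LHS]integralE [RHS]integralE !nuI//; last 2 first.
- exact: measurable_funeneg.
- exact: measurable_funepos.
congr (_ - _); apply: eq_integral => r rJ.
- rewrite !funeposE patchE rJ muleC mulrC EFinM maxe_pMr// ?mule0//.
  by move: rJ => /set_mem/=; rewrite in_itv/= lee_fin => /w0.
- rewrite !funenegE patchE rJ muleC mulrC EFinM -muleN maxe_pMr// ?mule0//.
  by move: rJ => /set_mem/=; rewrite in_itv/= lee_fin => /w0.
Qed.

End weighted_L2.

Section L2w_series.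
Context (R : realType) (rmin rlen : R).
Variables (w : R -> R) (w_weight : weight_function rlen w).
Variables (phi : nat -> R -> R) (phi_basis : orthonormal_basis rlen w phi).
Variables (g : R -> R) (g_L2 : L2w rlen w (fun r => g (r + rmin))).
Local Notation J := (`]0, rlen[%classic : set R).
Local Notation theta k := (L2w_coef rlen w (fun r => g (r + rmin)) (phi k)).
Local Open Scope ereal_scope.

Let mJ : measurable J. Proof. exact: measurable_itv. Qed.

(* The basis [phi] is indexed from 1, the series in [e] from 0. *)
Let e k := (phi k.+1 \_ J)%R.
Let g0 := ((fun r => g (r + rmin)) \_ J)%R.

Let restrJ (f : R -> R) : measurable_fun J f -> measurable_fun setT (f \_ J).
Proof. by move=> mf; apply/(measurable_restrictT _ mJ). Qed.

Let me k : measurable_fun setT (e k).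
Proof. by have [mphi _ _] := phi_basis; apply: restrJ; exact: mphi. Qed.

Let sum_shift (a : nat -> R) m r :
  (\sum_(1 <= k < m.+1) a k * phi k r = \sum_(0 <= k < m) a k.+1 * phi k.+1 r)%R.
Proof. by rewrite big_add1. Qed.

Section weight_measure.
Variables (nu : {sigma_finite_measure set (measurableTypeR R) -> \bar R}).
Hypothesis nu_fin : nu setT < +oo.
Hypothesis nuI : forall H : R -> \bar R, measurable_fun setT H -> (forall x, 0 <= H x) ->
  \int[nu]_x H x = \int[lebesgue_measure]_(r in J) (H r * (w r)%:E).
Hypothesis nuE : forall f : R -> R, measurable_fun J f ->
  \int[nu]_x ((f \_ J) x)%:E = \int[lebesgue_measure]_(r in J) (f r * w r)%:E.

Let e_orth k l : \int[nu]_x (e k x * e l x)%:E = ((k == l)%:R)%:E.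
Proof.
have [mphi orth _] := phi_basis; rewrite -(eqSS k l) -orth// -nuE.
  apply: eq_integral => x _; rewrite /e !patchE; case: ifP => //.
  by rewrite mulr0.
by apply: measurable_funM; exact: mphi.
Qed.

Let integral_sqrJ (f : R -> R) (a : nat -> R) m : measurable_fun J f ->
  \int[nu]_x (((f \_ J) x - \sum_(0 <= k < m) a k * e k x) ^+ 2)%:E =
  \int[lebesgue_measure]_(r in J)
    ((f r - \sum_(0 <= k < m) a k * phi k.+1 r) ^+ 2 * w r)%:E.
Proof.
have [mphi _ _] := phi_basis; move=> mf; rewrite -nuE.
  apply: eq_integral => x _; rewrite /e !patchE; case: ifP => xJ.
    congr ((_ - _) ^+ 2)%:E; apply: eq_bigr => k _.
    by rewrite patchE xJ.
  rewrite big1 ?subrr ?expr0n// => k _.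
  by rewrite patchE xJ mulr0.
apply: measurable_funX; apply: measurable_funB => //.
apply: measurable_sum => k; apply: measurable_funM => //; exact: mphi.
Qed.

Let g0_series :
  \int[nu]_x ((g0 x - \sum_(0 <= k < m) theta k.+1 * e k x) ^+ 2)%:E @[m --> \oo] --> 0.
Proof.
have [_ _ /(_ _ g_L2)] := phi_basis; apply: cvg_trans; apply: near_eq_cvg.
apply: nearW => m; rewrite integral_sqrJ; last by case: g_L2.
by apply: eq_integral => r _; rewrite sum_shift.
Qed.

Lemma L2w_coef_sqr_fin_weight_measure : \sum_(0 <= k <oo) (theta k.+1 ^+ 2)%:E < +oo.
Proof.
have [mg g_fin] := g_L2; apply: (@coef_sqr_fin _ (measurableTypeR R) R nu e me e_orth g0 (restrJ mg)
  (fun k => theta k.+1) g0_series).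
apply: le_lt_trans g_fin; rewrite -nuE; last exact: measurable_funX.
rewrite le_eqVlt; apply/orP; left; apply/eqP; apply: eq_integral => x _.
by rewrite /g0 !patchE; case: ifP => // _; rewrite expr0n.
Qed.

Let integral_sqr_shift (F : R -> R) (a : nat -> R) m :
    measurable_fun J (fun r => F (r + rmin)%R) ->
  \int[lebesgue_measure]_(r in `]rmin, (rmin + rlen)%R[)
    ((F r - \sum_(1 <= k < m.+1) a k * phi k (r - rmin)) ^+ 2 * w (r - rmin))%:E =
  \int[nu]_x ((((fun r => F (r + rmin)%R) \_ J) x -
    \sum_(0 <= k < m) a k.+1 * e k x) ^+ 2)%:E.
Proof.
have [mphi _ _] := phi_basis; have [mw w0 _] := w_weight; move=> mF.
rewrite integral_sqrJ// -(@integral_shift_itv _ rmin rlen).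
- by apply: eq_integral => r _; rewrite subrK sum_shift.
- apply/measurable_EFinP; apply: measurable_funM => //.
  apply: measurable_funX; apply: measurable_funB => //.
  by apply: measurable_sum => k; apply: measurable_funM => //; exact: mphi.
- by move=> x xJ; rewrite lee_fin mulr_ge0 ?sqr_ge0 ?w0.
Qed.

Context dO (Omega : measurableType dO) (P : probability Omega R).
Variables (c : nat -> Omega -> R).
Hypothesis mc : forall k, (0 < k)%N -> measurable_fun setT (c k).

Lemma L2w_series_sum_ex : \sum_(0 <= k <oo) \int[P]_omega `|c k.+1 omega|%:E < +oo ->
  exists G, L2w_series_sum P rmin rlen w phi c G.
Proof.
move=> c_fin; pose S omega := series_sum e (fun k => c k.+1 omega).
have mS : measurable_fun setT (fun p : Omega * measurableTypeR R => S p.1 p.2).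
  exact: (@measurable_random_series_sum _ (measurableTypeR R) R e me _ _ _
    (fun k => mc (ltn0Sn k))).
exists (fun omega r => S omega (r - rmin)%R); split.
  apply: measurable_funTS.
  pose h (p : Omega * measurableTypeR R) : Omega * measurableTypeR R := (p.1, (p.2 - rmin)%R).
  have mh : measurable_fun setT h.
    apply/measurable_fun_pairP; split => /=; first exact: measurable_fst.
    have msub : measurable_fun setT ((fun x => x - rmin)%R : measurableTypeR R -> measurableTypeR R).
      exact: measurable_funB.
    exact: measurableT_comp msub measurable_snd.
  exact: measurableT_comp mS mh.
have := @ae_random_series_sum_cvg _ (measurableTypeR R) R nu nu_fin e me e_orth _ _ P _
  (fun k => mc (ltn0Sn k)) c_fin.
apply: filterS => omega; apply: cvg_trans; apply: near_eq_cvg; apply: nearW => m.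
have S0 x : x \notin J -> S omega x = 0%R.
  move=> xJ; rewrite /S /series_sum (cvg_limn_esup (l := 0))//.
  rewrite (_ : (fun _ => _) = fun=> 0); first exact: cvg_cst.
  apply/funext => n; rewrite big1// => k _.
  by rewrite /e patchE (negbTE xJ) mulr0.
have mS1 : measurable_fun setT (S omega).
  exact: (measurableT_comp mS (pair1_measurable omega)).
rewrite (integral_sqr_shift (F := fun r => S omega (r - rmin)%R)).
  apply: eq_integral => x _; congr ((_ - _) ^+ 2)%:E.
  by rewrite patchE addrK; case: ifPn => // /S0.
rewrite (_ : (fun r => _) = S omega); first exact: measurable_funTS.
by apply/funext => r; rewrite addrK.
Qed.

Lemma MISE_le_weight_measure d G : L2w_series_sum P rmin rlen w phi c G ->
  MISE d P rmin rlen w g G <= (sphere_area R d)%:E *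
    (3%:E * \sum_(0 <= k <oo) \int[P]_omega ((c k.+1 omega - theta k.+1) ^+ 2)%:E).
Proof.
have [mw w0 _] := w_weight; have [mg _] := g_L2.
case=> mG Gc; rewrite /MISE; set sa := sphere_area R d.
have sa0 : (0 <= sa)%R by apply: mulr_ge0 => //; exact: fine_ge0.
apply: lee_wpmul2l; first by rewrite lee_fin.
pose G0 omega x := ((fun r => G omega (r + rmin)%R) \_ J) x.
have mG0 : measurable_fun setT (fun p : Omega * measurableTypeR R => G0 p.1 p.2).
  have mTJ : measurable ([set: Omega] `*` (J : set (measurableTypeR R))) by exact: measurableX.
  have -> : (fun p : Omega * measurableTypeR R => G0 p.1 p.2) =
      (fun p => G p.1 (p.2 + rmin)%R) \_ ([set: Omega] `*` J).
    apply/funext => -[omega x]; rewrite /G0 !patchE/=; congr (if _ then _ else _).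
    by apply/idP/idP => /set_mem xJ; apply/mem_set => //; case: xJ.
  apply/(measurable_restrictT _ mTJ).
  pose h (p : Omega * measurableTypeR R) : Omega * measurableTypeR R := (p.1, (p.2 + rmin)%R).
  have mh : measurable_fun setT h.
    apply/measurable_fun_pairP; split => /=; first exact: measurable_fst.
    have madd : measurable_fun setT ((fun x => x + rmin)%R : measurableTypeR R -> measurableTypeR R).
      exact: measurable_funD.
    exact: measurableT_comp madd measurable_snd.
  have mI : measurable ([set: Omega] `*` (`]rmin, (rmin + rlen)%R[%classic : set (measurableTypeR R))).
    exact: measurableX.
  apply: (measurable_comp mI _ mG (measurable_funTS mh)).
  move=> _ [[omega x] [_ /= xJ] <-]; split => //=.
  by move: xJ; rewrite !in_itv/= ltrDr addrC ltrD2l.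
have mG1 omega : measurable_fun J (fun r => G omega (r + rmin)%R).
  apply/(measurable_restrictT _ mJ).
  exact: (measurableT_comp mG0 (pair1_measurable omega)).
have Gc0 : {ae P, forall omega,
    \int[nu]_x ((G0 omega x - \sum_(0 <= k < m) c k.+1 omega * e k x) ^+ 2)%:E
      @[m --> \oo] --> 0}.
  apply: filterS Gc => omega; apply: cvg_trans; apply: near_eq_cvg; apply: nearW => m.
  by rewrite (integral_sqr_shift (F := G omega)).
apply: le_trans (@mean_integral_sqr_series_le _ (measurableTypeR R) R nu e me e_orth g0
  (restrJ mg) (fun k => theta k.+1) g0_series _ _ P _ (fun k => mc (ltn0Sn k)) G0 mG0 Gc0).
pose H x := \int[P]_omega ((G0 omega x - g0 x) ^+ 2)%:E.
have mH : measurable_fun setT (H : measurableTypeR R -> \bar R).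
  apply: (@measurable_fun_fubini_tonelli_G _ _ Omega (measurableTypeR R) R P
    (fun p : Omega * measurableTypeR R => ((G0 p.1 p.2 - g0 p.2) ^+ 2)%:E)).
    apply/measurable_EFinP; apply: measurable_funX; apply: measurable_funB => //.
    exact: (measurableT_comp (restrJ mg) measurable_snd).
  by move=> p; rewrite lee_fin sqr_ge0.
have H0 x : 0 <= H x by apply: integral_ge0 => omega _; rewrite lee_fin sqr_ge0.
rewrite nuI// -(@integral_shift_itv _ rmin rlen).
- rewrite le_eqVlt; apply/orP; left; apply/eqP; apply: eq_integral => r rI.
  congr (_ * _); rewrite unlock; apply: eq_integral => omega _.
  rewrite /G0 /g0 !patchE mem_set ?subrK//.
  by move: rI => /set_mem/=; rewrite !in_itv/= subr_gt0 ltrBlDl.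
- by apply: emeasurable_funM; [exact: measurable_funTS|exact/measurable_EFinP].
- by move=> x xJ; apply: mule_ge0; [exact: H0|rewrite lee_fin; exact: w0].
Qed.

End weight_measure.

Lemma L2w_coef_sqr_fin : \sum_(0 <= k <oo) (theta k.+1 ^+ 2)%:E < +oo.
Proof. by have [nu [_ _ nuE]] := weight_measure_ex w_weight; exact: L2w_coef_sqr_fin_weight_measure nuE. Qed.

Context dO (Omega : measurableType dO) (P : probability Omega R).
Variables (c : nat -> Omega -> R).
Hypothesis mc : forall k, (0 < k)%N -> measurable_fun setT (c k).

Lemma L2w_seriesP : \sum_(0 <= k <oo) \int[P]_omega `|c k.+1 omega|%:E < +oo ->
  L2w_series_sum P rmin rlen w phi c (L2w_series P rmin rlen w phi c).
Proof.
have [nu [nu_fin _ nuE]] := weight_measure_ex w_weight; move=> c_fin.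
apply: (xgetPex (fun _ _ => 0%R) (P := L2w_series_sum P rmin rlen w phi c)).
exact: (L2w_series_sum_ex nu_fin nuE mc c_fin).
Qed.

Lemma MISE_le d G : L2w_series_sum P rmin rlen w phi c G ->
  MISE d P rmin rlen w g G <= (sphere_area R d)%:E *
    (3%:E * \sum_(0 <= k <oo) \int[P]_omega ((c k.+1 omega - theta k.+1) ^+ 2)%:E).
Proof.
move=> GG; have [nu [_ nuI nuE]] := weight_measure_ex w_weight.
exact: (MISE_le_weight_measure nuI nuE mc d GG).
Qed.
End L2w_series.

(** * Smoothed coefficients *)

Section smoothed_coefficients.
Local Open Scope ereal_scope.
Context dO (Omega : measurableType dO) (R : realType) (P : probability Omega R).
Variables (theta : nat -> R) (theta_fin : \sum_(0 <= k <oo) (theta k ^+ 2)%:E < +oo).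
Variable B : R.

Let integral_cst_probability (r : R) : \int[P]__ r%:E = r%:E.
Proof.
transitivity (r%:E * P setT); first exact: integral_cst.
by rewrite probability_setT mule1.
Qed.

Lemma bias_cvg (b : nat -> nat -> R) : (forall n k, (`|b n k| <= B)%R) ->
    (forall k, b n k @[n --> \oo] --> (1 : R)%R) ->
  \sum_(0 <= k <oo) ((b n k - 1) ^+ 2 * theta k ^+ 2)%:E @[n --> \oo] --> 0.
Proof.
move=> bB b1; pose D := ((B + 1) ^+ 2)%R.
have D0 : (0 <= D)%R by exact: sqr_ge0.
have bD n k : ((b n k - 1) ^+ 2 <= D)%R.
  rewrite -(real_normK (num_real _)) ler_sqr ?nnegrE ?addr_ge0//; last first.
    exact: le_trans (normr_ge0 _) (bB n k).
  by apply: le_trans (ler_normB _ _) _; rewrite normr1 lerD2r.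
have t0 n k : 0 <= ((b n k - 1) ^+ 2 * theta k ^+ 2)%:E by rewrite lee_fin mulr_ge0 ?sqr_ge0.
have tail : D%:E * \sum_(m <= k <oo) (theta k ^+ 2)%:E @[m --> \oo] --> 0.
  have := cvgeZl (y := D%:E) isT (nneseries_tail_cvg theta_fin (fun k _ => sqr_ge0 (theta k))).
  by rewrite mule0.
have head m : (\sum_(0 <= k < m) ((b n k - 1) ^+ 2 * theta k ^+ 2))%R @[n --> \oo] --> (0 : R)%R.
  elim: m => [|m IH].
    by under eq_fun do rewrite big_geq//; exact: cvg_cst.
  under eq_fun do rewrite big_nat_recr//=.
  have bk : (b n m - 1)%R @[n --> \oo] --> (1 - 1 : R)%R by apply: cvgB => //; exact: cvg_cst.
  have H : (\sum_(0 <= k < m) ((b n k - 1) ^+ 2 * theta k ^+ 2) +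
      (b n m - 1) * (b n m - 1) * theta m ^+ 2)%R @[n --> \oo] -->
      (0 + (1 - 1) * (1 - 1) * theta m ^+ 2 : R)%R.
    apply: cvgD => //; apply: cvgM; last exact: cvg_cst.
    exact: cvgM.
  by rewrite subrr !mul0r addr0 in H.
pose v n := \sum_(0 <= k <oo) ((b n k - 1) ^+ 2 * theta k ^+ 2)%:E.
have v0 n : 0 <= v n by apply: nneseries_ge0 => k _ _; exact: t0.
have v_le m n : v n <= (\sum_(0 <= k < m) ((b n k - 1) ^+ 2 * theta k ^+ 2))%:E +
    D%:E * \sum_(m <= k <oo) (theta k ^+ 2)%:E.
  rewrite /v (nneseries_split 0 m) ?add0n// -sumEFin leeD2l// -nneseriesZl//; last first.
    by move=> k _; rewrite lee_fin sqr_ge0.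
  apply: lee_nneseries => [k _ _|k _]; first exact: t0.
  by rewrite -EFinM lee_fin ler_wpM2r ?sqr_ge0.
have v_fin n : v n \is a fin_num.
  rewrite ge0_fin_numE//; apply: le_lt_trans (v_le 0%N n) _.
  by rewrite big_geq// add0e lte_mul_pinfty.
apply/fine_cvgP; split; first exact: nearW.
apply/cvgrPdist_le => eps eps0; have e2 : (0 < eps / 2)%R by rewrite divr_gt0.
have [fin_near /cvgrPdist_le/(_ _ e2) small] := (fine_cvgP _ _).1 tail.
have [m [m_fin m_le]] : exists m, D%:E * \sum_(m <= k <oo) (theta k ^+ 2)%:E \is a fin_num /\
    (fine (D%:E * \sum_(m <= k <oo) (theta k ^+ 2)%:E) <= eps / 2)%R.
  near \oo => m; exists m; split; first by near: m.
  by apply: le_trans (ler_norm _) _; rewrite -normrN -[X in (`|X|)%R]add0r; near: m.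
have /cvgrPdist_le/(_ _ e2) := head m; apply: filterS => n.
rewrite !sub0r !normrN => hn; rewrite ger0_norm; last exact: (fine_ge0 (v0 n)).
rewrite -lee_fin (fineK (v_fin n)).
apply: le_trans (v_le m n) _.
rewrite -(fineK m_fin) -EFinD lee_fin [leRHS](splitr eps) lerD//.
exact: le_trans (ler_norm _) hn.
Unshelve. all: by end_near.
Qed.

Variables (T : nat -> Omega -> R) (mT : forall k, measurable_fun setT (T k)) (eps : R).
Hypothesis T_err : forall k, \int[P]_omega ((T k omega - theta k) ^+ 2)%:E <= eps%:E.
Variables (b : nat -> R) (b_fin : \sum_(0 <= k <oo) `|b k|%:E < +oo).

Let eps_ge0 : (0 <= eps)%R.
Proof.
by rewrite -lee_fin; apply: le_trans (T_err 0%N); apply: integral_ge0 => ? _; rewrite lee_fin sqr_ge0.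
Qed.

Let mT2 k : measurable_fun setT (fun omega => ((T k omega - theta k) ^+ 2)%:E).
Proof. by apply/measurable_EFinP; apply: measurable_funX; exact: measurable_funB. Qed.

Lemma expectation_abs_smoothed_fin : \sum_(0 <= k <oo) \int[P]_omega `|b k * T k omega|%:E < +oo.
Proof.
pose S := \sum_(0 <= k <oo) (theta k ^+ 2)%:E.
have S0 : 0 <= S by apply: nneseries_ge0 => k _ _; rewrite lee_fin sqr_ge0.
have S_fin : S \is a fin_num by rewrite ge0_fin_numE.
pose M := (eps + (2 + fine S))%R.
have M0 : (0 <= M)%R by rewrite !addr_ge0 ?fine_ge0.
have theta_le k : (`|theta k| <= 1 + fine S)%R.
  have : (theta k ^+ 2 <= fine S)%R.
    rewrite -lee_fin fineK//; apply: le_trans (nneseries_lim_ge k.+1 _) => //.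
      by rewrite big_nat_recr//= leeDr// sume_ge0// => i _; rewrite lee_fin sqr_ge0.
    by move=> i _ _; rewrite lee_fin sqr_ge0.
  by rewrite -(real_normK (num_real (theta k))); have := normr_ge0 (theta k); nra.
have T_abs k : \int[P]_omega `|T k omega|%:E <= M%:E.
  apply: (@le_trans _ _ (\int[P]_omega (((T k omega - theta k) ^+ 2)%:E + (2 + fine S)%:E))).
    apply: ge0_le_integral => //.
    - by apply/measurable_EFinP; exact: measurableT_comp.
    - exact: emeasurable_funD.
    move=> omega _; rewrite -EFinD lee_fin.
    have := ler_normD (T k omega - theta k)%R (theta k); rewrite subrK.
    have := theta_le k; rewrite -(real_normK (num_real (T k omega - theta k)%R)).
    by have := normr_ge0 (T k omega - theta k)%R; nra.
  rewrite ge0_integralD//; last 2 first.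
  - by move=> omega _; rewrite lee_fin sqr_ge0.
  - by move=> omega _; rewrite lee_fin addr_ge0 ?fine_ge0.
  by rewrite integral_cst_probability /M (EFinD eps) leeD2r.
apply: (@le_lt_trans _ _ (\sum_(0 <= k <oo) M%:E * `|b k|%:E)).
  apply: lee_nneseries => [k _ _|k _]; first exact: integral_ge0.
  under eq_integral do rewrite normrM EFinM.
  rewrite ge0_integralZl//; last by apply/measurable_EFinP; exact: measurableT_comp.
  by rewrite muleC lee_wpmul2r// lee_fin.
by rewrite nneseriesZl// lte_mul_pinfty// lee_fin.
Qed.

Hypothesis bB : forall k, (`|b k| <= B)%R.

Lemma mean_square_smoothed_le :
  \sum_(0 <= k <oo) \int[P]_omega ((b k * T k omega - theta k) ^+ 2)%:E <=
  (2 * B)%:E * (eps%:E * \sum_(0 <= k <oo) `|b k|%:E) +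
  2%:E * \sum_(0 <= k <oo) ((b k - 1) ^+ 2 * theta k ^+ 2)%:E.
Proof.
have B0 : (0 <= B)%R := le_trans (normr_ge0 _) (bB 0%N).
have Bb0 k : (0 <= 2 * (B * `|b k|))%R := mulr_ge0 (ler0n _ _) (mulr_ge0 B0 (normr_ge0 _)).
have b0 k : 0 <= ((b k - 1) ^+ 2 * theta k ^+ 2)%:E by rewrite lee_fin mulr_ge0 ?sqr_ge0.
rewrite -nneseriesZl// -nneseriesZl; last by move=> k _; rewrite mule_ge0 ?lee_fin.
rewrite -nneseriesZl// -nneseriesD; last 2 first.
- by move=> k _ _; rewrite mule_ge0 ?mule_ge0 ?lee_fin// mulr_ge0.
- by move=> k _ _; rewrite mule_ge0 ?b0.
apply: lee_nneseries => [k _ _|k _].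
  by apply: integral_ge0 => omega _; rewrite lee_fin sqr_ge0.
apply: (@le_trans _ _ (\int[P]_omega ((2 * (B * `|b k|))%:E * ((T k omega - theta k) ^+ 2)%:E +
    (2 * ((b k - 1) ^+ 2 * theta k ^+ 2))%:E))).
  apply: ge0_le_integral => //.
  - by move=> omega _; rewrite lee_fin sqr_ge0.
  - apply/measurable_EFinP; apply: measurable_funX; apply: measurable_funB => //.
    exact: measurable_funM.
  - by apply: emeasurable_funD => //; exact: measurable_funeM.
  move=> omega _; rewrite -EFinM -EFinD lee_fin.
  have bb : (b k ^+ 2 <= B * `|b k|)%R.
    by rewrite -(real_normK (num_real (b k))) expr2 ler_wpM2r.
  have := ler_wpM2r (sqr_ge0 (T k omega - theta k)%R) bb.
  have := sqr_ge0 (b k * (T k omega - theta k) - (b k - 1) * theta k)%R.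
  nra.
rewrite ge0_integralD//; last 3 first.
- by move=> omega _; rewrite -EFinM lee_fin; exact: mulr_ge0 (Bb0 k) (sqr_ge0 _).
- exact: measurable_funeM.
- by move=> omega _; rewrite EFinM mule_ge0.
rewrite integral_cst_probability -EFinM leeD2r//.
rewrite ge0_integralZl//; last 2 first.
- by move=> omega _; rewrite lee_fin sqr_ge0.
- by rewrite lee_fin; exact: Bb0.
apply: (@le_trans _ _ ((2 * (B * `|b k|))%:E * eps%:E)).
  by apply: lee_wpmul2l => //; rewrite lee_fin; exact: Bb0.
by rewrite -!EFinM lee_fin le_eqVlt; apply/orP; left; apply/eqP; ring.
Qed.

End smoothed_coefficients.

Lemma bounded_window (R : realType) (d : nat) (a : 'I_d -> R) n :
  (forall i, 0 < a i) -> bounded_set (window a n).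
Proof.
move=> a_gt0; exists (\sum_(i < d) n%:R * a i); split; first exact: num_real.
move=> M mM x /= Wx.
have na0 i : 0 <= n%:R * a i by exact: mulr_ge0 (ler0n _ _) (ltW (a_gt0 i)).
rewrite /Num.norm/= mx_normrE.
apply: bigmax_le => [|[i j] _] /=; first by rewrite (le_trans _ (ltW mM))// sumr_ge0.
rewrite ord1 (le_trans _ (ltW mM))//; apply: (@le_trans _ _ (n%:R * a j)).
  by rewrite ler_norml; exact: Wx.
by rewrite (bigD1 j)//= lerDl sumr_ge0.
Qed.

Lemma eseries_from1 (R : realType) (f : nat -> \bar R) : (forall k, 0 <= f k)%E ->
  (\sum_(1 <= k <oo) f k = \sum_(0 <= k <oo) f k.+1)%E.
Proof.
move=> f0; rewrite -(nneseries_addn 1 f0); apply: eq_eseriesr => k _.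
by rewrite addn1.
Qed.

Lemma cvgeZl0 (R : realType) (y : R) (u : (\bar R)^nat) : u n @[n --> \oo] --> 0%E ->
  (y%:E * u n)%E @[n --> \oo] --> 0%E.
Proof. by move=> u0; have := cvgeZl (y := y%:E) isT u0; rewrite mule0. Qed.

Theorem mainTheorem1 (R : realType) (d : nat) (d_gt0 : (0 < d)%N)
    (dO : measure_display) (Omega : measurableType dO) (P : probability Omega R)
    (X : Omega -> set 'rV[R]_d) (X_pp : point_process X)
    (rho : forall k : nat, k.-tuple 'rV[R]_d -> R)
    (rho_joint : forall k : nat, (1 <= k <= 4)%N -> joint_intensity P X (rho k))
    (g : R -> R)
    (g_isotropic : forall u v : 'rV[R]_d,
      normalized_intensity rho [tuple u; v] = g (enorm (v - u)))
    (g3 : 'rV[R]_d -> 'rV[R]_d -> R)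
    (g3_invariant : forall v1 v2 v3 : 'rV[R]_d,
      normalized_intensity rho [tuple v1; v2; v3] = g3 (v2 - v1) (v3 - v1))
    (g4 : 'rV[R]_d -> 'rV[R]_d -> 'rV[R]_d -> R)
    (g4_invariant : forall v1 v2 v3 v4 : 'rV[R]_d,
      normalized_intensity rho [tuple v1; v2; v3; v4]
      = g4 (v2 - v1) (v3 - v1) (v4 - v1))
    (a : 'I_d -> R) (a_gt0 : forall i, 0 < a i)
    (rmin rlen : R) (rmin_ge0 : 0 <= rmin) (rlen_gt0 : 0 < rlen)
    (w : R -> R) (w_weight : weight_function rlen w)
    (phi : nat -> R -> R) (phi_basis : orthonormal_basis rlen w phi)
    (g_L2 : L2w rlen w (fun r => g (r + rmin)))
    (* psistar: filter of neighbourhoods in Psi of the possibly ideal limit point *)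
    (Psi : Type) (b : Psi -> nat -> R) (psi : nat -> Psi)
    (psistar : set_system Psi) (psistar_filter : Filter psistar)
    (V1 : exists rho_min rho_max : R, 0 < rho_min /\ rho_min < rho_max /\
      forall u, rho_min <= intensity rho u <= rho_max)
    (V2 : exists C2 C3 : R, forall h h1 h2 : 'rV[R]_d,
      annulus rmin rlen h -> annulus rmin rlen h1 -> annulus rmin rlen h2 ->
      g (enorm h) * w (enorm h - rmin) <= C2 * enorm h ^+ d.-1 /\
      g3 h1 h2 <= C3)
    (V3 : exists C4 : R,
      (ereal_sup [set \int[lebesgue_rV]_h3
                    `|g4 h1 h3 (h2 + h3)%R - g (enorm h1) * g (enorm h2)|%:E
                 | h1 in annulus rmin rlen & h2 in annulus rmin rlen]
       <= C4%:E)%E)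
    (S1_sup : exists B : R, forall (k : nat) (p : Psi), (1 <= k)%N -> `|b p k| <= B)
    (S1_sum : forall p : Psi, (\sum_(1 <= k <oo) `|b p k|%:E < +oo)%E)
    (S2_cvg : psi n @[n --> \oo] --> psistar)
    (S2_lim : forall m : nat, (1 <= m)%N ->
      \big[Num.max/0]_(1 <= k < m.+1) `|b p k - 1| @[p --> psistar] --> (0 : R))
    (S3 : (((volume (window a n))^-1)%:E * \sum_(1 <= k <oo) `|b (psi n) k|%:E)%E
          @[n --> \oo] --> 0%E) :
  MISE d P rmin rlen w g
    (orthogonal_series_estimator P X (intensity rho) rmin rlen w phi
       (b (psi n)) (window a n))
  @[n --> \oo] --> 0%E.
Proof.
have [rho_min [rho_max [rho_min_gt0 [_ rho_bounds]]]] := V1.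
have rho_ge u : rho_min <= intensity rho u by have /andP[] := rho_bounds u.
have [C2 [C3 V23]] := V2; have [C4 V4] := V3; have [B b_sup] := S1_sup.
have C2_ge0 : 0 <= Num.max 0 C2 by rewrite le_max lexx.
have C3_ge0 : 0 <= Num.max 0 C3 by rewrite le_max lexx.
have C4_ge0 : 0 <= Num.max 0 C4 by rewrite le_max lexx.
have V2g (h : 'rV[R]_d) : annulus rmin rlen h ->
    g (enorm h) * w (enorm h - rmin) <= Num.max 0 C2 * enorm h ^+ d.-1.
  move=> hh; have [+ _] := V23 h h h hh hh hh => /le_trans; apply.
  by rewrite ler_wpM2r ?exprn_ge0 ?enorm_ge0// le_max lexx orbT.
have V2g3 (h1 h2 : 'rV[R]_d) : annulus rmin rlen h1 -> annulus rmin rlen h2 ->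
    g3 h1 h2 <= Num.max 0 C3.
  move=> h1h h2h; have [_ +] := V23 h1 h1 h2 h1h h1h h2h => /le_trans; apply.
  by rewrite le_max lexx orbT.
have V3' (h1 h2 : 'rV[R]_d) : annulus rmin rlen h1 -> annulus rmin rlen h2 ->
    (\int[lebesgue_rV]_h3 `|g4 h1 h3 (h2 + h3)%R - g (enorm h1) * g (enorm h2)|%:E
      <= (Num.max 0 C4)%:E)%E.
  move=> h1h h2h; apply: (@le_trans _ _ C4%:E); last by rewrite lee_fin le_max lexx orbT.
  by apply: le_trans V4; apply: ereal_sup_ubound; exists h1 => //; exists h2.
have [mphi phi_orth _] := phi_basis.
have phi_norm k : (0 < k)%N ->
    (\int[lebesgue_measure]_(r in `]0%R, rlen[) (phi k r ^+ 2 * w r)%:E <= 1)%E.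
  move=> k0; rewrite le_eqVlt; apply/orP; left; apply/eqP.
  have := phi_orth k k k0 k0; rewrite eqxx => <-.
  by apply: eq_integral => r _; rewrite expr2.
set K := mse_constant d rho_min rlen w (Num.max 0 C2) (Num.max 0 C3) (Num.max 0 C4).
pose theta k := L2w_coef rlen w (fun r => g (r + rmin)) (phi k).
pose T n k omega := theta_hat (intensity rho) rmin rlen w (phi k) (window a n) (X omega).
pose vol n := volume (window a n).
have T_ok : \forall n \near \oo, forall k, (0 < k)%N ->
    measurable_fun setT (T n k) /\
    (\int[P]_omega ((T n k omega - theta k) ^+ 2)%:E <= (K / vol n)%:E)%E.
  near=> n => k k0.
  have n0 : (0 < n)%N by near: n; exists 1%N.
  have e_ge (h : 'rV[R]_d) : annulus rmin rlen h -> 2^-1 <= edge_correction (window a n) h.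
    move=> /andP[_ /ltW]; move: h; near: n.
    exact: near_edge_correction_ge.
  have W_fin : (lebesgue_rV (window a n) < +oo)%E by rewrite lebesgue_rV_window// ltry.
  have mW := measurable_window a n; have bW := bounded_window n a_gt0.
  have me := measurable_edge_correction a_gt0 n.
  split; first exact: (measurable_theta_hat_signed X_pp rho_joint rho_min_gt0 rho_ge
    rmin_ge0 w_weight mW bW me e_ge (mphi k k0)).
  exact: (mean_square_error_theta_hat_signed d_gt0 X_pp rho_joint rho_min_gt0 rho_ge
    g_isotropic g3_invariant g4_invariant rmin_ge0 rlen_gt0 w_weight g_L2 C2_ge0 C3_ge0
    C4_ge0 V2g V2g3 V3' mW bW W_fin (volume_window_gt0 a_gt0 n0) me
    (edge_correctionN a_gt0 n) e_ge (mphi k k0) (phi_norm k k0)).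
have theta_fin : (\sum_(0 <= k <oo) (theta k.+1 ^+ 2)%:E < +oo)%E.
  exact: (L2w_coef_sqr_fin w_weight phi_basis g_L2).
pose bn n k := b (psi n) k.+1.
have bn_fin n : (\sum_(0 <= k <oo) `|bn n k|%:E < +oo)%E.
  by have := S1_sum (psi n); rewrite eseries_from1// => k; rewrite lee_fin.
have bn_le n k : `|bn n k| <= B by exact: b_sup.
have bn1 k : bn n k @[n --> \oo] --> (1 : R).
  have max0 := cvg_comp _ _ S2_cvg (S2_lim k.+1 isT).
  apply/cvgrPdist_le => eps eps0; have /cvgrPdist_le/(_ _ eps0) := max0.
  apply: filterS => n; rewrite sub0r normrN distrC; apply: le_trans.
  apply: le_trans (ler_norm _).
  apply: (le_bigmax_seq (0 : R) (k.+1) xpredT (fun j => `|b (psi n) j - 1|)) => //.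
  by rewrite mem_index_iota ltnSn.
pose bound n : \bar R := ((sphere_area R d)%:E * (3%:E *
  ((2 * B)%:E * ((K / vol n)%:E * \sum_(0 <= k <oo) `|bn n k|%:E) +
   2%:E * \sum_(0 <= k <oo) ((bn n k - 1) ^+ 2 * theta k.+1 ^+ 2)%:E)))%E.
have bound0 : bound n @[n --> \oo] --> 0%E.
  have h1 : ((2 * B)%:E * ((K / vol n)%:E * \sum_(0 <= k <oo) `|bn n k|%:E))%E
      @[n --> \oo] --> 0%E.
    have := @cvgeZl0 _ (2 * B * K) _ S3; apply: cvg_trans.
    apply: near_eq_cvg; apply: nearW => n /=.
    by rewrite eseries_from1 ?lee_fin// !muleA -!EFinM -!mulrA.
  apply: cvgeZl0; apply: cvgeZl0.
  rewrite -[X in cvg_to _ (nbhs X)](adde0 0%E); apply: cvgeD => //; apply: cvgeZl0.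
  exact: bias_cvg bn_le bn1.
apply: (squeeze_cvge _ (@cvg_cst _ 0%E _ _ _) bound0).
near=> n; apply/andP; split.
  apply: mule_ge0; first by rewrite lee_fin ltW// sphere_area_gt0.
  have [mw w0 _] := w_weight.
  apply: integral_ge0 => r /=; rewrite in_itv/= => /andP[r1 r2].
  apply: mule_ge0; first by apply: expectation_ge0 => omega; exact: sqr_ge0.
  by rewrite lee_fin w0// subr_gt0 r1 ltrBlDl.
have Tn : forall k, (0 < k)%N -> measurable_fun setT (T n k) /\
    (\int[P]_omega ((T n k omega - theta k) ^+ 2)%:E <= (K / vol n)%:E)%E by near: n.
have mT k : measurable_fun setT (T n k.+1) by have [] := Tn k.+1 isT.
have T_err k : (\int[P]_omega ((T n k.+1 omega - theta k.+1) ^+ 2)%:E <= (K / vol n)%:E)%E.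
  by have [] := Tn k.+1 isT.
have mc k : (0 < k)%N -> measurable_fun setT (fun omega => b (psi n) k * T n k omega).
  by move=> k0; apply: measurable_funM => //; have [] := Tn k k0.
have c_fin := expectation_abs_smoothed_fin theta_fin mT T_err (bn_fin n).
apply: le_trans (MISE_le w_weight phi_basis g_L2 mc d
  (L2w_seriesP rmin w_weight phi_basis mc c_fin)) _.
apply: lee_wpmul2l; first by rewrite lee_fin ltW// sphere_area_gt0.
apply: lee_wpmul2l => //.
exact: (mean_square_smoothed_le mT T_err (bn_le n)).
Unshelve. all: by end_near.
Qed.
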